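(* Let $(\xi,\eta)$ be a random vector in $\mathbb{R}^2$ with $\mathbb{P}\{\xi>0\}>0$, $\eta>0$, and such that the distribution of $\xi$ is non-lattice. Suppose that $\mathbb{E}e^{\beta\xi}=1$ for some $\beta>0$, that $\alpha:=\mathbb{E}\,\xi e^{\beta\xi}<\infty$, and that $\sigma^2:=\mathbb{E}\,\xi^2e^{\beta\xi}-\alpha^2<\infty$. (1) Suppose in addition that $\mathbb{E}e^{\beta\xi}\eta^\beta<\infty$, $$\mathbb{E}\,|\xi|e^{\beta\xi}\eta^\beta<\infty\qquad\text{and}\qquad \mathbb{E}\,(\xi^++\log(1+\eta))^2e^{\beta\xi^+}(1+\eta)^\beta<\infty .$$ Let $c>0$ be the constant such that $\mathbb{P}\{D_\infty>x\}\sim c/x^\beta$ as $x\to\infty$. Then $$\mathbb{P}\{D_n>x\}=\frac{c}{x^\beta}\,\mathcal{N}_{0,\sigma^2}\!\left(\frac{n\alpha-\log x}{\sqrt{\alpha^{-1}\log x}}\right)+o(1/x^\beta)$$ as $x\to\infty$ uniformly in $n\ge0$. In particular, for $n>\alpha^{-1}\log x+U(x)\sqrt{\log x}$, where $U(x)\to\infty$, $$\mathbb{P}\{D_n>x\}\sim\mathbb{P}\{D_\infty>x\}\quad\text{as }x\to\infty .$$ (2) The same results hold for $\widetilde D_n$ (with $\widetilde D_\infty$ in place of $D_\infty$, and $c>0$ the constant such that $\mathbb{P}\{\widetilde D_\infty>x\}\sim c/x^\beta$) if the three moment conditions in (1) are replaced by $\mathbb{E}\,\eta^\beta<\infty$,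 $\mathbb{E}\,|\xi|\eta^\beta<\infty$ and $\mathbb{E}\,\eta^\beta\log^2(1+\eta)<\infty$.
   Context: Let $(\xi_k,\eta_k)$, $k\ge1$, be independent copies of $(\xi,\eta)$ (the components $\xi$ and $\eta$ may be dependent), $S_0:=0$, $S_n:=\xi_1+\dots+\xi_n$. Define $$D_n:=\sum_{k=1}^n \eta_k e^{S_k},\quad D_\infty:=\sum_{k=1}^\infty \eta_k e^{S_k},\quad \widetilde D_n:=\sum_{k=1}^n \eta_k e^{S_{k-1}},\quad \widetilde D_\infty:=\sum_{k=1}^\infty \eta_k e^{S_{k-1}},$$ with $D_0=\widetilde D_0=0$ (empty sums); the infinite series converge almost surely. Here $\xi^+=\max(\xi,0)$, $\mathcal{N}_{0,\sigma^2}(\cdot)$ denotes the cumulative distribution function of the normal law with mean $0$ and variance $\sigma^2$, and $u(x)\sim v(x)$ means $u(x)/v(x)\to1$. The existence of the constants $c>0$ with $\mathbb{P}\{D_\infty>x\}\sim c/x^\beta$ (when $\mathbb{E}e^{\beta\xi}\eta^\beta<\infty$), respectively $\mathbb{P}\{\widetilde D_\infty>x\}\sim c/x^\beta$ (when $\mathbb{E}\eta^\beta<\infty$), is a separate result of the paper under the first set of assumptions above. *)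

(* Defs.v *)
From HB Require Import structures.
From mathcomp Require Import all_boot all_order all_algebra.
From mathcomp Require Import all_classical all_reals all_analysis.
Set Implicit Arguments.
Unset Strict Implicit.
Unset Printing Implicit Defensive.
Import Order.TTheory GRing.Theory Num.Theory.
Import numFieldNormedType.Exports.
Local Open Scope classical_set_scope.
Local Open Scope ring_scope.

Definition sim {R : realType} (u v : R -> R) : Prop :=
  u x / v x @[x --> +oo%R] --> (1 : R).

(* normal_prob takes the standard deviation, here the variance s2 is given.
   The library value for s2 <= 0 is not the degenerate normal law. *)
Definition normal_cdf {R : realType} (s2 y : R) : R :=
  fine (normal_prob 0 (Num.sqrt s2) `]-oo, y]).

(* Concentrated on h * Z for some h > 0 (no shift): the lattice of renewal
   theory. *)
Definition lattice {d : measure_display} {T : measurableType d} {R : realType}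
    (P : probability T R) (X : T -> R) : Prop :=
  exists2 h : R, 0 < h & {ae P, forall t, exists k : int, X t = h * k%:~R}.

Definition same_law {d d' : measure_display} {T : measurableType d}
    {T' : measurableType d'} {R : realType} (P : probability T R)
    (X Y : T -> T') : Prop :=
  forall A : set T', measurable A -> P (X @^-1` A) = P (Y @^-1` A).

Definition independent_seq {d d' : measure_display} {T : measurableType d}
    {T' : measurableType d'} {R : realType} (P : probability T R)
    (X : nat -> T -> T') : Prop :=
  forall (J : seq nat) (A : nat -> set T'), uniq J ->
    (forall k, measurable (A k)) ->
    P (\bigcap_(k in [set` J]) (X k @^-1` A k)) =
    (\prod_(k <- J) P (X k @^-1` A k))%E.

(* Indices are shifted by one: xis k and etas k stand for xi_{k+1} and
   eta_{k+1}, so that S_n is the sum of xis 0, ..., xis (n - 1). *)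
Section perpetuities.
Context {T : Type} {R : realType}.
Variables xis etas : nat -> T -> R.

Definition walk (n : nat) (t : T) : R := \sum_(k < n) xis k t.

Definition perp (n : nat) (t : T) : R :=
  \sum_(k < n) etas k t * expR (walk k.+1 t).

Definition perp_oo (t : T) : \bar R :=
  (\sum_(0 <= k <oo) (etas k t * expR (walk k.+1 t))%:E)%E.

Definition perp_tilde (n : nat) (t : T) : R :=
  \sum_(k < n) etas k t * expR (walk k t).

Definition perp_tilde_oo (t : T) : \bar R :=
  (\sum_(0 <= k <oo) (etas k t * expR (walk k t))%:E)%E.

End perpetuities.

Section tails.
Context {d : measure_display} {T : measurableType d} {R : realType}.
Variable P : probability T R.

Definition tail (X : T -> R) (x : R) : R := fine (P [set t | x < X t]).

Definition etail (X : T -> \bar R) (x : R) : R :=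
  fine (P [set t | (x%:E < X t)%E]).

(* The o(1/x^beta) is uniform in n: the quantifier over n comes after the
   choice of the range of x. *)
Definition uniform_normal_tail (D : nat -> T -> R)
    (alpha s2 beta c : R) : Prop :=
  forall e : R, 0 < e -> \forall x \near +oo%R, forall n : nat,
    `|tail (D n) x
      - c / x `^ beta * normal_cdf s2
          ((n%:R * alpha - ln x) / Num.sqrt (alpha^-1 * ln x))|
    <= e / x `^ beta.

(* n is allowed to depend on x; as n is an arbitrary function of x, this is
   the same as uniformity over the admissible n. *)
Definition late_tail_equivalence (D : nat -> T -> R) (Doo : T -> \bar R)
    (alpha : R) : Prop :=
  forall U : R -> R, U x @[x --> +oo%R] --> +oo%R ->
  forall n : R -> nat,
    (\forall x \near +oo%R,
      alpha^-1 * ln x + U x * Num.sqrt (ln x) < (n x)%:R) ->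
    sim (fun x => tail (D (n x)) x) (etail Doo).

End tails.

(* Main.v *)
Require Import Defs.
From HB Require Import structures.
From mathcomp Require Import all_boot all_order all_algebra.
From mathcomp Require Import all_classical all_reals all_analysis.
From mathcomp Require Import measurable_realfun measurable_fun_approximation.
From mathcomp Require Import ring lra.
Import Order.TTheory GRing.Theory Num.Theory.
Import numFieldNormedType.Exports.
Local Open Scope classical_set_scope.
Local Open Scope ring_scope.

(** Absorbing the factor [expR xi] into [eta] reduces [D_n] to the form
    [D_n = zeta_1 + zeta_2 e^{S_1} + ... + zeta_n e^{S_{n-1}}].  Let [F] be the
    tail of [D_oo], so that [F z ~ c / z^beta].  Splitting the series after [n]
    terms gives
      [F x = E F ((x - D_n) e^{-S_n})
           = P{D_n > x} + E (F ((x - D_n) e^{-S_n}); D_n <= x)].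
    Let [P*] be the law tilted by [e^{beta S_n}].  Under [P*] the ratio
    [D_n e^{-S_n}] is tight away from [0] and [oo], uniformly in [n]: its last summand
    [zeta_n e^{-xi_n}] bounds it from below, and its moments of small order [th]
    satisfy a linear recursion that contracts because [E e^{(beta - th) xi} < 1].
    Hence the second term is
    [c x^{-beta} P*{S_n <= ln x}] up to [o(x^{-beta})], and
    [x^beta P{D_n > x}] is close to [c P*{S_n > ln x}].  Under [P*] the walk has
    mean [alpha] and variance [sigma2] per step, and the central limit theorem
    gives the normal profile; uniformity in [n] follows from monotonicity in [n]
    on a finite grid of levels.  The central limit theorem itself is proved by
    Lindeberg's replacement method, with a logistic function as smooth
    indicator. *)

(** The tilted law is never built as a measure: each statement about it is an integral against the
    weight [expR (beta * S n t)], of total mass 1. Independence enters through a single one-step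
    identity for the law of the pair (S_n, D_n), from which the tilted walk, the moment recursion
    and the renewal identity are all derived. F enters as the pointwise limit of the tails of D_m,
    so its renewal equation follows by monotone convergence from the one for D_{n+m}. Tightness is
    needed because z^beta F(z) is close to c only for large z. Up to small tilted probability, D_n
    <= x and S_n <= ln x then agree outside a window of bounded width for S_n around ln x; the
    window is negligible because the walk fluctuates on the scale of the square root of ln x.
    Positivity of alpha is that of a relative entropy. Non-latticeness yields sigma2 > 0: with zero
    variance, xi would be almost surely equal to alpha. *)

(** * Measurability and weighted moments *)

Lemma measurable_set_le {d} {T : measurableType d} {R : realType} (f g : T -> R) :
  measurable_fun setT f -> measurable_fun setT g ->
  measurable [set x | f x <= g x].
Proof.
move=> mf mg; rewrite -[X in measurable X]setTI.
exact: measurable_fun_le.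
Qed.

Lemma measurable_set_lt {d} {T : measurableType d} {R : realType} (f g : T -> R) :
  measurable_fun setT f -> measurable_fun setT g ->
  measurable [set x | f x < g x].
Proof.
move=> mf mg; rewrite (_ : [set x | _] = ~` [set x | g x <= f x]).
  by apply: measurableC; exact: measurable_set_le.
by apply/seteqP; split => x /=; rewrite ltNge => /negP.
Qed.

Section weighted_moments.
Context {d} {T : measurableType d} {R : realType}.
Variables (m : {measure set T -> \bar R}) (w X : T -> R).
Hypotheses (mw : measurable_fun setT w) (mX : measurable_fun setT X).
Hypothesis w0 : forall t, 0 <= w t.

Lemma ge0_integrable_EFin (f : T -> R) : measurable_fun setT f ->
  (forall t, 0 <= f t) -> (\int[m]_t (f t)%:E < +oo)%E ->
  m.-integrable setT (fun t => (f t)%:E).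
Proof.
move=> mf f0 intf; apply/integrableP; split; first exact/measurable_EFinP.
by under eq_integral do rewrite /= ger0_norm ?f0//.
Qed.

(** The domination |w X| <= w + w X^2 follows from w (|X| - 1)^2 >= 0. *)
Lemma integrable_weighted_first_moment :
  m.-integrable setT (fun t => (w t)%:E) ->
  m.-integrable setT (fun t => (w t * X t ^+ 2)%:E) ->
  m.-integrable setT (fun t => (w t * X t)%:E).
Proof.
move=> iw iw2.
apply: (le_integrable _ _ _ (integrableD _ iw iw2)) => //.
  by apply/measurable_EFinP; apply: measurable_funM.
move=> t _ /=; have wt := w0 t.
rewrite lee_fin normrM (ger0_norm wt) [`|w t + _|]ger0_norm; last first.
  by rewrite addr_ge0// mulr_ge0// sqr_ge0.
have : 0 <= w t * (`|X t| - 1) ^+ 2 by rewrite mulr_ge0 ?sqr_ge0.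
have : 0 <= w t * `|X t| by rewrite mulr_ge0.
have -> : X t ^+ 2 = `|X t| ^+ 2 by rewrite real_normK ?num_real.
by rewrite sqrrB1 => h1 h2; lra.
Qed.

End weighted_moments.
Lemma measurable_affine {R : realType} (a b : R) :
  measurable_fun setT (fun x : R => a + b * x).
Proof.
apply: measurable_funD; first exact: measurable_cst.
by apply: measurable_funM; [exact: measurable_cst|exact: measurable_id].
Qed.

Lemma measurable_natr_bool {d} {T : measurableType d} {R : realType} (A : T -> bool) :
  measurable [set t | A t] -> measurable_fun setT (fun t => (A t)%:R : R).
Proof.
move=> mA; rewrite (_ : (fun t => _) = \1_[set t | A t]).
  exact: measurable_indic.
apply/funext => t; rewrite indicE; congr (_%:R); congr nat_of_bool.
by apply/idP/idP; rewrite inE.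
Qed.

Lemma measurable_le_natr {d} {T : measurableType d} {R : realType} (f : T -> R) (b : R) :
  measurable_fun setT f -> measurable_fun setT (fun t => (f t <= b)%R%:R : R).
Proof.
move=> mf; apply: measurable_natr_bool.
exact: (measurable_set_le f (cst b)).
Qed.

(** Syntax-directed on the body under the binder. A difference is a sum with an opposite, so its
    clause stands before the one for sums; a bare opposite has no clause and has to be written
    [0 - f]. *)
Ltac solve_measurable :=
  first
    [ assumption
    | exact: measurable_cst | exact: measurable_id
    | exact: measurable_fst | exact: measurable_snd
    | lazymatch goal with
      | |- measurable_fun _ (fun x => pair (@?f x) (@?g x)) =>
          apply: (measurable_fun_pair (f := f) (g := g)); solve_measurable
      | |- measurable_fun _ (fun x => EFin (@?f x)) =>
          apply/measurable_EFinP; solve_measurable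
      | |- measurable_fun _ (fun x => GRing.add (@?f x) (GRing.opp (@?g x))) =>
          apply: (measurable_funB (f := f) (g := g)); solve_measurable
      | |- measurable_fun _ (fun x => GRing.add (@?f x) (@?g x)) =>
          apply: (measurable_funD (f := f) (g := g)); solve_measurable
      | |- measurable_fun _ (fun x => GRing.mul (@?f x) (@?g x)) =>
          apply: (measurable_funM (f := f) (g := g)); solve_measurable
      | |- measurable_fun _ (fun x => expR (@?f x)) =>
          apply: (measurableT_comp (@measurable_expR _) (g := f)); solve_measurable
      | |- measurable_fun _ (fun x => powR (@?f x) ?p) =>
          apply: (measurableT_comp (measurable_powR p) (g := f)); solve_measurable
      | |- measurable_fun _ (fun x => fst (@?f x)) =>
          apply: (measurableT_comp (@measurable_fst _ _ _ _) (g := f)); solve_measurable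
      | |- measurable_fun _ (fun x => snd (@?f x)) =>
          apply: (measurableT_comp (@measurable_snd _ _ _ _) (g := f)); solve_measurable
      | |- measurable_fun _ (fun x => ?h (@?f x)) =>
          match goal with
          | H : measurable_fun _ h |- _ =>
              apply: (measurableT_comp H (g := f)); solve_measurable
          | H : forall n, measurable_fun _ (_ n) |- _ =>
              apply: (measurableT_comp (H _) (g := f)); solve_measurable
          end
      end ].

(** * Gaussian integrals *)

Section gaussian.
Context {R : realType}.
Local Notation mu := (@lebesgue_measure R).
Implicit Types (s a b u x t : R).

Lemma ge0_integral_oppr (f : R -> \bar R) : measurable_fun [set: R] f ->
  (forall x, (0 <= f x)%E) -> (\int[mu]_x f (- x)%R = \int[mu]_x f x)%E.
Proof.
move=> mf f0.
rewrite [RHS](eq_measure_integral (pushforward mu (-%R : _ -> measurableTypeR R))).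
  by rewrite ge0_integral_pushforward.
by move=> A mA _; exact/esym/lebesgue_measureN.
Qed.

Lemma normal_pdf_oppr s x : s != 0 -> normal_pdf 0 s (- x) = normal_pdf 0 s x.
Proof. by move=> s0; rewrite normal_pdfE// /normal_fun !subr0 sqrrN. Qed.

Lemma is_derive_normal_pdf s x : s != 0 ->
  is_derive x 1 (fun z => - (s ^+ 2) * normal_pdf 0 s z) (x * normal_pdf 0 s x).
Proof.
move=> s0; rewrite normal_pdfE// /normal_fun.
have s20 : s ^+ 2 != 0 by rewrite expf_neq0.
apply: is_derive_eq.
rewrite !scaler0 !add0r /= !(addr0, subr0, scaler1) /GRing.scale /=.
move: (normal_peak s) (expR _) => p e.
by field.
Qed.

Lemma cvg_normal_pdf_pinfty s : 0 < s ->
  normal_pdf 0 s x @[x --> +oo%R] --> (0 : R).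
Proof.
move=> s0; rewrite normal_pdfE ?gt_eqF//.
rewrite -[X in _ --> X](mulr0 (normal_peak s)); apply: cvgMr; rewrite /normal_fun.
under eq_fun do rewrite subr0 mulNr.
apply: (cvg_comp (fun x : R => x ^+ 2 / (s ^+ 2 *+ 2)) (fun x => expR (- x))).
  2: exact: cvgr_expR.
apply: gt0_cvgMly; last first.
  apply/cvgryPge => A; near=> x.
  have x1 : 1 <= x by near: x; exact: nbhs_pinfty_ge.
  have Ax : A <= x by near: x; exact: nbhs_pinfty_ge.
  by rewrite (le_trans Ax)// expr2 ler_peMl// (le_trans ler01).
by rewrite invr_gt0 pmulrn_lgt0// exprn_gt0.
Unshelve. all: by end_near. Qed.

Lemma integral_tail_id_normal_pdf s t : 0 < s -> 0 <= t ->
  (\int[mu]_(x in `[t, +oo[) (x * normal_pdf 0 s x)%:E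
   = (s ^+ 2 * normal_pdf 0 s t)%:E)%E.
Proof.
move=> s0 t0; have s0' : s != 0 by rewrite gt_eqF.
have cpdf : continuous (normal_pdf 0 s) by exact: continuous_normal_pdf.
rewrite (@ge0_continuous_FTC2y _ _ (fun z => - (s ^+ 2) * normal_pdf 0 s z) t 0).
- by rewrite sub0e -EFinN mulNr opprK.
- by move=> x tx; rewrite mulr_ge0 ?normal_pdf_ge0 ?(le_trans t0).
- apply: continuous_subspaceT => x; apply: cvgM; first exact: cvg_id.
  exact: cpdf.
- by rewrite -[X in _ --> X](mulr0 (- s ^+ 2)); apply: cvgMr; exact: cvg_normal_pdf_pinfty.
- by move=> x _; have [] := is_derive_normal_pdf s x s0'.
- by apply: cvg_at_right_filter; apply: cvgMr; exact: cpdf.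
- move=> x _; rewrite derive1E.
  by have [_ ->] := is_derive_normal_pdf s x s0'.
Qed.

(** Tonelli in place of integration by parts: x^2 is the integral of x over y in [0, x]. After the
    exchange the inner integral of x times the density over x >= y is s^2 times the density at y. *)
Lemma integral_halfline_sqr_normal_pdf s : 0 < s ->
  (\int[mu]_(x in [set x | (0 <= x)%R]) (x ^+ 2 * normal_pdf 0 s x)%:E =
   (s ^+ 2)%:E * \int[mu]_(x in [set x | (0 <= x)%R]) (normal_pdf 0 s x)%:E)%E.
Proof.
move=> s0; pose D := [set x : R | 0 <= x].
have mD : measurable D by rewrite /D -set_itvcy.
pose A : set (R * R) := ([set p | 0 <= p.2] `&` [set p | p.2 <= p.1]).
have mA : measurable A.
  apply: measurableI.
    exact: (measurable_set_le (cst 0) snd).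
  exact: (measurable_set_le snd fst).
pose F (p : R * R) : \bar R := (\1_A p * (p.1 * normal_pdf 0 s p.1))%:E.
have mF : measurable_fun setT F.
  apply/measurable_EFinP; apply: measurable_funM; first exact: measurable_indic.
  apply: measurable_funM; first exact: measurable_fst.
  by apply: measurableT_comp; [exact: measurable_normal_pdf|exact: measurable_fst].
have F0 p : (0 <= F p)%E.
  rewrite lee_fin /F indicE; have [|_] := boolP (p \in A); last by rewrite mul0r.
  rewrite inE => -[/= p2 p1]; rewrite mul1r mulr_ge0 ?normal_pdf_ge0//.
  exact: le_trans p1.
have := fubini_tonelli (m1 := mu) (m2 := mu) F mF F0.
have -> : (\int[mu]_x \int[mu]_y F (x, y) =
   \int[mu]_(x in D) (x ^+ 2 * normal_pdf 0 s x)%:E)%E.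
  rewrite [RHS]integral_mkcond; apply: eq_integral => x _.
  rewrite patchE; case: ifPn => [|xD]; last first.
    rewrite integral0_eq// => y _; rewrite /F indicE memNset ?mul0r// => -[/= y0 yx].
    by move/negP: xD; apply; rewrite inE /D /=; exact: le_trans yx.
  rewrite inE /D /= => x0.
  transitivity (\int[mu]_(y in `[0%R, x]) (x * normal_pdf 0 s x)%:E)%E.
    rewrite [RHS]integral_mkcond; apply: eq_integral => y _.
    rewrite patchE /F indicE; have [yA|yA] := boolP ((x, y) \in A).
      by rewrite ifT ?mul1r//; move: yA; rewrite !inE /A /= in_itv /= => -[-> ->].
    rewrite mul0r ifN//; apply: contra yA; rewrite !inE /= in_itv /= /A /=.
    by move=> /andP[].
  rewrite integral_cst//= lebesgue_measure_itv /= lte_fin.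
  case: ltP => [_|x0']; first by rewrite -EFinB -EFinM subr0 expr2; congr (_%:E); ring.
  have -> : x = 0 by apply/eqP; rewrite eq_le x0 x0'.
  by rewrite mule0 expr2 !mul0r.
move=> ->.
have mpdf : measurable_fun D (fun x => (normal_pdf 0 s x)%:E).
  by apply: measurable_funTS; apply/measurable_EFinP; exact: measurable_normal_pdf.
rewrite -ge0_integralZl ?lee_fin ?sqr_ge0//; last first.
  by move=> x _; rewrite lee_fin normal_pdf_ge0.
rewrite [RHS]integral_mkcond; apply: eq_integral => y _.
rewrite patchE; case: ifPn => [|yD]; last first.
  rewrite integral0_eq// => x _; rewrite /F indicE memNset ?mul0r// => -[/= y0 _].
  by move/negP: yD; apply; rewrite inE.
rewrite inE /= => y0.
rewrite -EFinM -integral_tail_id_normal_pdf// [RHS]integral_mkcond.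
apply: eq_integral => x _; rewrite patchE /F indicE; have [xA|xA] := boolP ((x, y) \in A).
  by rewrite ifT ?mul1r//; move: xA; rewrite !inE /A /= in_itv /= andbT => -[_ ->].
rewrite mul0r ifN//; apply: contra xA; rewrite !inE /= in_itv /= /A /= andbT.
by move=> yx; split.
Qed.

Lemma integral_sqr_normal_pdf s : 0 < s ->
  (\int[mu]_x (normal_pdf 0 s x * x ^+ 2)%:E = (s ^+ 2)%:E)%E.
Proof.
move=> s0; have s0' : s != 0 by rewrite gt_eqF.
have cpdf : continuous (normal_pdf 0 s) by exact: continuous_normal_pdf.
under eq_integral do rewrite mulrC.
rewrite ge0_symfun_integralT; last 3 first.
- by move=> x; rewrite mulr_ge0 ?sqr_ge0 ?normal_pdf_ge0.
- move=> x; apply: cvgM; [exact: sqr_continuous|exact: cpdf].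
- by move=> x /=; rewrite sqrrN normal_pdf_oppr.
rewrite integral_halfline_sqr_normal_pdf// muleCA -ge0_symfun_integralT//; last 2 first.
- by move=> x; exact: normal_pdf_ge0.
- by move=> x /=; rewrite normal_pdf_oppr.
by rewrite integral_normal_pdf mule1.
Qed.

Lemma integrable_sqr_normal_pdf s : 0 < s ->
  mu.-integrable setT (fun x => (normal_pdf 0 s x * x ^+ 2)%:E).
Proof.
move=> s0; apply: ge0_integrable_EFin.
- by apply: measurable_funM; [exact: measurable_normal_pdf|exact: measurable_funX].
- by move=> x; rewrite mulr_ge0 ?sqr_ge0 ?normal_pdf_ge0.
- by rewrite integral_sqr_normal_pdf// ltry.
Qed.

(** The integrand is odd, so reflection exchanges its positive and negative parts. Integrability,
    from the second moment, lets the two equal integrals cancel. *)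
Lemma integral_id_normal_pdf s : 0 < s ->
  (\int[mu]_x (normal_pdf 0 s x * x)%:E = 0)%E.
Proof.
move=> s0; pose f (x : R) := normal_pdf 0 s x * x.
have mf : measurable_fun setT f.
  by apply: measurable_funM => //; exact: measurable_normal_pdf.
have fi : mu.-integrable setT (EFin \o f).
  apply: integrable_weighted_first_moment => //.
  - exact: measurable_normal_pdf.
  - by move=> x; exact: normal_pdf_ge0.
  - exact: integrable_normal_pdf.
  - exact: integrable_sqr_normal_pdf.
rewrite -[LHS]/(\int[mu]_x (f x)%:E)%E integralE.
have -> : (\int[mu]_x (EFin \o f)^\- x = \int[mu]_x (EFin \o f)^\+ x)%E.
  rewrite -[RHS]ge0_integral_oppr//; last first.
    by apply: measurable_funepos; exact/measurable_EFinP.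
  apply: eq_integral => x _; rewrite funeposE funenegE /= /f.
  by rewrite normal_pdf_oppr ?gt_eqF// mulrN EFinN.
by rewrite subee// integrable_pos_fin_num.
Qed.

Lemma normal_peakE s : 0 < s -> normal_peak s = s^-1 * (Num.sqrt (pi *+ 2))^-1.
Proof.
move=> s0; rewrite /normal_peak -mulrnAr sqrtrM ?sqr_ge0// sqrtr_sqr gtr0_norm//.
by rewrite invfM.
Qed.

Lemma normal_pdf_center m s x : s != 0 ->
  normal_pdf m s x = normal_pdf 0 s (x - m).
Proof. by move=> s0; rewrite !normal_pdfE// /normal_fun subr0. Qed.

Lemma integral_normal_pdf_affine s a u (f : R -> R) : 0 < s -> 0 < a ->
  continuous f -> (forall x, 0 <= f x) ->
  (\int[mu]_z (normal_pdf 0 s z * f (u + a * z))%:E =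
   \int[mu]_x (normal_pdf u (a * s) x * f x)%:E)%E.
Proof.
move=> s0 a0 cf f0.
have as0 : a * s != 0 by rewrite mulf_neq0 ?gt_eqF.
have dF x : is_derive x 1 (fun z => u + a * z) a.
  by apply: is_derive_eq; rewrite ?(scaler0, add0r, addr0) /GRing.scale /= ?mulr1 ?mul1r.
have F'E : (fun z : R => u + a * z)^`()%classic = cst a.
  by apply/funext => x; rewrite derive1E; exact: derive_val.
rewrite [RHS](@increasing_ge0_integration_by_substitutionT _ (fun z => u + a * z)).
- apply: eq_integral => z _; congr (_%:E).
  rewrite /= !fctE F'E /= mulrAC; congr (_ * _).
  rewrite !normal_pdfE ?gt_eqF// ?mulr_gt0// /normal_fun.
  rewrite mulrAC; congr (_ * _); last first.
    by congr expR; field; rewrite !gt_eqF.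
  by rewrite !normal_peakE ?mulr_gt0// [RHS]mulrAC; congr (_ / _); field; rewrite !gt_eqF.
- by move=> x y xy; rewrite ltrD2l ltr_pM2l.
- by rewrite F'E => ?; exact: cvg_cst.
- by rewrite F'E; exact: is_cvg_cst.
- by rewrite F'E; exact: is_cvg_cst.
- by move=> x; have [] := dF x.
- apply/cvgrNyPle => A; exists ((A - u) / a); split; first exact: num_real.
  by move=> x; rewrite ltr_pdivlMr// => /ltW xA; rewrite -lerBrDl mulrC.
- apply/cvgryPge => A; exists ((A - u) / a); split; first exact: num_real.
  by move=> x; rewrite ltr_pdivrMr// => /ltW xA; rewrite -lerBlDl mulrC.
- move=> x; apply: cvgM; [exact: continuous_normal_pdf|exact: cf].
- by move=> x; rewrite mulr_ge0 ?normal_pdf_ge0.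
Unshelve. all: by end_near. Qed.

(* Completing the square in [z]: prior times likelihood is marginal times
   posterior. *)
Lemma normal_pdf_bayes s a b u z x : 0 < s -> 0 < a -> 0 < b ->
  let c := Num.sqrt (a ^+ 2 + b ^+ 2) in
  normal_pdf 0 s z * normal_pdf (u + a * z) (b * s) x =
  normal_pdf u (c * s) x * normal_pdf (a * (x - u) / c ^+ 2) (b * s / c) z.
Proof.
move=> s0 a0 b0 c.
have ab0 : 0 < a ^+ 2 + b ^+ 2 by rewrite addr_gt0// exprn_gt0.
have c0 : 0 < c by rewrite sqrtr_gt0.
have c2 : c ^+ 2 = a ^+ 2 + b ^+ 2 by rewrite sqr_sqrtr// ltW.
clearbody c.
rewrite !normal_pdfE ?gt_eqF ?divr_gt0 ?mulr_gt0//.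
rewrite !normal_peakE ?divr_gt0 ?mulr_gt0// /normal_fun.
rewrite mulrACA [RHS]mulrACA -!expRD; congr (_ * expR _).
  rewrite mulrACA [RHS]mulrACA; congr (_ * _); field; by rewrite !gt_eqF.
rewrite ![(_ * _) ^+ 2]exprMn exprVn c2.
by field; rewrite !gt_eqF.
Qed.

(** The sum of two independent centred normal variables scaled by a and b is normal with scale sqrt
    (a^2 + b^2). Substituting x = u + a z + b z' in the inner integral and exchanging the integrals
    leaves, by [normal_pdf_bayes], a posterior density in z, which integrates to 1. Continuity of f
    serves the substitution. *)
Lemma normal_pdf_conv s a b u (f : R -> R) : 0 < s -> 0 < a -> 0 < b ->
  continuous f -> (forall x, 0 <= f x) ->
  (\int[mu]_z \int[mu]_z' (normal_pdf 0 s z *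
     (normal_pdf 0 s z' * f (u + a * z + b * z')))%:E =
   \int[mu]_z (normal_pdf 0 s z * f (u + Num.sqrt (a ^+ 2 + b ^+ 2) * z))%:E)%E.
Proof.
move=> s0 a0 b0 cf f0; set c := Num.sqrt _.
have c0 : 0 < c by rewrite sqrtr_gt0 addr_gt0// exprn_gt0.
have mf : measurable_fun setT f by exact: continuous_measurable_fun.
have mpdf m t : measurable_fun setT (normal_pdf m t) := measurable_normal_pdf m t.
have ge0_mpdf m t g : measurable_fun setT g ->
    measurable_fun setT (fun x => (normal_pdf m t x * g x)%:E).
  by move=> mg; apply/measurable_EFinP; exact: measurable_funM.
pose F (p : R * R) : \bar R := (normal_pdf 0 s p.1 *
  (normal_pdf (u + a * p.1) (b * s) p.2 * f p.2))%:E.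
have mF : measurable_fun setT F.
  apply/measurable_EFinP; apply: measurable_funM.
    by apply: measurableT_comp => //; exact: measurable_fst.
  apply: measurable_funM; last first.
    by apply: measurableT_comp => //; exact: measurable_snd.
  under eq_fun do rewrite normal_pdf_center ?mulf_neq0 ?gt_eqF//.
  apply: measurableT_comp => //; apply: measurable_funB; first exact: measurable_snd.
  apply: measurable_funD; first exact: measurable_cst.
  by apply: measurable_funM; [exact: measurable_cst|exact: measurable_fst].
have F0 p : (0 <= F p)%E by rewrite lee_fin !mulr_ge0 ?normal_pdf_ge0.
transitivity (\int[mu]_z \int[mu]_x F (z, x))%E.
  apply: eq_integral => z _; under eq_integral do rewrite EFinM.
  rewrite ge0_integralZl//; last 3 first.
  - apply: ge0_mpdf; apply: (measurableT_comp mf).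
    exact: measurable_affine.
  - by move=> x _; rewrite lee_fin mulr_ge0 ?normal_pdf_ge0.
  - by rewrite lee_fin normal_pdf_ge0.
  rewrite integral_normal_pdf_affine// -ge0_integralZl//; last 3 first.
  - exact: ge0_mpdf.
  - by move=> x _; rewrite lee_fin mulr_ge0 ?normal_pdf_ge0.
  - by rewrite lee_fin normal_pdf_ge0.
rewrite (fubini_tonelli (m1 := mu) (m2 := mu) F mF F0) integral_normal_pdf_affine//.
apply: eq_integral => x _; rewrite /F /=.
under eq_integral do rewrite mulrA normal_pdf_bayes// mulrAC EFinM.
rewrite ge0_integralZl//; last 3 first.
- by apply/measurable_EFinP; exact: mpdf.
- by move=> z _; rewrite lee_fin normal_pdf_ge0.
- by rewrite lee_fin mulr_ge0 ?normal_pdf_ge0.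
by rewrite integral_normal_pdf mule1.
Qed.

End gaussian.

(** * The logistic function and Lindeberg replacement *)

Section logistic.
Context {R : realType}.
Implicit Types t u h x : R.

(** Decreasing in [t], hence a smooth indicator of left half-lines. Since l' = - l (1 - l), its
    derivatives [logistic1] to [logistic3] are polynomials in l, and bounding them amounts to
    polynomial inequalities on (0, 1). *)
Definition logistic t : R := (1 + expR t)^-1.
Local Notation l := logistic.
Definition logistic1 t : R := - (l t * (1 - l t)).
Definition logistic2 t : R := l t * (1 - l t) * (1 - 2 * l t).
Definition logistic3 t : R := - (l t * (1 - l t) * (1 - 6 * l t + 6 * l t ^+ 2)).

Lemma logistic_gt0 t : 0 < l t.
Proof. by rewrite invr_gt0 addr_gt0// expR_gt0. Qed.

Lemma logistic_lt1 t : l t < 1.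
Proof. by rewrite invf_lt1 ?addr_gt0 ?expR_gt0// ltrDl expR_gt0. Qed.

Lemma is_derive_logistic t : is_derive t 1 l (logistic1 t).
Proof.
have e0 : 1 + expR t != 0 by rewrite gt_eqF// addr_gt0// expR_gt0.
have de : is_derive t 1 (fun x : R => 1 + expR x) (expR t).
  by apply: is_derive_eq; rewrite add0r [LHS]mul1r.
rewrite (_ : logistic1 t = - (1 + expR t) ^- 2 *: expR t).
  exact: (@is_deriveV _ (fun x => 1 + expR x) t).
by rewrite /logistic1 /l /GRing.scale /=; field.
Qed.

Lemma is_derive_logistic1 t : is_derive t 1 logistic1 (logistic2 t).
Proof.
have h := is_derive_logistic t.
apply: is_derive_eq; rewrite /logistic2 /logistic1 /GRing.scale /=.
by ring.
Qed.

Lemma is_derive_logistic2 t : is_derive t 1 logistic2 (logistic3 t).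
Proof.
have h := is_derive_logistic t.
apply: is_derive_eq; rewrite /logistic3 /logistic1 /GRing.scale /=.
by ring.
Qed.

Lemma logistic2_le1 t : `|logistic2 t| <= 1.
Proof.
rewrite /logistic2; have := logistic_gt0 t; have := logistic_lt1 t.
by move: (l t) => y y1 y0; rewrite ler_norml; apply/andP; split; nra.
Qed.

Lemma logistic3_le1 t : `|logistic3 t| <= 1.
Proof.
rewrite /logistic3; have := logistic_gt0 t; have := logistic_lt1 t.
move: (l t) => y y1 y0.
have a0 : 0 < y * (1 - y) by nra.
have a1 : y * (1 - y) <= 4^-1 by have := sqr_ge0 (y - 2^-1); nra.
have -> : 1 - 6 * y + 6 * y ^+ 2 = 1 - 6 * (y * (1 - y)) by ring.
by move: (y * (1 - y)) a0 a1 => z z0 z1; rewrite ler_norml; apply/andP; split; nra.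
Qed.

(** The mean value theorem gives up the factor 1 / (k + 1) that integration would yield; only the
    order of vanishing at [t] matters. Iterated, it produces Taylor bounds. *)
Lemma le_norm_of_derive (phi phi' : R -> R) t (C : R) k :
  (forall x, is_derive x 1 phi (phi' x)) -> phi t = 0 ->
  (forall x, `|phi' x| <= C * `|x - t| ^+ k) ->
  forall u, `|phi u| <= C * `|u - t| ^+ k.+1.
Proof.
move=> dphi phit le_phi' u.
have C0 : 0 <= C.
  have := le_phi' (t + 1); rewrite addrAC subrr add0r normr1 expr1n mulr1.
  exact: le_trans.
have cphi : continuous phi.
  by move=> x; apply/differentiable_continuous/derivable1_diffP; have [] := dphi x.
have step c : `|c - t| <= `|u - t| ->
    `|phi' c| * `|u - t| <= C * `|u - t| ^+ k.+1.
  move=> ct; rewrite exprSr mulrA ler_wpM2r// (le_trans (le_phi' c))//.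
  by rewrite ler_wpM2l// lerXn2r ?nnegrE.
have [tu|ut] := leP t u.
  have [c /[!in_itv]/= /andP[tc cu]] := MVT_segment tu (fun x _ => dphi x)
    (continuous_subspaceT cphi).
  rewrite phit subr0 => ->; rewrite normrM; apply: step.
  by rewrite !ger0_norm ?subr_ge0// lerB.
have [c /[!in_itv]/= /andP[uc ct]] := MVT_segment (ltW ut) (fun x _ => dphi x)
  (continuous_subspaceT cphi).
rewrite phit sub0r => /eqP; rewrite eqr_oppLR => /eqP ->.
rewrite normrN normrM distrC [X in _ * X <= _]distrC distrC; apply: step.
by rewrite !ler0_norm ?subr_le0 ?(ltW ut)// lerN2 lerB.
Qed.

(** Two bounds are combined: the third derivative gives |h|^3, the boundedness of the second gives 2
    h^2. With only a second moment at hand, the minimum keeps the remainder integrable and still of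
    smaller order than h^2 after integration. *)
Lemma logistic_taylor u h :
  `|l (u + h) - (l u + h * logistic1 u + h ^+ 2 / 2 * logistic2 u)|
  <= 2 * (h ^+ 2 * Num.min 1 `|h|).
Proof.
pose p2 x := logistic2 x - logistic2 u.
pose p1 x := logistic1 x - logistic1 u - (x - u) * logistic2 u.
pose p0 x := l x - l u - (x - u) * logistic1 u - (x - u) ^+ 2 / 2 * logistic2 u.
have d2 x : is_derive x 1 p2 (logistic3 x).
  by have h2 := is_derive_logistic2 x; apply: is_derive_eq; rewrite subr0.
have d1 x : is_derive x 1 p1 (p2 x).
  have h1 := is_derive_logistic1 x; apply: is_derive_eq.
  by rewrite /p2 /GRing.scale /=; ring.
have d0 x : is_derive x 1 p0 (p1 x).
  have h0 := is_derive_logistic x; apply: is_derive_eq.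
  by rewrite /p1 /GRing.scale /=; field.
have p10 : p1 u = 0 by rewrite /p1; ring.
have p00 : p0 u = 0 by rewrite /p0; ring.
have cubic : `|p0 (u + h)| <= 1 * `|u + h - u| ^+ 3.
  apply: (le_norm_of_derive _ _ _ _ _ d0 p00).
  apply: (le_norm_of_derive _ _ _ _ _ d1 p10).
  apply: (le_norm_of_derive _ _ _ _ 0 d2); first by rewrite /p2 subrr.
  by move=> x; rewrite expr0 mulr1; exact: logistic3_le1.
have quadr : `|p0 (u + h)| <= 2 * `|u + h - u| ^+ 2.
  apply: (le_norm_of_derive _ _ _ _ _ d0 p00).
  apply: (le_norm_of_derive _ _ _ _ 0 d1 p10).
  move=> x; rewrite expr0 mulr1 (le_trans (ler_normB _ _))//.
  have := logistic2_le1 x; have := logistic2_le1 u; lra.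
have p0E : l (u + h) - (l u + h * logistic1 u + h ^+ 2 / 2 * logistic2 u) = p0 (u + h).
  rewrite /p0 (_ : u + h - u = h); last by ring.
  by move: (l _) => z; ring.
have uh : u + h - u = h by ring.
rewrite p0E; rewrite uh in cubic quadr.
have h2 : `|h| ^+ 2 = h ^+ 2 by rewrite real_normK ?num_real.
rewrite /Num.min; case: ifP => _; first by rewrite mulr1 -h2.
rewrite (le_trans cubic)// -h2 -exprSr mul1r.
have : 0 <= `|h| ^+ 3 by exact: exprn_ge0.
lra.
Qed.

End logistic.

Section one_step.
Context {d} {T : measurableType d} {R : realType}.
Variables (m : {measure set T -> \bar R}) (w X : T -> R) (s2 : R).
Hypotheses (mw : measurable_fun setT w) (mX : measurable_fun setT X).
Hypothesis w0 : forall t, 0 <= w t.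
Hypothesis w_total : (\int[m]_t (w t)%:E = 1)%E.
Hypothesis w_mean : (\int[m]_t (w t * X t)%:E = 0)%E.
Hypothesis w_var : (\int[m]_t (w t * X t ^+ 2)%:E = s2%:E)%E.
Local Notation l := (@logistic R).

Let iw : m.-integrable setT (fun t => (w t)%:E).
Proof. by apply: ge0_integrable_EFin => //; rewrite w_total ltry. Qed.

Let w2_ge0 t : 0 <= w t * X t ^+ 2.
Proof. by rewrite mulr_ge0// sqr_ge0. Qed.

Let iw2 : m.-integrable setT (fun t => (w t * X t ^+ 2)%:E).
Proof.
apply: ge0_integrable_EFin; last by rewrite w_var ltry.
  by apply: measurable_funM => //; exact: measurable_funX.
exact: w2_ge0.
Qed.

Let iw1 : m.-integrable setT (fun t => (w t * X t)%:E).
Proof. exact: integrable_weighted_first_moment. Qed.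

Let remainder (h : R) (t : T) : R := w t * X t ^+ 2 * Num.min 1 (h * `|X t|).

Let remainder_ge0 h t : 0 <= h -> 0 <= remainder h t.
Proof.
by move=> h0; rewrite mulr_ge0 ?w2_ge0// le_min ler01/= mulr_ge0.
Qed.

Let remainder_le h t : remainder h t <= w t * X t ^+ 2.
Proof.
by rewrite /remainder ler_piMr ?w2_ge0// ge_min lexx.
Qed.

Let mremainder h : measurable_fun setT (remainder h).
Proof.
apply: measurable_funM; first by apply: measurable_funM => //; exact: measurable_funX.
apply: measurable_minr; first exact: measurable_cst.
apply: measurable_funM; first exact: measurable_cst.
exact: measurableT_comp.
Qed.

Let iremainder h : 0 <= h -> m.-integrable setT (fun t => (remainder h t)%:E).
Proof.
move=> h0; apply: le_integrable iw2 => //; first exact/measurable_EFinP.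
by move=> t _ /=; rewrite lee_fin !ger0_norm ?remainder_ge0 ?remainder_le ?w2_ge0.
Qed.

Let remainder_small (e : R) : 0 < e ->
  exists2 h, 0 < h & (\int[m]_t remainder h t)%R <= e.
Proof.
move=> e0.
pose f_ n t := (remainder n.+1%:R^-1 t)%:E.
have mf_ n : measurable_fun setT (f_ n) by apply/measurable_EFinP.
have cvf_ : {ae m, forall t, setT t -> f_ ^~ t @ \oo --> (cst 0%E : T -> \bar R) t}.
  apply: aeW => t _; apply: cvg_EFin; first exact: nearW.
  apply: (@squeeze_cvgr _ _ _ _ (cst 0) (fun n => w t * X t ^+ 2 * (n.+1%:R^-1 * `|X t|))).
  - apply: nearW => n; rewrite remainder_ge0//= ler_wpM2l ?w2_ge0//.
    by rewrite ge_min lexx orbT.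
  - exact: cvg_cst.
  - rewrite -[X in _ --> X](mulr0 (w t * X t ^+ 2)); apply: cvgMr.
    by rewrite -[X in _ --> X](mul0r `|X t|); apply: cvgMl; exact: cvg_harmonic.
have domf_ : {ae m, forall t n, setT t -> (`|f_ n t| <= (w t * X t ^+ 2)%:E)%E}.
  apply: aeW => t n _; rewrite lee_fin ger0_norm ?remainder_le//.
  by rewrite remainder_ge0.
have [_ _] := dominated_convergence measurableT mf_ (measurable_cst _) cvf_ iw2 domf_.
rewrite integral0 => cv.
have /fine_cvgP[_ /cvgrPdist_le/(_ _ e0)[N _ /(_ N (leqnn N))]] :
  (\int[m]_t (f_ n t)%E)%E @[n --> \oo] --> 0%:E by exact: cv.
rewrite sub0r normrN => le_e; exists N.+1%:R^-1; first by rewrite invr_gt0.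
exact: le_trans (ler_norm _) le_e.
Qed.

Let ilogistic u h : m.-integrable setT (fun t => (w t * l (u + h * X t))%:E).
Proof.
apply: le_integrable iw => //.
  apply/measurable_EFinP; apply: measurable_funM => //.
  apply: (measurableT_comp _ (measurableT_comp (measurable_affine u h) mX)).
  apply: continuous_measurable_fun => x.
  by apply/differentiable_continuous/derivable1_diffP; have [] := is_derive_logistic x.
move=> t _ /=; rewrite lee_fin !ger0_norm ?mulr_ge0 ?(ltW (logistic_gt0 _))//.
by rewrite ler_piMr// ltW// logistic_lt1.
Qed.

(** The Taylor remainder does not depend on [u], so the estimate is uniform in the starting point
    and can be used at a random one. Total mass, mean and variance of the weight account for the
    three Taylor terms; dominated convergence makes the remainder small. *)
Lemma logistic_one_step (e : R) : 0 < e -> exists2 h0, 0 < h0 &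
  forall h u, 0 < h <= h0 ->
  `|(\int[m]_t (w t * l (u + h * X t)))%R
     - (l u + h ^+ 2 / 2 * s2 * logistic2 u)| <= e * h ^+ 2.
Proof.
move=> e0; have e20 : 0 < e / 2 by rewrite divr_gt0.
have [h0 h00 small] := remainder_small _ e20.
exists h0 => // h u /andP[hgt0 hle].
have h0' := ltW hgt0.
pose main t := l u * w t + h * logistic1 u * (w t * X t)
  + h ^+ 2 / 2 * logistic2 u * (w t * X t ^+ 2).
have i1 := integrableZl measurableT (l u) iw.
have i2 := integrableZl measurableT (h * logistic1 u) iw1.
have i3 := integrableZl measurableT (h ^+ 2 / 2 * logistic2 u) iw2.
have i12 := integrableD measurableT i1 i2.
have imain : m.-integrable setT (EFin \o main) := integrableD measurableT i12 i3.
have mainE : (\int[m]_t main t)%R = l u + h ^+ 2 / 2 * s2 * logistic2 u.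
  rewrite /main !RintegralD// !RintegralZl// /Rintegral w_total w_mean w_var /=.
  by ring.
rewrite -mainE -RintegralB//; last exact: ilogistic.
apply: (le_trans (le_normr_Rintegral _ _)) => //.
  exact: (integrableB measurableT (ilogistic u h) imain).
apply: (@le_trans _ _ (\int[m]_t (2 * h ^+ 2 * remainder h t))%R).
  apply: le_Rintegral => //.
  - apply: integrable_norm.
    exact: (integrableB measurableT (ilogistic u h) imain).
  - exact: (integrableZl measurableT (2 * h ^+ 2) (iremainder _ h0')).
  move=> t _.
  have -> : w t * l (u + h * X t) - main t = w t * (l (u + h * X t) -
     (l u + (h * X t) * logistic1 u + (h * X t) ^+ 2 / 2 * logistic2 u)).
    by rewrite /main; move: (l _) => z; field.
  rewrite normrM (ger0_norm (w0 t)).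
  apply: (le_trans (ler_wpM2l (w0 t) (logistic_taylor _ _))).
  rewrite normrM (ger0_norm h0') /remainder le_eqVlt; apply/orP; left; apply/eqP.
  by move: (Num.min _ _) => z; ring.
rewrite RintegralZl//; last exact: iremainder.
(* The remainder increases with the step size, so its bound at [h0] serves every [h <= h0]. *)
have : (\int[m]_t remainder h t)%R <= e / 2.
  apply: le_trans small; apply: le_Rintegral => //; [exact: iremainder| |].
    by apply: iremainder; exact: ltW.
  move=> t _; rewrite /remainder ler_wpM2l ?w2_ge0//.
  by rewrite le_min !ge_min lexx/= ler_wpM2r ?orbT.
have : 0 <= h ^+ 2 by rewrite sqr_ge0.
by move: (h ^+ 2) (Rintegral _ _ _) => y z; nra.
Qed.

Lemma logistic_one_stepE u h :
  (\int[m]_t (w t * l (u + h * X t))%:E =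
   ((\int[m]_t (w t * l (u + h * X t)))%R)%:E)%E.
Proof. by rewrite /Rintegral fineK//; exact: integrable_fin_num (ilogistic u h). Qed.

End one_step.

(** Two increments with the same mean and variance share one expansion up to order h^2. The estimate
    is one-sided and will be used twice, with the walk and the normal law in exchanged roles. *)
Lemma logistic_one_step_compare {R : realType} {d1 d2}
  {T1 : measurableType d1} {T2 : measurableType d2}
  (m1 : {measure set T1 -> \bar R}) (m2 : {measure set T2 -> \bar R})
  (w1 X1 : T1 -> R) (w2 X2 : T2 -> R) (s2 : R) :
  measurable_fun setT w1 -> measurable_fun setT X1 -> (forall t, 0 <= w1 t) ->
  (\int[m1]_t (w1 t)%:E = 1)%E -> (\int[m1]_t (w1 t * X1 t)%:E = 0)%E ->
  (\int[m1]_t (w1 t * X1 t ^+ 2)%:E = s2%:E)%E ->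
  measurable_fun setT w2 -> measurable_fun setT X2 -> (forall t, 0 <= w2 t) ->
  (\int[m2]_t (w2 t)%:E = 1)%E -> (\int[m2]_t (w2 t * X2 t)%:E = 0)%E ->
  (\int[m2]_t (w2 t * X2 t ^+ 2)%:E = s2%:E)%E ->
  forall e, 0 < e -> exists2 h0, 0 < h0 & forall h u, 0 < h <= h0 ->
  (\int[m1]_t (w1 t * logistic (u + h * X1 t))%:E <=
   \int[m2]_t (w2 t * logistic (u + h * X2 t))%:E + (e * h ^+ 2)%:E)%E.
Proof.
move=> mw1 mX1 w10 w11 w1m w1v mw2 mX2 w20 w21 w2m w2v e e0.
have e20 : 0 < e / 2 by rewrite divr_gt0.
have [h1 h10 H1] := logistic_one_step m1 w1 X1 s2 mw1 mX1 w10 w11 w1m w1v _ e20.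
have [h2 h20 H2] := logistic_one_step m2 w2 X2 s2 mw2 mX2 w20 w21 w2m w2v _ e20.
exists (Num.min h1 h2); first by rewrite lt_min h10.
move=> h u /andP[hgt0]; rewrite le_min => /andP[hh1 hh2].
rewrite (logistic_one_stepE m1 w1 X1)// (logistic_one_stepE m2 w2 X2)//.
rewrite -EFinD lee_fin.
have := H1 h u; rewrite hgt0 hh1 => /(_ isT); rewrite ler_norml => /andP[_ H1'].
have := H2 h u; rewrite hgt0 hh2 => /(_ isT); rewrite ler_norml => /andP[H2' _].
move: H1' H2'; move: (Rintegral _ _ _) (Rintegral _ _ _) => a b.
by move: (logistic u + _) => c; lra.
Qed.

(** * Law of a random recursion *)

Section recursion_law.
Context {d dS dE} {T : measurableType d} {S : measurableType dS}
  {E : measurableType dE} {R : realType} (P : probability T R).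
Local Open Scope ereal_scope.

(** Both sides are finite measures in [H] that agree on rectangles, a generating class stable under
    intersection. With [F] an event of the future, independence passes from the pair (state, input)
    to any function of it. *)
Lemma joint_law_indep_event (W : T -> S) (V : T -> E) (F : set T) :
  measurable_fun setT W -> measurable_fun setT V -> measurable F ->
  (forall B A, measurable B -> measurable A ->
    P (W @^-1` B `&` V @^-1` A `&` F) = P (W @^-1` B `&` V @^-1` A) * P F) ->
  forall H : set (S * E), measurable H ->
    P ([set t | H (W t, V t)] `&` F) = P [set t | H (W t, V t)] * P F.
Proof.
move=> mW mV mF rectE H mH.
have mWV : measurable_fun setT (fun t => (W t, V t)) by exact: measurable_fun_pair.
pose WV : {mfun T >-> (S * E)%type} :=
  HB.pack (fun t => (W t, V t)) (isMeasurableFun.Build _ _ _ _ _ mWV).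
have PF0 : (0 <= fine (P F))%R by rewrite fine_ge0.
have PFE : (fine (P F))%:E = P F by rewrite fineK// fin_num_measure.
pose m1 := pushforward (mrestr P mF) WV.
pose m2 := mscale (NngNum PF0) (distribution P WV).
pose C : set (set (S * E)) :=
  [set C | exists A, measurable A /\ exists B, measurable B /\ C = A `*` B].
have -> : P ([set t | H (W t, V t)] `&` F) = m1 H by [].
have m2E H' : m2 H' = P [set t | H' (W t, V t)] * P F.
  by rewrite /m2 /mscale /= PFE muleC.
rewrite -m2E.
apply: (measure_unique C (fun=> setT)) => //.
- rewrite measurable_prod_measurableType //; congr (<<s _ >>).
  rewrite predeqE => Y; split=> [[A mA [B mB <-]]|[A [mA [B [mB ->]]]]].
    by exists A; split => //; exists B.
  by exists A => //; exists B.
- move=> _ _ [X1 [mX1 [X2 [mX2 ->]]]] [Y1 [mY1 [Y2 [mY2 ->]]]].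
  rewrite -setXI; exists (X1 `&` Y1); split; first exact: measurableI.
  by exists (X2 `&` Y2); split => //; exact: measurableI.
- by move=> _; exists setT; split => //; exists setT; split => //; rewrite setXTT.
- by rewrite bigcup_const//; exists 0%N.
- move=> _ [A1 [mA1 [A2 [mA2 ->]]]].
  by rewrite [RHS]m2E; exact: rectE.
- move=> _; rewrite [X in X < _](_ : _ = P F) ?ltey_eq ?fin_num_measure//.
  by rewrite /m1 /= /pushforward /mrestr preimage_setT setTI.
Qed.

Lemma joint_law_prod (W : T -> S) (V : T -> E) :
  measurable_fun setT W -> measurable_fun setT V ->
  (forall B A, measurable B -> measurable A ->
    P (W @^-1` B `&` V @^-1` A) = P (W @^-1` B) * P (V @^-1` A)) ->
  forall g : S * E -> \bar R, measurable_fun setT g -> (forall p, 0 <= g p) ->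
  \int[P]_t g (W t, V t) = \int[P]_t \int[P]_t' g (W t, V t').
Proof.
move=> mW mV rectE g mg g0.
have mWV : measurable_fun setT (fun t => (W t, V t)) by exact: measurable_fun_pair.
pose WV : {mfun T >-> (S * E)%type} :=
  HB.pack (fun t => (W t, V t)) (isMeasurableFun.Build _ _ _ _ _ mWV).
pose Wf : {mfun T >-> S} := HB.pack W (isMeasurableFun.Build _ _ _ _ _ mW).
pose Vf : {mfun T >-> E} := HB.pack V (isMeasurableFun.Build _ _ _ _ _ mV).
transitivity (\int[distribution P WV]_p g p).
  by rewrite ge0_integral_distribution.
rewrite (eq_measure_integral (distribution P Wf \x distribution P Vf)); last first.
  by move=> A mA _; apply/esym/product_measure_unique => // B C mB mC; exact: rectE.
rewrite fubini_tonelli1// ge0_integral_distribution//.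
- apply: eq_integral => t _ /=; rewrite /fubini_F ge0_integral_distribution//.
  exact: measurableT_comp.
- exact: measurable_fun_fubini_tonelli_F.
- by move=> s; exact: integral_ge0.
Qed.

Variables (Z : nat -> T -> E) (Z0 : T -> E) (phi : S * E -> S) (M : nat -> T -> S)
  (s0 : S).
Hypotheses (mZ : forall n, measurable_fun setT (Z n)) (mZ0 : measurable_fun setT Z0)
  (mphi : measurable_fun setT phi).
Hypothesis indepZ : independent_seq P Z.
Hypothesis lawZ : forall n, same_law P (Z n) Z0.
Hypotheses (M0 : forall t, M 0 t = s0)
  (MS : forall n t, M n.+1 t = phi (M n t, Z n t)).

Lemma measurable_recursion n : measurable_fun setT (M n).
Proof.
elim: n => [|n ih].
  by rewrite (_ : M 0 = cst s0); [exact: measurable_cst|apply/funext].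
rewrite (_ : M n.+1 = phi \o (fun t => (M n t, Z n t))); last exact/funext/MS.
by apply: measurableT_comp => //; exact: measurable_fun_pair.
Qed.

Let mpreim d' (U : measurableType d') (f : T -> U) (A : set U) :
  measurable_fun setT f -> measurable A -> measurable (f @^-1` A).
Proof. by move=> mf mA; rewrite -[X in measurable X]setTI; exact: mf. Qed.

Let mfuture (J : seq nat) (A : nat -> set E) : (forall k, measurable (A k)) ->
  measurable (\bigcap_(k in [set` J]) (Z k @^-1` A k)).
Proof.
move=> mA; apply: fin_bigcap_measurable => [|k _]; first exact: finite_seq.
exact: mpreim.
Qed.

(** Treats a condition on the current input as one more coordinate of a finite family, so that
    independence can be quoted for [n :: J]. *)
Let future_cons n J (A : nat -> set E) B : n \notin J ->
  \bigcap_(k in [set` n :: J]) (Z k @^-1` (if k == n then B else A k)) =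
  Z n @^-1` B `&` \bigcap_(k in [set` J]) (Z k @^-1` A k).
Proof.
move=> nJ; apply/seteqP; split=> [t Ht|t [tB tA] k].
  split; first by have /= := Ht n (mem_head _ _); rewrite eqxx.
  move=> k /= kJ; have /= := Ht k; rewrite inE kJ orbT => /(_ isT).
  by case: eqP => // kn; move: nJ; rewrite -kn kJ.
rewrite /= inE => /predU1P[->|kJ]; first by rewrite eqxx.
by case: eqP => [->//|_]; exact: tA.
Qed.

Let future_prod n J (A : nat -> set E) B : n \notin J -> uniq J ->
  measurable B -> (forall k, measurable (A k)) ->
  P (Z n @^-1` B `&` \bigcap_(k in [set` J]) (Z k @^-1` A k)) =
  P (Z n @^-1` B) * P (\bigcap_(k in [set` J]) (Z k @^-1` A k)).
Proof.
move=> nJ uJ mB mA; rewrite -future_cons// indepZ//; last 2 first.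
- by rewrite /= nJ.
- by move=> k; case: ifP.
rewrite big_cons eqxx indepZ//; congr (_ * _).
apply: eq_big_seq => k kJ; case: eqP => // kn.
by move: nJ; rewrite -kn kJ.
Qed.

(** Induction on [n]: the state at time n + 1 is a function of the state at time n and of the input
    [Z n], and a condition on [Z n] can be counted among those on the future of time n. At time 0
    the state is constant, so its events are full or empty. *)
Lemma recursion_indep_future n J (A : nat -> set E) (B : set S) :
  uniq J -> (forall k, k \in J -> (n <= k)%N) -> (forall k, measurable (A k)) ->
  measurable B ->
  P (M n @^-1` B `&` \bigcap_(k in [set` J]) (Z k @^-1` A k)) =
  P (M n @^-1` B) * P (\bigcap_(k in [set` J]) (Z k @^-1` A k)).
Proof.
elim: n J A B => [|n ih] J A B uJ nJ mA mB.
  have [Bs|Bs] := pselect (B s0).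
    rewrite (_ : M 0 @^-1` B = setT) ?setTI ?probability_setT ?mul1e//.
    by apply/seteqP; split => // t _ /=; rewrite M0.
  rewrite (_ : M 0 @^-1` B = set0) ?set0I ?measure0 ?mul0e//.
  by apply/seteqP; split => // t /=; rewrite M0.
have nnJ : n \notin J by apply/negP => /nJ; rewrite ltnn.
have MSE : M n.+1 @^-1` B = [set t | (phi @^-1` B) (M n t, Z n t)].
  by apply/seteqP; split => t /=; rewrite MS.
rewrite MSE; apply: joint_law_indep_event => //.
- exact: measurable_recursion.
- exact: mfuture.
- move=> B' A' mB' mA'.
  have ihT := ih [:: n] (fun=> A') B' isT _ (fun=> mA') mB'.
  rewrite -setIA -(future_cons _ _ _ _ nnJ) ih//; last 3 first.
  + by rewrite /= nnJ.
  + by move=> k; rewrite inE => /predU1P[->//|/nJ/ltnW].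
  + by move=> k; case: ifP.
  rewrite future_cons// future_prod// muleA; congr (_ * _).
  move: ihT; rewrite set_cons1 bigcap_set1 => ->// k.
  by rewrite inE => /eqP ->.
- by rewrite -[X in measurable X]setTI; exact: mphi.
Qed.

(** Independence of state and input turns the joint law into a product; the input is then replaced
    by the representative [Z0] of the common law. The analysis of the perpetuity uses independence
    only in this form. *)
Lemma recursion_law n (g : S -> \bar R) : measurable_fun setT g ->
  (forall s, 0 <= g s) ->
  \int[P]_t g (M n.+1 t) = \int[P]_t \int[P]_t' g (phi (M n t, Z0 t')).
Proof.
move=> mg g0; under eq_integral do rewrite MS.
have mgphi : measurable_fun setT (g \o phi) by exact: measurableT_comp.
rewrite (joint_law_prod (M n) (Z n) (measurable_recursion n) (mZ n) _ (g \o phi))//.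
- apply: eq_integral => t _.
  have mgt : measurable_fun setT (fun z => g (phi (M n t, z))).
    by apply: (measurableT_comp mgphi); exact: pair1_measurable.
  pose Zn : {mfun T >-> E} := HB.pack (Z n) (isMeasurableFun.Build _ _ _ _ _ (mZ n)).
  pose Z0f : {mfun T >-> E} := HB.pack Z0 (isMeasurableFun.Build _ _ _ _ _ mZ0).
  transitivity (\int[distribution P Zn]_z g (phi (M n t, z))).
    by rewrite ge0_integral_distribution.
  transitivity (\int[distribution P Z0f]_z g (phi (M n t, z))).
    by apply: eq_measure_integral => A mA _; exact: lawZ.
  by rewrite ge0_integral_distribution.
- move=> B A mB mA.
  have := recursion_indep_future n [:: n] (fun=> A) B isT _ (fun=> mA) mB.
  rewrite set_cons1 bigcap_set1; apply => k.
  by rewrite inE => /eqP ->.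
- by move=> p; exact: g0.
Qed.

End recursion_law.

(** * The central limit theorem under the tilted law *)

(** An additive error survives averaging unchanged because the weight has mass 1; so n replacements
    cost n times the error of one. Nonnegative extended values avoid any integrability condition. *)
Lemma weighted_average_le {d} {T : measurableType d} {R : realType}
  (m : {measure set T -> \bar R}) (w : T -> R) (F G : T -> \bar R) (c : R) :
  measurable_fun setT w -> (forall t, 0 <= w t) -> (\int[m]_t (w t)%:E = 1)%E ->
  measurable_fun setT F -> measurable_fun setT G ->
  (forall t, 0 <= F t)%E -> (forall t, 0 <= G t)%E -> 0 <= c ->
  (forall t, F t <= G t + c%:E)%E ->
  (\int[m]_t ((w t)%:E * F t) <= \int[m]_t ((w t)%:E * G t) + c%:E)%E.
Proof.
move=> mw w0 w1 mF mG F0 G0 c0 FG.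
have mw' : measurable_fun setT (fun t => (w t)%:E) by exact/measurable_EFinP.
have w0' t : (0 <= (w t)%:E)%E by rewrite lee_fin.
apply: (@le_trans _ _ (\int[m]_t ((w t)%:E * G t + (w t)%:E * c%:E))%E).
  apply: ge0_le_integral => //.
  - by move=> t _; rewrite mule_ge0.
  - exact: emeasurable_funM.
  - apply: emeasurable_funD; first exact: emeasurable_funM.
    by apply: emeasurable_funM => //; exact: measurable_cst.
  - by move=> t _; rewrite -ge0_muleDr ?lee_fin// lee_wpmul2l.
rewrite ge0_integralD//.
- rewrite leeD2l// ge0_integralZr//.
  by rewrite w1 mul1e.
- by move=> t _; rewrite mule_ge0.
- exact: emeasurable_funM.
- by move=> t _; rewrite mule_ge0.
- by apply: emeasurable_funM => //; exact: measurable_cst.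
Qed.

(** * Gaussian smoothing of the logistic function *)

Section gaussian_smoothing.
Context {R : realType}.
Variable s : R.
Hypothesis s0 : 0 < s.
Local Notation mu := (@lebesgue_measure R).
Local Notation l := (@logistic R).
Local Notation pdf := (normal_pdf 0 s).

Lemma continuous_logistic : continuous l.
Proof.
move=> x; apply/differentiable_continuous/derivable1_diffP.
by have [] := is_derive_logistic x.
Qed.

Lemma measurable_logistic : measurable_fun setT l.
Proof. exact: continuous_measurable_fun continuous_logistic. Qed.

(** The mean of l (u + a Z) for Z centred normal with standard deviation [s]; [a] records the
    Gaussian steps already put in place of walk increments. *)
Definition smoothed_logistic (a u : R) : \bar R :=
  (\int[mu]_z (pdf z * l (u + a * z))%:E)%E.

Lemma smoothed_logistic_ge0 a u : (0 <= smoothed_logistic a u)%E.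
Proof.
apply: integral_ge0 => z _.
by rewrite lee_fin mulr_ge0 ?normal_pdf_ge0 ?(ltW (logistic_gt0 _)).
Qed.

Lemma smoothed_logistic0 u : smoothed_logistic 0 u = (l u)%:E.
Proof.
rewrite /smoothed_logistic; under eq_integral do rewrite mul0r addr0 EFinM.
rewrite ge0_integralZr//.
- by rewrite integral_normal_pdf mul1e.
- by apply/measurable_EFinP; exact: measurable_normal_pdf.
- by move=> z _; rewrite lee_fin normal_pdf_ge0.
- by rewrite lee_fin ltW// logistic_gt0.
Qed.

Lemma measurable_smoothed_logistic a : measurable_fun setT (smoothed_logistic a).
Proof.
apply: (measurable_fun_fubini_tonelli_F (m2 := mu)
  (fun p : R * R => (pdf p.2 * l (p.1 + a * p.2))%:E)).
- apply/measurable_EFinP; apply: measurable_funM.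
    apply: measurableT_comp; first exact: measurable_normal_pdf.
    exact: measurable_snd.
  apply: measurableT_comp; first exact: measurable_logistic.
  apply: measurable_funD; first exact: measurable_fst.
  by apply: measurable_funM; [exact: measurable_cst|exact: measurable_snd].
- by move=> p; rewrite lee_fin mulr_ge0 ?normal_pdf_ge0 ?(ltW (logistic_gt0 _)).
Qed.

Lemma smoothed_logistic_conv a b u : 0 <= a -> 0 < b ->
  (\int[mu]_z ((pdf z)%:E * smoothed_logistic b (u + a * z)) =
   smoothed_logistic (Num.sqrt (a ^+ 2 + b ^+ 2)) u)%E.
Proof.
(* The telescoping starts from [a = 0], where the substitution u + a z degenerates. *)
move=> a0 b0; have [->|an0] := eqVneq a 0.
  under eq_integral do rewrite mul0r addr0.
  rewrite expr0n add0r sqrtr_sqr gtr0_norm// ge0_integralZr//.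
  - by rewrite integral_normal_pdf mul1e.
  - by apply/measurable_EFinP; exact: measurable_normal_pdf.
  - by move=> z _; rewrite lee_fin normal_pdf_ge0.
  - exact: smoothed_logistic_ge0.
have agt0 : 0 < a by rewrite lt_neqAle eq_sym an0.
rewrite [RHS]/smoothed_logistic -(normal_pdf_conv s a b u l)//; last 2 first.
- exact: continuous_logistic.
- by move=> x; rewrite ltW// logistic_gt0.
apply: eq_integral => z _; rewrite -ge0_integralZl//.
- apply/measurable_EFinP; apply: measurable_funM; first exact: measurable_normal_pdf.
  exact: measurableT_comp measurable_logistic (measurable_affine _ _).
- by move=> x _; rewrite lee_fin mulr_ge0 ?normal_pdf_ge0 ?(ltW (logistic_gt0 _)).
- by rewrite lee_fin normal_pdf_ge0.
Qed.

Context {d} {T : measurableType d} (m : {sigma_finite_measure set T -> \bar R}).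
Variables (w X : T -> R).
Hypotheses (mw : measurable_fun setT w) (mX : measurable_fun setT X).
Hypothesis w0 : forall t, 0 <= w t.

Lemma smoothed_logistic_fubini (a h u : R) :
  (\int[m]_t ((w t)%:E * smoothed_logistic a (u + h * X t)) =
   \int[mu]_z ((pdf z)%:E * \int[m]_t (w t * l (u + a * z + h * X t))%:E))%E.
Proof.
pose F (p : T * R) : \bar R := (w p.1 * (pdf p.2 * l (u + h * X p.1 + a * p.2)))%:E.
have mF : measurable_fun setT F.
  apply/measurable_EFinP; apply: measurable_funM.
    by apply: measurableT_comp mw _; exact: measurable_fst.
  apply: measurable_funM.
    apply: measurableT_comp; first exact: measurable_normal_pdf.
    exact: measurable_snd.
  apply: measurableT_comp; first exact: measurable_logistic.
  apply: measurable_funD.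
    apply: (measurableT_comp (measurable_affine u h)).
    by apply: measurableT_comp mX _; exact: measurable_fst.
  by apply: measurable_funM; [exact: measurable_cst|exact: measurable_snd].
have F0 p : (0 <= F p)%E.
  by rewrite lee_fin !mulr_ge0 ?normal_pdf_ge0 ?(ltW (logistic_gt0 _)).
transitivity (\int[m]_t \int[mu]_z F (t, z))%E.
  apply: eq_integral => t _; rewrite -ge0_integralZl//.
  - apply/measurable_EFinP; apply: measurable_funM; first exact: measurable_normal_pdf.
    exact: measurableT_comp measurable_logistic (measurable_affine _ _).
  - by move=> x _; rewrite lee_fin mulr_ge0 ?normal_pdf_ge0 ?(ltW (logistic_gt0 _)).
  - by rewrite lee_fin.
rewrite (fubini_tonelli (m1 := m) (m2 := mu) F mF F0).
apply: eq_integral => z _; rewrite -ge0_integralZl//.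
- by apply: eq_integral => t _; rewrite /F/= -EFinM mulrCA addrAC.
- apply/measurable_EFinP; apply: measurable_funM => //.
  apply: measurableT_comp; first exact: measurable_logistic.
  exact: (measurableT_comp (measurable_affine _ h) mX).
- by move=> t _; rewrite lee_fin mulr_ge0 ?(ltW (logistic_gt0 _)).
- by rewrite lee_fin normal_pdf_ge0.
Qed.

Lemma measurable_logistic_mean (a h u : R) :
  measurable_fun setT (fun z : R => \int[m]_t (w t * l (u + a * z + h * X t))%:E)%E.
Proof.
apply: (measurable_fun_fubini_tonelli_F (m2 := m)
  (fun p : R * T => (w p.2 * l (u + a * p.1 + h * X p.2))%:E)).
- apply/measurable_EFinP; apply: measurable_funM.
    by apply: measurableT_comp mw _; exact: measurable_snd.
  apply: measurableT_comp; first exact: measurable_logistic.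
  apply: measurable_funD.
    apply: (measurableT_comp (measurable_affine u a)); exact: measurable_fst.
  apply: measurable_funM; first exact: measurable_cst.
  by apply: measurableT_comp mX _; exact: measurable_snd.
- by move=> p; rewrite lee_fin mulr_ge0 ?(ltW (logistic_gt0 _)).
Qed.

Lemma logistic_mean_ge0 (u h : R) :
  (0 <= \int[m]_t (w t * l (u + h * X t))%:E)%E.
Proof.
by apply: integral_ge0 => t _; rewrite lee_fin mulr_ge0 ?(ltW (logistic_gt0 _)).
Qed.

(** Replacement of one increment in the presence of smoothing. Tonelli moves the Gaussian average
    outside, so the hypothesis on the bare logistic applies at each shifted point u + a z; the new
    Gaussian step merges with the old ones by convolution. *)
Lemma smoothed_logistic_step_le (c a h u : R) : 0 <= a -> 0 < h -> 0 <= c ->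
  (forall v, (\int[m]_t (w t * l (v + h * X t))%:E <=
    smoothed_logistic h v + c%:E)%E) ->
  (\int[m]_t ((w t)%:E * smoothed_logistic a (u + h * X t)) <=
   smoothed_logistic (Num.sqrt (a ^+ 2 + h ^+ 2)) u + c%:E)%E.
Proof.
move=> a0 h0 c0 H; rewrite smoothed_logistic_fubini -smoothed_logistic_conv//.
apply: weighted_average_le => //.
- exact: measurable_normal_pdf.
- exact: normal_pdf_ge0.
- exact: integral_normal_pdf.
- exact: measurable_logistic_mean.
- exact: measurableT_comp (measurable_smoothed_logistic h) (measurable_affine _ _).
- by move=> z; exact: logistic_mean_ge0.
- by move=> z; exact: smoothed_logistic_ge0.
Qed.

Lemma smoothed_logistic_step_ge (c a h u : R) : 0 <= a -> 0 < h -> 0 <= c ->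
  (forall v, (smoothed_logistic h v <=
    \int[m]_t (w t * l (v + h * X t))%:E + c%:E)%E) ->
  (smoothed_logistic (Num.sqrt (a ^+ 2 + h ^+ 2)) u <=
   \int[m]_t ((w t)%:E * smoothed_logistic a (u + h * X t)) + c%:E)%E.
Proof.
move=> a0 h0 c0 H; rewrite smoothed_logistic_fubini -smoothed_logistic_conv//.
apply: weighted_average_le => //.
- exact: measurable_normal_pdf.
- exact: normal_pdf_ge0.
- exact: integral_normal_pdf.
- exact: measurableT_comp (measurable_smoothed_logistic h) (measurable_affine _ _).
- exact: measurable_logistic_mean.
- by move=> z; exact: smoothed_logistic_ge0.
- by move=> z; exact: logistic_mean_ge0.
Qed.

End gaussian_smoothing.

(** * Logistic approximation of indicators; regularity of the normal law *)

Section logistic_step.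
Context {R : realType}.
Implicit Types x y b r dl e : R.
Local Notation l := (@logistic R).

Lemma logisticN x : l (- x) = 1 - l x.
Proof.
by rewrite /logistic expRN; field; rewrite !gt_eqF ?addr_gt0 ?expR_gt0 ?ltr01.
Qed.

Lemma le_logistic x y : x <= y -> l y <= l x.
Proof.
by move=> xy; rewrite lef_pV2 ?posrE ?addr_gt0 ?expR_gt0// lerD2l ler_expR.
Qed.

Lemma logistic_le_inv x : 0 < x -> l x <= x^-1.
Proof.
move=> x0; rewrite lef_pV2 ?posrE ?addr_gt0 ?expR_gt0//.
have := expR_ge1Dx x; lra.
Qed.

(** The logistic of slope [r] is centred at b + dl: at b it is within 1 / (r dl) of 1, and at b + 2
    dl within 1 / (r dl) of 0. Hence it lies between the indicators of the half-lines ending at b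
    and at b + 2 dl, up to [e]. *)
Lemma indic_le_logistic r dl e b y : 0 < r -> 0 < dl -> (r * dl)^-1 <= e ->
  (y <= b)%R%:R <= l (r * (y - b - dl)) + e.
Proof.
move=> r0 dl0 re; have rdl : 0 < r * dl by rewrite mulr_gt0.
have e0 : 0 <= e by rewrite (le_trans _ re)// invr_ge0 ltW.
have [yb|by_] := leP y b; last by rewrite addr_ge0// ltW// logistic_gt0.
have : l (- (r * dl)) <= l (r * (y - b - dl)).
  by apply: le_logistic; rewrite -mulrN ler_wpM2l ?(ltW r0)//; lra.
rewrite logisticN -[(true%:R : R)]/(1 : R); have := logistic_le_inv _ rdl; lra.
Qed.

Lemma logistic_le_indic r dl e b y : 0 < r -> 0 < dl -> (r * dl)^-1 <= e ->
  l (r * (y - b - dl)) <= (y <= b + 2 * dl)%R%:R + e.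
Proof.
move=> r0 dl0 re; have rdl : 0 < r * dl by rewrite mulr_gt0.
have e0 : 0 <= e by rewrite (le_trans _ re)// invr_ge0 ltW.
have [yb|by_] := leP y (b + 2 * dl).
  by rewrite (le_trans (ltW (logistic_lt1 _)))// lerDl.
rewrite add0r (le_trans _ re)// (le_trans _ (logistic_le_inv _ rdl))//.
by apply: le_logistic; rewrite ler_wpM2l ?(ltW r0)//; lra.
Qed.

End logistic_step.

Section normal_distribution_function.
Context {R : realType}.
Variable s : R.
Hypothesis s0 : 0 < s.
Local Notation mu := (@lebesgue_measure R).
Local Notation pdf := (normal_pdf 0 s).
Local Notation N := (normal_prob 0 s).
Local Open Scope ereal_scope.

Lemma normal_probE (z : R) :
  N `]-oo, z] = \int[mu]_x ((pdf x)%:E * ((x <= z)%R%:R)%:E).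
Proof.
rewrite /normal_prob integral_mkcond; apply: eq_integral => x _.
rewrite patchE; have [|xz] := boolP (x \in _).
  by rewrite inE/= in_itv/= => ->; rewrite mule1.
rewrite (_ : (x <= z)%R = false) ?mule0//.
by apply: contraNF xz; rewrite inE/= in_itv.
Qed.

Lemma normal_prob_lipschitz (z dl : R) : (0 <= dl)%R ->
  N `]-oo, (z + dl)%R] <= N `]-oo, z] + (dl * normal_peak s)%:E.
Proof.
move=> dl0; have s0' : s != 0%R by rewrite gt_eqF.
have -> : `]-oo, (z + dl)%R]%classic = `]-oo, z] `|` `]z, (z + dl)%R].
  rewrite -itv_bndbnd_setU// bnd_simp//.
  by rewrite lerDl.
rewrite (le_trans (measureU2 _ _ _))// leeD2l//.
apply: (@le_trans _ _ (\int[mu]_(x in `]z, (z + dl)%R]) (normal_peak s)%:E)).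
  apply: ge0_le_integral => //.
  - by move=> x _; rewrite lee_fin normal_pdf_ge0.
  - by apply/measurable_EFinP/measurable_funTS; exact: measurable_normal_pdf.
  - by move=> x _; rewrite lee_fin normal_pdf_ub.
rewrite integral_cst//= lebesgue_measure_itv/= lte_fin.
case: ifPn => [_|_]; last by rewrite mule0 lee_fin mulr_ge0 ?normal_peak_ge0.
by rewrite -EFinB -EFinM lee_fin mulrC addrAC subrr add0r.
Qed.

End normal_distribution_function.

(** * Lindeberg telescoping for the tilted walk *)

Section tilted_walk.
Context {d} {T : measurableType d} {R : realType} (P : probability T R).
Variables (xi : T -> R) (S : nat -> T -> R) (beta alpha s : R).
Hypotheses (mxi : measurable_fun setT xi) (mS : forall n, measurable_fun setT (S n)).
Hypothesis S0 : forall t, S 0 t = 0.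
Hypothesis lawS : forall n (g : R -> \bar R), measurable_fun setT g ->
  (forall x, 0 <= g x)%E ->
  (\int[P]_t g (S n.+1 t) = \int[P]_t \int[P]_t' g (S n t + xi t')%R)%E.
Hypothesis s0 : 0 < s.
Local Notation w := (fun t => expR (beta * xi t)).
Local Notation tw := (fun n t => expR (beta * S n t)).
Hypothesis w_total : (\int[P]_t (expR (beta * xi t))%:E = 1)%E.
Hypothesis w_mean : (\int[P]_t (expR (beta * xi t) * (xi t - alpha))%:E = 0)%E.
Hypothesis w_var :
  (\int[P]_t (expR (beta * xi t) * (xi t - alpha) ^+ 2)%:E = (s ^+ 2)%:E)%E.
Local Notation l := (@logistic R).
Local Notation N := (normal_prob 0 s).

Let mexp (f : T -> R) : measurable_fun setT f ->
  measurable_fun setT (fun t => expR (beta * f t)).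
Proof.
move=> mf; apply: measurableT_comp => //.
by apply: measurable_funM => //; exact: measurable_cst.
Qed.

(** The exponential weight factorizes over increments, so under the tilted law S is again a random
    walk, its increments having density [expR (beta * xi t)]. *)
Lemma tilted_step n (g : R -> \bar R) : measurable_fun setT g ->
  (forall x, 0 <= g x)%E ->
  (\int[P]_t ((tw n.+1 t)%:E * g (S n.+1 t)) =
   \int[P]_t ((tw n t)%:E * \int[P]_t' ((w t')%:E * g (S n t + xi t')%R)))%E.
Proof.
move=> mg g0.
have mexpR : measurable_fun setT (fun x : R => (expR (beta * x))%:E).
  have mb : measurable_fun setT (fun x : R => beta * x).
    by apply: measurable_funM; [exact: measurable_cst|exact: measurable_id].
  by apply/measurable_EFinP; exact: measurableT_comp mb.
rewrite (lawS n (fun x => (expR (beta * x))%:E * g x)%E); last 2 first.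
- exact: emeasurable_funM.
- by move=> x; rewrite mule_ge0// lee_fin expR_ge0.
apply: eq_integral => t _.
rewrite -ge0_integralZl//; last 2 first.
- apply: emeasurable_funM; first by apply/measurable_EFinP; exact: mexp.
  apply: (measurableT_comp mg).
  by apply: measurable_funD => //; exact: measurable_cst.
- by move=> t' _; rewrite mule_ge0// lee_fin expR_ge0.
by apply: eq_integral => t' _; rewrite muleA -EFinM -expRD mulrDr.
Qed.

Lemma tilted_total n : (\int[P]_t (tw n t)%:E = 1)%E.
Proof.
elim: n => [|n ih].
  under eq_integral do rewrite S0 mulr0 expR0.
  by rewrite integral_cst// mul1e; exact: probability_setT.
have := tilted_step n (cst 1%E) (measurable_cst _) (fun=> lee01).
under eq_integral do rewrite mule1.
move=> ->; under eq_integral do under eq_integral do rewrite mule1.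
by under eq_integral do rewrite w_total mule1.
Qed.

Let msmooth a (u h : R) n : measurable_fun setT
  (fun t => smoothed_logistic s a (u + h * (S n t - n%:R * alpha))).
Proof.
apply: (measurableT_comp (measurable_smoothed_logistic s a)).
apply: (measurableT_comp (measurable_affine u h)).
by apply: measurable_funB => //; exact: measurable_cst.
Qed.


Let tilted_smooth_step a (u h : R) n :
  (\int[P]_t ((tw n.+1 t)%:E * smoothed_logistic s a (u + h * (S n.+1 t - n.+1%:R * alpha))) =
   \int[P]_t ((tw n t)%:E * \int[P]_t' ((w t')%:E *
     smoothed_logistic s a (u + h * (S n t - n%:R * alpha) + h * (xi t' - alpha)))))%E.
Proof.
have E t t' : u + h * (S n t + xi t' - n.+1%:R * alpha) =
    u + h * (S n t - n%:R * alpha) + h * (xi t' - alpha) by rewrite -natr1; ring.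
pose g x := smoothed_logistic s a (u + h * (x - n.+1%:R * alpha)).
have mg : measurable_fun setT g.
  apply: (measurableT_comp (measurable_smoothed_logistic s a)).
  apply: (measurableT_comp (measurable_affine u h)).
  by apply: measurable_funB => //; exact: measurable_cst.
have g0 x : (0 <= g x)%E by exact: smoothed_logistic_ge0.
have gE t t' : g (S n t + xi t') =
    smoothed_logistic s a (u + h * (S n t - n%:R * alpha) + h * (xi t' - alpha)).
  by rewrite /g E.
transitivity (\int[P]_t ((tw n.+1 t)%:E * g (S n.+1 t)))%E; first by [].
move: g mg g0 gE => g mg g0 gE.
rewrite (tilted_step n g mg g0); apply: eq_integral => t _.
by under eq_integral do rewrite gE.
Qed.

Let mxia : measurable_fun setT (fun t => xi t - alpha).
Proof. by apply: measurable_funB => //; exact: measurable_cst. Qed.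

Let mstep a (u h : R) n : measurable_fun setT (fun t => \int[P]_t' ((w t')%:E *
     smoothed_logistic s a (u + h * (S n t - n%:R * alpha) + h * (xi t' - alpha))))%E.
Proof.
apply: (measurable_fun_fubini_tonelli_F (m2 := P) (fun p : T * T => (w p.2)%:E *
  smoothed_logistic s a (u + h * (S n p.1 - n%:R * alpha) + h * (xi p.2 - alpha)))%E).
- apply: emeasurable_funM.
    apply/measurable_EFinP; apply: (measurableT_comp (mexp _ mxi)).
    exact: measurable_snd.
  apply: (measurableT_comp (measurable_smoothed_logistic s a)).
  apply: measurable_funD.
    apply: (measurableT_comp (measurable_affine u h)).
    apply: measurable_funB; last exact: measurable_cst.
    by apply: measurableT_comp (mS n) _; exact: measurable_fst.
  apply: measurable_funM; first exact: measurable_cst.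
  by apply: measurableT_comp mxia _; exact: measurable_snd.
- by move=> p; rewrite mule_ge0 ?lee_fin ?expR_ge0// smoothed_logistic_ge0.
Qed.

Let step_ge0 a (u h : R) n t : (0 <= \int[P]_t' ((w t')%:E *
     smoothed_logistic s a (u + h * (S n t - n%:R * alpha) + h * (xi t' - alpha))))%E.
Proof.
by apply: integral_ge0 => t' _; rewrite mule_ge0 ?lee_fin ?expR_ge0// smoothed_logistic_ge0.
Qed.

Let sqrt_step (a h : R) n :
  Num.sqrt (Num.sqrt (a ^+ 2 + h ^+ 2) ^+ 2 + n%:R * h ^+ 2) =
  Num.sqrt (a ^+ 2 + n.+1%:R * h ^+ 2).
Proof.
by rewrite sqr_sqrtr ?addr_ge0 ?sqr_ge0// -natr1 mulrDl mul1r -addrA [h ^+ 2 + _]addrC.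
Qed.

(** The induction needs [a] general: the last increment is replaced by a Gaussian one, whose
    variance is absorbed into [a], and the hypothesis is used with sqrt (a^2 + h^2). Each
    replacement costs [c], since the tilted mass is 1. *)
Lemma tilted_telescope_le (c h : R) : 0 < h -> 0 <= c ->
  (forall v, (\int[P]_t (w t * l (v + h * (xi t - alpha)))%:E <=
    smoothed_logistic s h v + c%:E)%E) ->
  forall n a u, 0 <= a ->
  (\int[P]_t ((tw n t)%:E * smoothed_logistic s a (u + h * (S n t - n%:R * alpha))) <=
   smoothed_logistic s (Num.sqrt (a ^+ 2 + n%:R * h ^+ 2)) u + (n%:R * c)%:E)%E.
Proof.
move=> h0 c0 H; elim=> [|n ih] a u a0.
  under eq_integral do rewrite S0 !mul0r subrr !mulr0 addr0 expR0 mul1e.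
  rewrite integral_cst//= probability_setT mule1 !mul0r adde0 addr0.
  by rewrite sqrtr_sqr ger0_norm.
rewrite tilted_smooth_step.
apply: (@le_trans _ _ (\int[P]_t ((tw n t)%:E *
  smoothed_logistic s (Num.sqrt (a ^+ 2 + h ^+ 2)) (u + h * (S n t - n%:R * alpha)))
  + c%:E)%E).
  apply: weighted_average_le => //.
  - exact: mexp.
  - exact (tilted_total n).
  - by move=> t; exact: smoothed_logistic_ge0.
  - move=> t; apply: smoothed_logistic_step_le => //.
    + exact: mexp.
rewrite (le_trans (leeD2r _ (ih _ _ (sqrtr_ge0 _))))// sqrt_step -addeA -EFinD.
by have -> : n.+1%:R * c = n%:R * c + c by rewrite -natr1 mulrDl mul1r.
Qed.

Lemma tilted_telescope_ge (c h : R) : 0 < h -> 0 <= c ->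
  (forall v, (smoothed_logistic s h v <=
    \int[P]_t (w t * l (v + h * (xi t - alpha)))%:E + c%:E)%E) ->
  forall n a u, 0 <= a ->
  (smoothed_logistic s (Num.sqrt (a ^+ 2 + n%:R * h ^+ 2)) u <=
   \int[P]_t ((tw n t)%:E * smoothed_logistic s a (u + h * (S n t - n%:R * alpha)))
   + (n%:R * c)%:E)%E.
Proof.
move=> h0 c0 H; elim=> [|n ih] a u a0.
  under eq_integral do rewrite S0 !mul0r subrr !mulr0 addr0 expR0 mul1e.
  rewrite integral_cst//= probability_setT mule1 !mul0r adde0 addr0.
  by rewrite sqrtr_sqr ger0_norm.
rewrite tilted_smooth_step -sqrt_step (le_trans (ih _ _ (sqrtr_ge0 _)))//.
have -> : n.+1%:R * c = c + n%:R * c by rewrite -natr1 mulrDl mul1r addrC.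
rewrite EFinD addeA leeD2r//.
apply: weighted_average_le => //.
- exact: mexp.
- exact (tilted_total n).
- by move=> t; exact: smoothed_logistic_ge0.
- move=> t; apply: smoothed_logistic_step_ge => //.
  + exact: mexp.
Qed.

Let normalized (n : nat) (t : T) : R := (S n t - n%:R * alpha) / Num.sqrt n%:R.

Let normalized_leE n (z : R) t : (0 < n)%N ->
  (S n t <= n%:R * alpha + z * Num.sqrt n%:R) = (normalized n t <= z).
Proof. by move=> n0; rewrite ler_pdivrMr ?sqrtr_gt0 ?ltr0n// lerBlDl. Qed.

Let normalized_arg n (r b dl : R) t : (0 < n)%N ->
  r * (normalized n t - b - dl) =
  - (r * (b + dl)) + r / Num.sqrt n%:R * (S n t - n%:R * alpha).
Proof.
move=> n0; rewrite /normalized; have : Num.sqrt (n%:R : R) != 0.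
  by rewrite gt_eqF// sqrtr_gt0 ltr0n.
by move: (Num.sqrt _) => q q0; field.
Qed.

Let normalized_var (n : nat) (r : R) : 0 < r -> (0 < n)%N ->
  n%:R * (r / Num.sqrt n%:R) ^+ 2 = r ^+ 2.
Proof.
move=> r0 n0; rewrite exprMn exprVn sqr_sqrtr ?ler0n// mulrCA divff ?mulr1//.
by rewrite pnatr_eq0 -lt0n.
Qed.

Let mnormalized n : measurable_fun setT (normalized n).
Proof.
apply: measurable_funM; last exact: measurable_cst.
by apply: measurable_funB => //; exact: measurable_cst.
Qed.

Let mlogistic (f : T -> R) (r b dl : R) : measurable_fun setT f ->
  measurable_fun setT (fun t => (l (r * (f t - b - dl)))%:E).
Proof.
move=> mf; apply/measurable_EFinP; apply: (measurableT_comp measurable_logistic).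
apply: measurable_funM; first exact: measurable_cst.
apply: measurable_funB; last exact: measurable_cst.
by apply: measurable_funB => //; exact: measurable_cst.
Qed.

Let small_step (r h0 : R) : 0 < h0 -> 0 < r ->
  exists M : nat, forall n, (M <= n)%N -> (0 < n)%N /\ 0 < r / Num.sqrt n%:R <= h0.
Proof.
move=> h00 r0; exists (Num.trunc ((r / h0) ^+ 2)).+1 => n Mn.
have n0 : (0 < n)%N by exact: leq_ltn_trans Mn.
split => //; have sn0 : 0 < Num.sqrt (n%:R : R) by rewrite sqrtr_gt0 ltr0n.
rewrite divr_gt0//= ler_pdivrMr// mulrC -ler_pdivrMr//.
rewrite -[leLHS]ger0_norm ?divr_ge0 ?(ltW r0) ?(ltW h00)// -sqrtr_sqr ler_wsqrtr//.
by rewrite (le_trans (ltW (truncnS_gt _)))// ler_nat.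
Qed.

Lemma tilted_clt (z e : R) : 0 < e -> exists M, forall n, (M <= n)%N ->
  (\int[P]_t ((tw n t)%:E * ((S n t <= n%:R * alpha + z * Num.sqrt n%:R)%R%:R)%:E)
     <= N `]-oo, z] + e%:E)%E /\
  (N `]-oo, z] <=
   \int[P]_t ((tw n t)%:E * ((S n t <= n%:R * alpha + z * Num.sqrt n%:R)%R%:R)%:E)
   + e%:E)%E.
Proof.
(* Four losses of e / 4: indicator against logistic for the walk, the Lindeberg replacement,
   logistic against indicator for the normal law, and the shift by 2 dl. [dl] is chosen for the last
   one, [r] for the two comparisons with the logistic. *)
move=> e0; set e4 := e / 4.
have e40 : 0 < e4 by rewrite divr_gt0.
have e4ge0 : 0 <= e4 by exact: ltW.
pose dl := e4 / (2 * normal_peak s).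
have pk : 0 < normal_peak s by rewrite normal_peak_gt0// gt_eqF.
have dl0 : 0 < dl by rewrite divr_gt0 ?mulr_gt0.
have dlE : 2 * dl * normal_peak s = e4 by rewrite /dl; field; rewrite gt_eqF.
pose r := (e4 * dl)^-1.
have r0 : 0 < r by rewrite invr_gt0 mulr_gt0.
have re : (r * dl)^-1 <= e4.
  by rewrite /r invfM invrK -mulrA divff ?mulr1// gt_eqF.
(* With h = r / sqrt n, an error of (e4 / r^2) h^2 per step adds up to e4 over n steps. *)
have er0 : 0 < e4 / r ^+ 2 by rewrite divr_gt0 ?exprn_gt0.
have mpdf := measurable_normal_pdf 0 s.
have mid : measurable_fun setT (id : R -> R) by exact: measurable_id.
have pdf0 := normal_pdf_ge0 0 s.
have w0 t : 0 <= w t by exact: expR_ge0.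
have [h1 h10 H1] := logistic_one_step_compare P lebesgue_measure
  w (fun t => xi t - alpha) (normal_pdf 0 s) id (s ^+ 2)
  (mexp _ mxi) mxia w0 w_total w_mean w_var mpdf mid pdf0
  (integral_normal_pdf _ _) (integral_id_normal_pdf s s0)
  (integral_sqr_normal_pdf s s0) _ er0.
have [h2 h20 H2] := logistic_one_step_compare lebesgue_measure P
  (normal_pdf 0 s) id w (fun t => xi t - alpha) (s ^+ 2)
  mpdf mid pdf0
  (integral_normal_pdf _ _) (integral_id_normal_pdf s s0)
  (integral_sqr_normal_pdf s s0)
  (mexp _ mxi) mxia w0 w_total w_mean w_var _ er0.
have hmin : 0 < Num.min h1 h2 by rewrite lt_min h10.
have [M HM] := small_step r _ hmin r0.
exists M => n /HM[n0 /andP[h0]]; rewrite le_min => /andP[hh1 hh2].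
set h := r / _ in h0 hh1 hh2.
have hh1' : 0 < h <= h1 by rewrite h0.
have hh2' : 0 < h <= h2 by rewrite h0.
have c0 : 0 <= e4 / r ^+ 2 * h ^+ 2 by rewrite mulr_ge0 ?sqr_ge0// ltW.
have ncE : n%:R * (e4 / r ^+ 2 * h ^+ 2) = e4.
  by rewrite mulrCA normalized_var// divfK// gt_eqF// exprn_gt0.
have sqE : Num.sqrt (0 ^+ 2 + n%:R * h ^+ 2) = r.
  by rewrite expr0n add0r normalized_var// sqrtr_sqr gtr0_norm.
have tw0 t : 0 <= expR (beta * S n t) by exact: expR_ge0.
have ind0 (b : bool) : (0 <= (b%:R : R)%:E)%E by rewrite lee_fin ler0n.
have l0 x : (0 <= (l x)%:E)%E by rewrite lee_fin ltW// logistic_gt0.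
under eq_integral do rewrite normalized_leE//.
have tele_le b : (\int[P]_t ((tw n t)%:E * (l (r * (normalized n t - b - dl)))%:E) <=
    \int[lebesgue_measure]_x ((normal_pdf 0 s x)%:E * (l (r * (x - b - dl)))%:E) + e4%:E)%E.
  have := @tilted_telescope_le _ _ h0 c0 (fun v => H1 h v hh1') n 0 (- (r * (b + dl))) (lexx _).
  rewrite sqE ncE.
  under eq_integral do rewrite smoothed_logistic0 -normalized_arg//.
  move=> /le_trans; apply; rewrite leeD2r// le_eqVlt; apply/orP; left; apply/eqP.
  apply: eq_integral => x _; rewrite -EFinM; congr (_ * l _)%:E; ring.
have tele_ge b : (\int[lebesgue_measure]_x ((normal_pdf 0 s x)%:E * (l (r * (x - b - dl)))%:E) <=
    \int[P]_t ((tw n t)%:E * (l (r * (normalized n t - b - dl)))%:E) + e4%:E)%E.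
  have := @tilted_telescope_ge _ _ h0 c0 (fun v => H2 h v hh2') n 0 (- (r * (b + dl))) (lexx _).
  rewrite sqE ncE.
  under eq_integral do rewrite smoothed_logistic0 -normalized_arg//.
  apply: le_trans; rewrite le_eqVlt; apply/orP; left; apply/eqP.
  apply: eq_integral => x _; rewrite -EFinM; congr (_ * l _)%:E; ring.
have mN := mnormalized n.
have mind b : measurable_fun setT (fun t => ((normalized n t <= b)%R%:R)%:E : \bar R).
  by apply/measurable_EFinP; exact: measurable_le_natr.
have mindR b : measurable_fun setT (fun x : R => ((x <= b)%R%:R)%:E : \bar R).
  by apply/measurable_EFinP; exact: measurable_le_natr.
have mlogR b : measurable_fun setT (fun x : R => (l (r * (x - b - dl)))%:E).
  apply/measurable_EFinP; apply: (measurableT_comp measurable_logistic).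
  apply: measurable_funM; first exact: measurable_cst.
  apply: measurable_funB; last exact: measurable_cst.
  by apply: measurable_funB => //; exact: measurable_cst.
have indic_lel b y : (((y <= b)%R%:R)%:E <= (l (r * (y - b - dl)))%:E + e4%:E)%E.
  by rewrite -EFinD lee_fin indic_le_logistic.
have lel_indic b y :
    ((l (r * (y - b - dl)))%:E <= ((y <= b + 2 * dl)%R%:R)%:E + e4%:E)%E.
  by rewrite -EFinD lee_fin logistic_le_indic.
have walk_ub b : (\int[P]_t ((tw n t)%:E * ((normalized n t <= b)%R%:R)%:E) <=
    \int[P]_t ((tw n t)%:E * (l (r * (normalized n t - b - dl)))%:E) + e4%:E)%E.
  apply: weighted_average_le => //;
    do ?[exact: mexp|exact: (tilted_total n)|exact: mlogistic].
have walk_lb b : (\int[P]_t ((tw n t)%:E * (l (r * (normalized n t - b - dl)))%:E) <=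
    \int[P]_t ((tw n t)%:E * ((normalized n t <= b + 2 * dl)%R%:R)%:E) + e4%:E)%E.
  apply: weighted_average_le => //;
    do ?[exact: mexp|exact: (tilted_total n)|exact: mlogistic].
have gauss_ub b : (N `]-oo, b] <=
    \int[lebesgue_measure]_x ((normal_pdf 0 s x)%:E * (l (r * (x - b - dl)))%:E) + e4%:E)%E.
  rewrite normal_probE.
  apply: weighted_average_le => //; do ?[exact: integral_normal_pdf|exact: mlogR|exact: mindR].
have gauss_lb b : (\int[lebesgue_measure]_x ((normal_pdf 0 s x)%:E * (l (r * (x - b - dl)))%:E)
    <= N `]-oo, (b + 2 * dl)%R] + e4%:E)%E.
  rewrite normal_probE.
  apply: weighted_average_le => //; do ?[exact: integral_normal_pdf|exact: mlogR|exact: mindR].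
have dl20 : 0 <= 2 * dl by rewrite mulr_ge0 ?ltW.
have lip b := normal_prob_lipschitz s s0 b (2 * dl) dl20.
have eE : (e%:E = e4%:E + e4%:E + e4%:E + e4%:E :> \bar R)%E.
  by rewrite -!EFinD; congr (_%:E); rewrite /e4; field.
rewrite eE; split.
- rewrite (le_trans (walk_ub z))// !addeA leeD2r//.
  rewrite (le_trans (tele_le z))// leeD2r//.
  rewrite (le_trans (gauss_lb z))// leeD2r//.
  by rewrite (le_trans (lip z))// dlE.
- have zE : z = z - 2 * dl + 2 * dl by rewrite subrK.
  rewrite {1}zE (le_trans (lip _))// dlE !addeA leeD2r//.
  rewrite (le_trans (gauss_ub _))// leeD2r//.
  rewrite (le_trans (tele_ge _))// leeD2r//.
  by rewrite (le_trans (walk_lb _))// -zE.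
Qed.

End tilted_walk.

(** * Tightness under the tilted law *)

Section powR_facts.
Context {R : realType}.
Implicit Types a b x y th beta : R.

Lemma powR_expR x th : expR x `^ th = expR (th * x).
Proof. by rewrite /powR gt_eqF ?expR_gt0// expRK. Qed.

Lemma ge0_powR_le x y th : 0 <= th -> 0 <= x -> x <= y -> x `^ th <= y `^ th.
Proof.
move=> th0 x0 xy; apply: (ge0_ler_powR th0) => //; rewrite nnegrE//.
exact: le_trans xy.
Qed.

(** For a share q = z / (x + y) in (0, 1], th <= 1 gives q <= q^th; the shares of x and y add up to
    1. *)
Lemma powR_subadd x y th : 0 < th -> th <= 1 -> 0 <= x -> 0 <= y ->
  (x + y) `^ th <= x `^ th + y `^ th.
Proof.
move=> th0 th1 x0 y0; have [xy0|xy0] := leP (x + y) 0.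
  have -> : x + y = 0 by apply/eqP; rewrite eq_le xy0 addr_ge0.
  by rewrite powR0 ?gt_eqF// addr_ge0 ?powR_ge0.
have le_part z : 0 <= z -> z <= x + y -> z / (x + y) * (x + y) `^ th <= z `^ th.
  move=> z0 zxy; have [->|zn0] := eqVneq z 0; first by rewrite !mul0r powR_ge0.
  have zgt0 : 0 < z by rewrite lt_neqAle eq_sym zn0.
  have -> : z `^ th = (z / (x + y)) `^ th * (x + y) `^ th.
    by rewrite -powRM ?divr_ge0 ?addr_ge0// divfK// gt_eqF.
  rewrite ler_wpM2r ?powR_ge0// ger1_powR// divr_gt0//=.
  by rewrite ler_pdivrMr// mul1r.
have hx := le_part x x0; have hy := le_part y y0.
rewrite lerDl in hx; rewrite lerDr in hy.
rewrite (le_trans _ (lerD (hx y0) (hy x0)))//.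
by rewrite -mulrDl -mulrDl divff ?mul1r// gt_eqF.
Qed.

(* The larger of [z] and [expR v] dominates both factors. *)
Lemma powR_mul_expR_le z v th beta : 0 <= th -> th <= beta -> 0 <= z ->
  z `^ th * expR ((beta - th) * v) <= z `^ beta + expR (beta * v).
Proof.
move=> th0 thb z0; have b0 : 0 <= beta by exact: le_trans thb.
have bth : 0 <= beta - th by rewrite subr_ge0.
rewrite -!powR_expR; have [zv|vz] := leP z (expR v).
  rewrite (@le_trans _ _ (expR v `^ beta))// ?lerDr ?powR_ge0//.
  rewrite -[X in _ <= expR v `^ X](subrKC th) [leRHS]powRD; last first.
    by rewrite expR_eq0 implybT.
  by rewrite ler_wpM2r ?powR_ge0// ge0_powR_le.
have zgt0 : 0 < z by rewrite (lt_trans _ vz)// expR_gt0.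
rewrite (@le_trans _ _ (z `^ beta))// ?lerDl ?powR_ge0//.
rewrite -[X in _ <= z `^ X](subrKC th) [leRHS]powRD; last by rewrite (gt_eqF zgt0) implybT.
by rewrite ler_wpM2l ?powR_ge0// ge0_powR_le ?expR_ge0 ?(ltW vz).
Qed.

(** The tangent at v = (1 - lam) x lies below the exponential, strictly at 0 because v is nonzero.
    Averaging its values at 0 and x with weights lam and 1 - lam returns e^v. *)
Lemma expR_strictly_convex0 x lam : 0 < lam -> lam < 1 -> x != 0 ->
  expR ((1 - lam) * x) < lam + (1 - lam) * expR x.
Proof.
move=> l0 l1 x0; set v := (1 - lam) * x.
have l1' : 0 < 1 - lam by rewrite subr_gt0.
have h0 : expR v * (1 - v) < 1.
  rewrite -[ltRHS](expRxMexpNx_1 v) ltr_pM2l ?expR_gt0//.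
  by apply: expR_gt1Dx; rewrite oppr_eq0 mulf_neq0// gt_eqF.
have h1 : expR v * (1 + (x - v)) <= expR x.
  rewrite -[X in _ <= expR X](subrKC v) expRD ler_wpM2l ?expR_ge0//.
  exact: expR_ge1Dx.
have -> : expR v = lam * (expR v * (1 - v)) + (1 - lam) * (expR v * (1 + (x - v))).
  by rewrite {3 5}/v; ring.
rewrite ltr_leD//; last by rewrite ler_pM2l.
by rewrite -[ltRHS]mulr1 ltr_pM2l.
Qed.

End powR_facts.

Section lattice_free_moment.
Context {d} {T : measurableType d} {R : realType} (P : probability T R).
Variables (xi : T -> R) (beta : R).
Hypotheses (mxi : measurable_fun setT xi) (beta0 : 0 < beta).
Hypothesis w_total : (\int[P]_t (expR (beta * xi t))%:E = 1)%E.
Hypothesis xi_pos : (0 < P [set t | (0 < xi t)%R])%E.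

(** A vanishing integral would make f vanish almost everywhere, hence at some point where xi > 0. *)
Lemma expectation_gt0 (f : T -> R) : measurable_fun setT f ->
  (forall t, 0 <= f t) -> (forall t, 0 < xi t -> 0 < f t) ->
  (0 < \int[P]_t (f t)%:E)%E.
Proof.
move=> mf f0 fpos.
rewrite lt0e integral_ge0 ?andbT; last by move=> t _; rewrite lee_fin.
apply/eqP => intf0.
have mf' : measurable_fun setT (EFin \o f) by exact/measurable_EFinP.
have [|N [mN PN0 subN]] := (ae_eq_integral_abs P measurableT mf').1.
  rewrite -[RHS]intf0; apply: eq_integral => t _ /=.
  by rewrite ger0_norm.
have : (P [set t | (0 < xi t)%R] <= P N)%E.
  apply: le_measure; rewrite ?inE//; first exact: (measurable_set_lt (cst 0) xi).
  move=> t /= xit; apply: subN => /= /(_ Logic.I) [ft0].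
  by have := fpos t xit; rewrite ft0 ltxx.
by rewrite PN0 leNgt xi_pos.
Qed.

(** The convex function p -> E e^{p xi} equals 1 at 0 and at beta, and beta - th lies strictly
    between them. The gap [f] in the convexity inequality is positive where xi > 0, an event of
    positive probability. *)
Lemma exp_moment_lt1 th : 0 < th -> th < beta ->
  (\int[P]_t (expR ((beta - th) * xi t))%:E < 1)%E.
Proof.
move=> th0 thb; set lam := th / beta.
have l0 : 0 < lam by rewrite divr_gt0.
have l1 : lam < 1 by rewrite ltr_pdivrMr// mul1r.
have l1' : 0 < 1 - lam by rewrite subr_gt0.
have E t : (beta - th) * xi t = (1 - lam) * (beta * xi t).
  by rewrite /lam; field; rewrite gt_eqF.
pose f t := lam + (1 - lam) * expR (beta * xi t) - expR ((beta - th) * xi t).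
have f0 t : 0 <= f t.
  rewrite /f E subr_ge0; have [->|xn0] := eqVneq (beta * xi t) 0.
    by rewrite mulr0 expR0; lra.
  exact/ltW/expR_strictly_convex0.
have mf : measurable_fun setT f by rewrite /f; solve_measurable.
have fpos t : 0 < xi t -> 0 < f t.
  by move=> xt; rewrite /f E subr_gt0 expR_strictly_convex0// gt_eqF// mulr_gt0.
have sum1 : (\int[P]_t (expR ((beta - th) * xi t))%:E + \int[P]_t (f t)%:E = 1)%E.
  rewrite -ge0_integralD//.
  - rewrite (eq_integral (fun t => lam%:E + (1 - lam)%:E * (expR (beta * xi t))%:E)%E).
      rewrite ge0_integralD//.
      + rewrite integral_cst//= ge0_integralZl//.
        * rewrite w_total mule1 [X in (_ * X)%E]probability_setT mule1 -EFinD.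
          by congr (_%:E); ring.
        * by solve_measurable.
        * by rewrite lee_fin ltW.
      + by move=> t _; rewrite lee_fin ltW.
      + by move=> t _; rewrite -EFinM lee_fin mulr_ge0 ?expR_ge0 ?ltW.
      + by apply: emeasurable_funM; solve_measurable.
    by move=> t _; rewrite -EFinM -!EFinD /f; congr (_%:E); ring.
  - by solve_measurable.
  - by move=> t _; rewrite lee_fin.
  - exact/measurable_EFinP.
have I0 : (0 <= \int[P]_t (expR ((beta - th) * xi t))%:E)%E.
  by apply: integral_ge0 => t _; rewrite lee_fin expR_ge0.
have J0 := expectation_gt0 f mf f0 fpos.
rewrite -[ltRHS]sum1 lteDl// ge0_fin_numE//.
by rewrite (le_lt_trans _ (ltry 1))// -sum1 leeDl// ltW.
Qed.

End lattice_free_moment.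

Section perpetuity.
Context {d} {T : measurableType d} {R : realType} (P : probability T R).
Variables (xi zeta : T -> R) (S D : nat -> T -> R) (beta : R).
Hypotheses (mxi : measurable_fun setT xi) (mzeta : measurable_fun setT zeta).
Hypotheses (mS : forall n, measurable_fun setT (S n))
  (mD : forall n, measurable_fun setT (D n)).
Hypotheses (zeta_ge0 : forall t, 0 <= zeta t)
  (zeta_gt0 : {ae P, forall t, 0 < zeta t}).
Hypotheses (S0 : forall t, S 0 t = 0) (D0 : forall t, D 0 t = 0)
  (D_ge0 : forall n t, 0 <= D n t).
Hypothesis lawM : forall n (g : R * R -> \bar R), measurable_fun setT g ->
  (forall p, 0 <= g p)%E ->
  (\int[P]_t g (S n.+1 t, D n.+1 t) =
   \int[P]_t \int[P]_t' g (S n t + xi t', D n t + zeta t' * expR (S n t))%R)%E.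
Hypothesis beta0 : 0 < beta.
Hypothesis w_total : (\int[P]_t (expR (beta * xi t))%:E = 1)%E.

Lemma walk_law n (g : R -> \bar R) : measurable_fun setT g ->
  (forall x, 0 <= g x)%E ->
  (\int[P]_t g (S n.+1 t) = \int[P]_t \int[P]_t' g (S n t + xi t')%R)%E.
Proof.
move=> mg g0; apply: (lawM n (g \o fst)); last by move=> p; exact: g0.
exact: measurableT_comp mg measurable_fst.
Qed.

Let twtotal n : (\int[P]_t (expR (beta * S n t))%:E = 1)%E.
Proof. by apply: (tilted_total P xi S beta) => //; exact: walk_law. Qed.

(** D_{n+m} = D_n + e^{S_n} D'_m with a fresh copy D'_m, stated for laws only. [Kg] applies one more
    step to [g], so that the induction on [m] peels off the last step on both sides. *)
Lemma renewal_law n m (g : R * R -> \bar R) : measurable_fun setT g ->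
  (forall p, 0 <= g p)%E ->
  (\int[P]_t g (S (n + m) t, D (n + m) t) =
   \int[P]_t \int[P]_t' g (S n t + S m t', D n t + expR (S n t) * D m t')%R)%E.
Proof.
elim: m g => [|m ih] g mg g0.
  rewrite addn0; apply: eq_integral => t _.
  under eq_integral do rewrite S0 D0 mulr0 !addr0.
  by rewrite integral_cst// [X in (_ * X)%E]probability_setT mule1.
pose Kg (p : R * R) : \bar R :=
  (\int[P]_t g (p.1 + xi t, p.2 + zeta t * expR p.1)%R)%E.
have mKg : measurable_fun setT Kg.
  apply: (measurable_fun_fubini_tonelli_F (m2 := P)
    (fun q : (R * R) * T => g (q.1.1 + xi q.2, q.1.2 + zeta q.2 * expR q.1.1)%R)) => //.
  by solve_measurable.
have Kg0 p : (0 <= Kg p)%E by exact: integral_ge0.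
transitivity (\int[P]_t Kg (S (n + m) t, D (n + m) t))%E.
  by rewrite addnS (lawM _ g mg g0).
rewrite (ih Kg mKg Kg0); apply: eq_integral => t _.
pose h (p : R * R) : \bar R := g (S n t + p.1, D n t + expR (S n t) * p.2)%R.
have mh : measurable_fun setT h by rewrite /h; solve_measurable.
have -> : (\int[P]_t' g (S n t + S m.+1 t', D n t + expR (S n t) * D m.+1 t')%R =
  \int[P]_t' h (S m.+1 t', D m.+1 t'))%E by [].
rewrite (lawM m h mh (fun=> g0 _)); apply: eq_integral => t' _.
rewrite /Kg; apply: eq_integral => t'' _; rewrite /h /= -addrA expRD; congr (g (_, _)).
by ring.
Qed.

Section moment.
Variable th : R.
Hypotheses (th0 : 0 < th) (th1 : th <= 1) (thb : th < beta).
Hypothesis zeta_beta : (\int[P]_t (zeta t `^ beta)%:E < +oo)%E.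
Hypothesis xi_pos : (0 < P [set t | (0 < xi t)%R])%E.

(** The moment of order [th] of D_n e^{-S_n} under the tilted law, the factor e^{- th S_n} being
    merged with the tilting. *)
Let m_ n : \bar R := (\int[P]_t (expR ((beta - th) * S n t) * D n t `^ th)%:E)%E.
Let rho : \bar R := (\int[P]_t (expR ((beta - th) * xi t))%:E)%E.
Let B : \bar R := (\int[P]_t (zeta t `^ th * expR ((beta - th) * xi t))%:E)%E.

Let B_lty : (B < +oo)%E.
Proof.
apply: (@le_lt_trans _ _ (\int[P]_t ((zeta t `^ beta)%:E + (expR (beta * xi t))%:E))%E).
  apply: ge0_le_integral => //.
  - by move=> t _; rewrite lee_fin mulr_ge0 ?powR_ge0 ?expR_ge0.
  - by solve_measurable.
  - by apply: emeasurable_funD; solve_measurable.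
  - by move=> t _; rewrite -EFinD lee_fin powR_mul_expR_le ?(ltW th0) ?(ltW thb).
rewrite ge0_integralD//.
- by rewrite w_total lte_add_pinfty// ltry.
- by move=> t _; rewrite lee_fin powR_ge0.
- by solve_measurable.
- by solve_measurable.
Qed.

(** Subadditivity of the power splits D_{n+1} into the old sum and the new summand. In the old part
    the increment contributes the factor [rho]; the new part leaves [B] times the tilted mass 1. *)
Let m_step n : (m_ n.+1 <= rho * m_ n + B)%E.
Proof.
pose g (p : R * R) : \bar R := (expR ((beta - th) * p.1) * p.2 `^ th)%:E.
have mg : measurable_fun setT g by rewrite /g; solve_measurable.
rewrite /m_ -[leLHS]/(\int[P]_t g (S n.+1 t, D n.+1 t))%E lawM//; last first.
  by move=> p; rewrite lee_fin mulr_ge0 ?powR_ge0 ?expR_ge0.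
pose A t := expR ((beta - th) * S n t) * D n t `^ th.
have A0 t : 0 <= A t by rewrite mulr_ge0 ?powR_ge0 ?expR_ge0.
have mA : measurable_fun setT A by rewrite /A; solve_measurable.
have rho0 : (0 <= rho)%E by apply: integral_ge0 => t _; rewrite lee_fin expR_ge0.
have B0 : (0 <= B)%E.
  by apply: integral_ge0 => t _; rewrite lee_fin mulr_ge0 ?powR_ge0 ?expR_ge0.
apply: (@le_trans _ _ (\int[P]_t ((A t)%:E * rho + (expR (beta * S n t))%:E * B))%E).
  apply: ge0_le_integral => //.
  - move=> t _; apply: integral_ge0 => t' _.
    by rewrite lee_fin mulr_ge0 ?powR_ge0 ?expR_ge0.
  - apply: (measurable_fun_fubini_tonelli_F (m2 := P)
      (fun q : T * T => g (S n q.1 + xi q.2, D n q.1 + zeta q.2 * expR (S n q.1))%R)).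
      by solve_measurable.
    by move=> q; rewrite lee_fin mulr_ge0 ?powR_ge0 ?expR_ge0.
  - apply: emeasurable_funD; apply: emeasurable_funM => //; solve_measurable.
  - move=> t _; rewrite /rho /B -!ge0_integralZl ?lee_fin ?A0 ?expR_ge0//; last 3 first.
    + by solve_measurable.
    + by move=> t' _; rewrite lee_fin mulr_ge0 ?powR_ge0 ?expR_ge0.
    + by solve_measurable.
    rewrite -ge0_integralD//; last 4 first.
    + by move=> t' _; rewrite lee_fin mulr_ge0 ?expR_ge0.
    + by apply: emeasurable_funM; solve_measurable.
    + by move=> t' _; rewrite lee_fin !mulr_ge0 ?powR_ge0 ?expR_ge0.
    + by apply: emeasurable_funM; solve_measurable.
    apply: ge0_le_integral => //.
    + by move=> t' _; rewrite lee_fin mulr_ge0 ?powR_ge0 ?expR_ge0.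
    + by rewrite /g; solve_measurable.
    + by apply: emeasurable_funD; apply: emeasurable_funM; solve_measurable.
    move=> t' _; rewrite -!EFinM -EFinD lee_fin /g /A /=.
    have ze : 0 <= zeta t' * expR (S n t) by rewrite mulr_ge0 ?expR_ge0.
    rewrite (le_trans (ler_wpM2l (expR_ge0 _)
      (powR_subadd _ _ _ th0 th1 (D_ge0 n t) ze)))//.
    rewrite powRM ?expR_ge0// powR_expR le_eqVlt; apply/orP; left; apply/eqP.
    have -> : expR (beta * S n t) = expR ((beta - th) * S n t) * expR (th * S n t).
      by rewrite -expRD; congr expR; ring.
    by rewrite [(beta - th) * (_ + _)]mulrDr expRD; ring.
rewrite ge0_integralD//.
- rewrite ge0_integralZr//; last 2 first.
  + by solve_measurable.
  + by move=> t _; rewrite lee_fin.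
  rewrite ge0_integralZr//; last by solve_measurable.
  by rewrite twtotal mul1e muleC.
- by move=> t _; rewrite mule_ge0 ?lee_fin.
- by apply: emeasurable_funM; solve_measurable.
- by move=> t _; rewrite mule_ge0 ?lee_fin ?expR_ge0.
- by apply: emeasurable_funM; solve_measurable.
Qed.

Lemma tilted_moment_bound : exists2 C : R, 0 <= C & forall n,
  (\int[P]_t (expR ((beta - th) * S n t) * D n t `^ th)%:E <= C%:E)%E.
Proof.
have rho0 : (0 <= rho)%E by apply: integral_ge0 => t _; rewrite lee_fin expR_ge0.
have rho1 : (rho < 1)%E by exact: exp_moment_lt1.
have B0 : (0 <= B)%E.
  by apply: integral_ge0 => t _; rewrite lee_fin mulr_ge0 ?powR_ge0 ?expR_ge0.
have rhoE : rho = (fine rho)%:E.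
  by rewrite fineK// ge0_fin_numE// (lt_trans rho1)// ltry.
have BE : B = (fine B)%:E by rewrite fineK// ge0_fin_numE.
have r1 : fine rho < 1 by rewrite -lte_fin -rhoE.
have r0 : 0 <= fine rho by rewrite fine_ge0.
have b0 : 0 <= fine B by rewrite fine_ge0.
(* B / (1 - rho) is the fixed point of m = rho m + B; the recursion starts below it because D_0 =
   0. *)
have C0 : 0 <= fine B / (1 - fine rho) by rewrite divr_ge0// subr_ge0 ltW.
exists (fine B / (1 - fine rho)) => //; elim=> [|n ih].
  rewrite (eq_integral (cst 0%E)) ?integral0 ?lee_fin// => t _.
  by rewrite D0 powR0 ?gt_eqF// mulr0.
rewrite (le_trans (m_step n))// (@le_trans _ _
  ((fine rho)%:E * (fine B / (1 - fine rho))%:E + (fine B)%:E)%E)//.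
  by rewrite -rhoE -BE leeD2r// lee_wpmul2l.
rewrite -EFinM -EFinD lee_fin le_eqVlt; apply/orP; left; apply/eqP.
by field; rewrite gt_eqF// subr_gt0.
Qed.

(** Markov's inequality for the moment of order [th] of D_n e^{-S_n}. *)
Lemma tilted_upper_tail : exists2 C : R, 0 <= C & forall n w,
  (\int[P]_t ((expR (beta * S n t))%:E * ((expR (w + S n t) < D n t)%R%:R)%:E)
   <= (C * expR (- (th * w)))%:E)%E.
Proof.
have [C C0 HC] := tilted_moment_bound; exists C => // n w.
have mind : measurable_fun setT (fun t => (expR (w + S n t) < D n t)%R%:R : R).
  apply: measurable_natr_bool.
  by apply: (measurable_set_lt (fun t => expR (w + S n t)) (D n)) => //; solve_measurable.
rewrite mulrC EFinM (le_trans _ (lee_wpmul2l _ (HC n)))//.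
rewrite -ge0_integralZl//; last 2 first.
- by solve_measurable.
- by move=> t _; rewrite lee_fin mulr_ge0 ?powR_ge0 ?expR_ge0.
apply: ge0_le_integral => //.
- by apply: emeasurable_funM; solve_measurable.
- by apply: emeasurable_funM; solve_measurable.
move=> t _; rewrite -!EFinM lee_fin.
have [wD|_] := ltP (expR (w + S n t)) (D n t); last first.
  by rewrite mulr0 !mulr_ge0 ?powR_ge0 ?expR_ge0.
have := ge0_powR_le _ _ th (ltW th0) (expR_ge0 _) (ltW wD).
rewrite powR_expR mulr1 => le_pow; rewrite mulrA -expRD.
apply: le_trans (ler_wpM2l (expR_ge0 _) le_pow); rewrite -expRD ler_expR.
by rewrite le_eqVlt; apply/orP; left; apply/eqP; ring.
Qed.

End moment.

(** Tilted probability that zeta e^{-xi} falls below e^{-w}. *)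
Definition tilted_small (w : R) : \bar R :=
  (\int[P]_t ((expR (beta * xi t))%:E * ((zeta t < expR (xi t - w))%R%:R)%:E))%E.

Let msmall w : measurable_fun setT (fun t => (zeta t < expR (xi t - w))%R%:R : R).
Proof.
apply: measurable_natr_bool.
by apply: (measurable_set_lt zeta (fun t => expR (xi t - w))) => //; solve_measurable.
Qed.

(** Keeping only the last summand gives D_{n+1} e^{-S_{n+1}} >= zeta e^{-xi} for the last pair,
    whose tilted law is the same for all n. There is no such bound at time 0, where D_0 = 0. *)
Lemma tilted_lower_tail n w :
  (\int[P]_t ((expR (beta * S n.+1 t))%:E *
     ((D n.+1 t < expR (S n.+1 t - w))%R%:R)%:E) <= tilted_small w)%E.
Proof.
have msw := msmall w.
pose g (p : R * R) : \bar R :=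
  ((expR (beta * p.1))%:E * ((p.2 < expR (p.1 - w))%R%:R)%:E)%E.
have mg : measurable_fun setT g.
  apply: emeasurable_funM; first by solve_measurable.
  apply/measurable_EFinP/measurable_natr_bool.
  by apply: (measurable_set_lt (@snd R R) (fun p => expR (p.1 - w))) => //; solve_measurable.
have g0 p : (0 <= g p)%E by rewrite mule_ge0// lee_fin ?expR_ge0.
rewrite -[leLHS]/(\int[P]_t g (S n.+1 t, D n.+1 t))%E lawM//.
have K0 : (0 <= tilted_small w)%E.
  by apply: integral_ge0 => t _; rewrite mule_ge0// lee_fin ?expR_ge0.
apply: (@le_trans _ _ (\int[P]_t ((expR (beta * S n t))%:E * tilted_small w))%E).
  apply: ge0_le_integral; [exact: measurableT| | | | ].
  - by move=> t _; exact: integral_ge0.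
  - apply: (measurable_fun_fubini_tonelli_F (m2 := P)
      (fun q : T * T => g (S n q.1 + xi q.2, D n q.1 + zeta q.2 * expR (S n q.1))%R)) => //.
    by solve_measurable.
  - by apply: emeasurable_funM; solve_measurable.
  move=> t _; rewrite /tilted_small -ge0_integralZl; [|exact: measurableT| | | ].
  2: by apply: emeasurable_funM; solve_measurable.
  2: by move=> t' _; rewrite mule_ge0// lee_fin ?expR_ge0.
  2: by rewrite lee_fin expR_ge0.
  apply: ge0_le_integral => //.
  + by apply: (measurableT_comp mg); solve_measurable.
  + apply: emeasurable_funM; first by solve_measurable.
    by apply: emeasurable_funM; solve_measurable.
  move=> t' _; rewrite /g /= -!EFinM lee_fin mulrA -expRD -mulrDr ler_wpM2l ?expR_ge0//.
  rewrite ler_nat; case: (ltP (zeta t') _) => [_|]; first by case: (_ < _).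
  move=> le_z; rewrite ltNge (_ : expR _ <= D n t + zeta t' * expR (S n t))//.
  rewrite -addrA expRD mulrC (le_trans (ler_wpM2r (expR_ge0 _) le_z))//.
  by rewrite lerDr.
rewrite ge0_integralZr//.
- by rewrite twtotal mul1e.
by solve_measurable.
Qed.

(** Dominated convergence along integer w: almost surely zeta > 0, so the indicator is eventually 0.
    Monotonicity in w covers the other values. *)
Lemma tilted_small_cvg (e : R) : 0 < e ->
  exists w0 : R, forall w, w0 <= w -> (tilted_small w <= e%:E)%E.
Proof.
move=> e0; pose f_ n t := ((expR (beta * xi t))%:E * ((zeta t < expR (xi t - n%:R))%R%:R)%:E)%E.
have mf_ n : measurable_fun setT (f_ n).
  by have ? := msmall n%:R; apply: emeasurable_funM; solve_measurable.
have iw : P.-integrable setT (fun t => (expR (beta * xi t))%:E).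
  apply: ge0_integrable_EFin; first by solve_measurable.
  - by move=> t; exact: expR_ge0.
  - by rewrite w_total ltry.
have cvf_ : {ae P, forall t, setT t -> f_ ^~ t @ \oo --> (cst 0%E : T -> \bar R) t}.
  apply: filterS zeta_gt0 => t zt _; apply: cvg_near_cst.
  exists (Num.trunc (xi t - ln (zeta t))).+1 => // n /= Mn; rewrite /f_.
  rewrite ltNge (_ : expR (xi t - n%:R) <= zeta t) ?mule0//.
  rewrite -[leRHS]lnK ?posrE// ler_expR lerBlDl -lerBlDr.
  by rewrite (le_trans (ltW (truncnS_gt _)))// ler_nat.
have domf_ : {ae P, forall t n, setT t -> (`|f_ n t| <= (expR (beta * xi t))%:E)%E}.
  apply: aeW => t n _; rewrite /f_ -EFinM /= lee_fin ger0_norm ?mulr_ge0 ?expR_ge0//.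
  by rewrite ler_piMr ?expR_ge0//; case: (_ < _).
have [_ _] := dominated_convergence measurableT mf_ (measurable_cst _) cvf_ iw domf_.
rewrite integral0 => cv.
have /fine_cvgP[finN /cvgrPdist_le/(_ _ e0) leN] :
  (\int[P]_t (f_ n t)%E)%E @[n --> \oo] --> 0%:E by exact: cv.
near \oo => n; exists n%:R => w nw.
apply: (@le_trans _ _ (\int[P]_t (f_ n t))%E).
  apply: ge0_le_integral; [exact: measurableT| | |exact: mf_|].
  - by move=> t _; rewrite mule_ge0// lee_fin ?expR_ge0.
  - by have := msmall w => ?; apply: emeasurable_funM; solve_measurable.
  move=> t _; rewrite /f_ -!EFinM lee_fin ler_wpM2l ?expR_ge0// ler_nat.
  case: ltP => // h; rewrite (lt_le_trans h)// ler_expR lerD2l lerN2//.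
have fn : (\int[P]_t (f_ n t))%E \is a fin_num by near: n.
rewrite -(fineK fn) lee_fin (le_trans (ler_norm _))//.
by rewrite -normrN -[X in `|X|]sub0r; near: n.
Unshelve. all: by end_near. Qed.

End perpetuity.

(** * Comparison of the tails of [D_n] and [D_oo] *)

Lemma ge0_integral_lin {d} {T : measurableType d} {R : realType}
  (m : {measure set T -> \bar R}) (f g : T -> R) (k : R) :
  measurable_fun setT f -> measurable_fun setT g ->
  (forall t, 0 <= f t) -> (forall t, 0 <= g t) -> 0 <= k ->
  (\int[m]_t (f t + k * g t)%:E =
   \int[m]_t (f t)%:E + k%:E * \int[m]_t (g t)%:E)%E.
Proof.
move=> mf mg f0 g0 k0; under eq_integral do rewrite EFinD.
have kg0 t : 0 <= k * g t by rewrite mulr_ge0.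
rewrite ge0_integralD//; last 4 first.
- by move=> t _; rewrite lee_fin.
- by solve_measurable.
- by move=> t _; rewrite lee_fin.
- by solve_measurable.
congr (_ + _)%E; under eq_integral do rewrite EFinM.
rewrite ge0_integralZl//; first by solve_measurable.
by move=> t _; rewrite lee_fin.
Qed.

Section tail_facts.
Context {d} {T : measurableType d} {R : realType} (P : probability T R).

Lemma measurable_natr_lt (f g : T -> R) : measurable_fun setT f ->
  measurable_fun setT g -> measurable_fun setT (fun t => (f t < g t)%R%:R : R).
Proof.
by move=> mf mg; apply: measurable_natr_bool; exact: measurable_set_lt.
Qed.

Lemma tail_integral (X : T -> R) x : measurable_fun setT X ->
  ((tail P X x)%:E = \int[P]_t ((x < X t)%R%:R)%:E)%E.
Proof.
move=> mX; have mA : measurable [set t | x < X t] by exact: (measurable_set_lt (cst x) X).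
rewrite /tail fineK ?fin_num_measure// -[LHS]mul1e -integral_cst//.
rewrite integral_mkcond; apply: eq_integral => t _.
rewrite patchE; case: ifPn => [|xX]; first by rewrite inE/= => ->.
by rewrite (_ : (x < X t) = false)//; apply: contraNF xX; rewrite inE.
Qed.

Lemma tail_ge0 (X : T -> R) x : 0 <= tail P X x.
Proof. by rewrite fine_ge0. Qed.

Lemma tail_le1 (X : T -> R) x : measurable_fun setT X -> tail P X x <= 1.
Proof.
move=> mX; have mA : measurable [set t | x < X t] by exact: (measurable_set_lt (cst x) X).
by rewrite -lee_fin /tail fineK ?fin_num_measure// probability_le1.
Qed.

Lemma le_tail (X Y : T -> R) x y : measurable_fun setT X -> measurable_fun setT Y ->
  (forall t, x < X t -> y < Y t) -> tail P X x <= tail P Y y.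
Proof.
move=> mX mY XY; rewrite fine_le ?fin_num_measure//.
- exact: (measurable_set_lt (cst x) X).
- exact: (measurable_set_lt (cst y) Y).
- apply: le_measure; rewrite ?inE => //.
  + exact: (measurable_set_lt (cst x) X).
  + exact: (measurable_set_lt (cst y) Y).
Qed.

End tail_facts.

Section perpetuity_tail.
Context {d} {T : measurableType d} {R : realType} (P : probability T R).
Variables (xi zeta : T -> R) (S D : nat -> T -> R) (beta : R).
Hypotheses (mxi : measurable_fun setT xi) (mzeta : measurable_fun setT zeta).
Hypotheses (mS : forall n, measurable_fun setT (S n))
  (mD : forall n, measurable_fun setT (D n)).
Hypotheses (zeta_ge0 : forall t, 0 <= zeta t).
Hypotheses (S0 : forall t, S 0 t = 0) (D0 : forall t, D 0 t = 0)
  (D_ge0 : forall n t, 0 <= D n t) (D_nd : forall n t, D n t <= D n.+1 t).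
Hypothesis lawM : forall n (g : R * R -> \bar R), measurable_fun setT g ->
  (forall p, 0 <= g p)%E ->
  (\int[P]_t g (S n.+1 t, D n.+1 t) =
   \int[P]_t \int[P]_t' g (S n t + xi t', D n t + zeta t' * expR (S n t))%R)%E.
Hypothesis beta0 : 0 < beta.
Hypothesis w_total : (\int[P]_t (expR (beta * xi t))%:E = 1)%E.
Variable Fbar : R -> R.
Hypothesis cvF : forall y, tail P (D m) y @[m --> \oo] --> Fbar y.

Lemma tail_renewal n m x : ((tail P (D (n + m)) x)%:E =
  \int[P]_t (tail P (D m) ((x - D n t) * expR (- S n t)))%:E)%E.
Proof.
pose g (p : R * R) : \bar R := ((x < p.2)%R%:R)%:E.
have mg : measurable_fun setT g.
  by apply/measurable_EFinP; apply: (measurable_natr_lt (cst x) snd); solve_measurable.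
have g0 p : (0 <= g p)%E by rewrite lee_fin.
rewrite tail_integral//.
rewrite -[LHS]/(\int[P]_t g (S (n + m) t, D (n + m) t))%E.
rewrite (renewal_law P xi zeta S D mxi mzeta S0 D0 lawM _ _ g mg g0).
apply: eq_integral => t _; rewrite tail_integral//; apply: eq_integral => t' _.
rewrite /g /=; congr (_%:E); congr (_%:R); congr nat_of_bool.
by rewrite expRN ltr_pdivrMr ?expR_gt0// ltrBlDl [D m t' * _]mulrC.
Qed.

Lemma tail_nd m k x : (m <= k)%N -> tail P (D m) x <= tail P (D k) x.
Proof.
move=> mk; apply: le_tail => // t; move/lt_le_trans; apply.
elim: k mk => [|k ih]; first by rewrite leqn0 => /eqP ->.
by rewrite leq_eqVlt => /predU1P[->//|/ih/le_trans]; apply.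
Qed.

Lemma tail_le_limit n x : tail P (D n) x <= Fbar x.
Proof.
rewrite -(cvg_lim _ (cvF x))//; apply: limr_ge; first exact: cvgP (cvF x).
by near=> m; apply: tail_nd; near: m; exact: nbhs_infty_ge.
Unshelve. all: by end_near. Qed.

Lemma limit_tail_ge0 x : 0 <= Fbar x.
Proof. exact: le_trans (tail_ge0 P (D 0) x) (tail_le_limit 0 x). Qed.

Lemma limit_tail_le1 x : Fbar x <= 1.
Proof.
rewrite -(cvg_lim _ (cvF x))//; apply: limr_le; first exact: cvgP (cvF x).
by near=> m; exact: tail_le1.
Unshelve. all: by end_near. Qed.

Lemma limit_tail_nonincreasing x y : x <= y -> Fbar y <= Fbar x.
Proof.
move=> xy; apply: (ler_cvg_to (cvF y) (cvF x)); near=> m.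
by apply: le_tail => // t; exact: le_lt_trans.
Unshelve. all: by end_near. Qed.

(** On {D_n > x} the argument (x - D_n) e^{-S_n} is negative; the value 1 there is what brings P{D_n
    > x} out of the renewal equation. *)
Lemma limit_tail_neg x : x < 0 -> Fbar x = 1.
Proof.
move=> x0; apply/eqP; rewrite eq_le limit_tail_le1/=.
rewrite (le_trans _ (tail_le_limit 0 x))// /tail.
rewrite (_ : [set t | _] = setT) ?probability_setT//.
by apply/seteqP; split => // t _ /=; rewrite D0.
Qed.

Let mtail m : measurable_fun setT (fun y : R => (tail P (D m) y)%:E).
Proof.
under eq_fun do rewrite tail_integral//.
apply: (measurable_fun_fubini_tonelli_F (m2 := P)
  (fun p : R * T => ((p.1 < D m p.2)%R%:R)%:E)).
  by apply/measurable_EFinP; apply: (measurable_natr_lt fst (fun p => D m p.2)); solve_measurable.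
by move=> p; rewrite lee_fin.
Qed.

Let arg n x t := (x - D n t) * expR (- S n t).

Let marg n x : measurable_fun setT (arg n x).
Proof.
rewrite (_ : arg n x = (fun t => (x - D n t) * expR (0 - S n t))).
  by solve_measurable.
by apply/funext => t; rewrite sub0r.
Qed.

Let cvFE y : (tail P (D m) y)%:E @[m --> \oo] --> (Fbar y)%:E.
Proof. by apply: cvg_EFin; [exact: nearW|exact: cvF]. Qed.

Let mFarg n x : measurable_fun setT (fun t => Fbar (arg n x t)).
Proof.
apply/measurable_EFinP.
apply: (emeasurable_fun_cvg (fun m t => (tail P (D m) (arg n x t))%:E)) => [m|t _].
  exact: (measurableT_comp (mtail m) (marg n x)).
exact: cvFE.
Qed.

(** Limit m -> oo in [tail_renewal]: the tails of D_m increase with m, so monotone convergence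
    applies and the infinite series itself is never split. *)
Lemma limit_tail_renewal n x :
  ((Fbar x)%:E = \int[P]_t (Fbar ((x - D n t) * expR (- S n t)))%:E)%E.
Proof.
have cv1 : (tail P (D (n + m)) x)%:E @[m --> \oo] --> (Fbar x)%:E.
  have -> : (fun m => (tail P (D (n + m)) x)%:E) =
      (fun m => (tail P (D (m + n)) x)%:E) by apply/funext => m; rewrite addnC.
  by rewrite (cvg_shiftn n (fun m => (tail P (D m) x)%:E)).
have cv2 := @cvg_monotone_convergence _ _ _ P setT measurableT
  (fun m t => (tail P (D m) (arg n x t))%:E)
  (fun m => measurableT_comp (mtail m) (marg n x))
  (fun m t _ => tail_ge0 _ _ _)
  (fun t _ m k mk => tail_nd m k _ mk).
rewrite (_ : (fun m => _) = (fun m => (tail P (D (n + m)) x)%:E)) in cv2; last first.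
  by apply/funext => m; rewrite tail_renewal.
rewrite -(cvg_lim _ cv1)// (cvg_lim _ cv2)//; apply: eq_integral => t _.
by apply: cvg_lim => //; exact: cvFE.
Qed.

Definition tilted_cdf n b : R := fine
  (\int[P]_t ((expR (beta * S n t))%:E * ((S n t <= b)%R%:R)%:E))%E.

Let e_ n t := expR (beta * S n t).
Let ind_ n b t : R := (S n t <= b)%R%:R.

Let mind n b : measurable_fun setT (ind_ n b).
Proof. exact: measurable_le_natr. Qed.

Let me_ n : measurable_fun setT (e_ n).
Proof. by rewrite /e_; solve_measurable. Qed.

Let e_ge0 n t : 0 <= e_ n t. Proof. exact: expR_ge0. Qed.

Let twtotal n : (\int[P]_t (e_ n t)%:E = 1)%E.
Proof. exact: (tilted_total P xi S beta mxi S0 (walk_law P xi zeta S D lawM) w_total n). Qed.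

Lemma tilted_cdf_fin n b : ((tilted_cdf n b)%:E =
  \int[P]_t ((expR (beta * S n t))%:E * ((S n t <= b)%R%:R)%:E))%E.
Proof.
rewrite /tilted_cdf fineK// ge0_fin_numE; last first.
  by apply: integral_ge0 => t _; rewrite mule_ge0// lee_fin expR_ge0.
apply: (@le_lt_trans _ _ 1%E); last exact: ltry.
rewrite -(twtotal n); apply: ge0_le_integral; [exact: measurableT| | | |].
- by move=> t _; rewrite mule_ge0// lee_fin expR_ge0.
- have ? := mind n b; have ? := me_ n.
  by apply: emeasurable_funM; apply/measurable_EFinP.
- by apply/measurable_EFinP; exact: me_.
- move=> t _; rewrite -EFinM lee_fin ler_piMr ?expR_ge0//.
  by rewrite -[leRHS]/(1%:R) ler_nat leq_b1.
Qed.

Lemma tilted_cdf_nd n a b : a <= b -> tilted_cdf n a <= tilted_cdf n b.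
Proof.
move=> ab; rewrite -lee_fin !tilted_cdf_fin.
apply: ge0_le_integral; [exact: measurableT| | | |].
- by move=> t _; rewrite mule_ge0// lee_fin expR_ge0.
- by apply: emeasurable_funM; apply/measurable_EFinP; [exact: me_|exact: mind].
- by apply: emeasurable_funM; apply/measurable_EFinP; [exact: me_|exact: mind].
- move=> t _; rewrite -!EFinM lee_fin ler_wpM2l ?expR_ge0// ler_nat.
  by have [/le_trans/(_ ab)->//|] := leP (S n t) a.
Qed.

Let mup n w : measurable_fun setT (fun t => (expR (w + S n t) < D n t)%R%:R : R).
Proof.
by apply: (measurable_natr_lt (fun t => expR (w + S n t)) (D n)) => //; solve_measurable.
Qed.

Let mlow n w : measurable_fun setT (fun t => (D n t < expR (S n t - w))%R%:R : R).
Proof.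
by apply: (measurable_natr_lt (D n) (fun t => expR (S n t - w))) => //; solve_measurable.
Qed.

Let walk_level n t w x : 0 < x -> (S n t <= ln x - w) = (expR (w + S n t) <= x).
Proof. by move=> x0; rewrite -[in RHS](lnK x0) ler_expR lerBrDl. Qed.

Let powR_arg x s : 0 < x -> (x * expR (- s)) `^ beta * expR (beta * s) = x `^ beta.
Proof.
move=> x0; rewrite powRM ?expR_ge0 ?ltW// powR_expR -mulrA -expRD.
by rewrite mulrN addNr expR0 mulr1.
Qed.

(** Integrates a pointwise inequality. Let S_n <= ln x - w. If D_n > x, then F = 1 pays for the
    indicator, and D_n > e^{w + S_n} puts the weighted term into the error. If D_n <= x, then F ((x
    - D_n) e^{-S_n}) >= F (x e^{-S_n}) >= a x^{-beta} e^{beta S_n}. *)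
Lemma upper_inequality n x w a u : 0 < x -> 0 <= a ->
  (forall z, expR w <= z -> a <= z `^ beta * Fbar z) ->
  (\int[P]_t ((expR (beta * S n t))%:E * ((expR (w + S n t) < D n t)%R%:R)%:E)
   <= u%:E)%E ->
  tail P (D n) x + a / x `^ beta * tilted_cdf n (ln x - w) <=
  Fbar x + a / x `^ beta * u.
Proof.
move=> x0 a0 aF upb; set K := a / _.
have xb0 : 0 < x `^ beta by exact: powR_gt0.
have K0 : 0 <= K by rewrite divr_ge0 ?(ltW xb0).
have mup' := mup n w.
rewrite -lee_fin !EFinD !EFinM tail_integral// tilted_cdf_fin (limit_tail_renewal n x).
apply: (@le_trans _ _ (\int[P]_t (Fbar (arg n x t))%:E + K%:E *
  \int[P]_t (e_ n t * (expR (w + S n t) < D n t)%R%:R)%:E)%E); last first.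
  by rewrite leeD2l// lee_wpmul2l// (le_trans _ upb).
under [X in (_ + _ * X <= _)%E]eq_integral do rewrite -EFinM.
have mx : measurable_fun setT (fun t => (x < D n t)%R%:R : R).
  by apply: (measurable_natr_lt (cst x) (D n)).
have mei := mind n (ln x - w).
have me := me_ n.
have eI t (b : bool) : 0 <= e_ n t * b%:R by rewrite mulr_ge0.
have F0 t := limit_tail_ge0 (arg n x t).
rewrite -!ge0_integral_lin//.
- apply: ge0_le_integral; [exact: measurableT| | | |].
  + by move=> t _; rewrite lee_fin addr_ge0// mulr_ge0.
  + apply/measurable_EFinP; apply: measurable_funD => //; apply: measurable_funM => //.
    exact: measurable_funM.
  + apply/measurable_EFinP; apply: measurable_funD => //; apply: measurable_funM => //.
    exact: measurable_funM.
  move=> t _; rewrite lee_fin /ind_ walk_level//.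
  have [xD|Dx] := ltP x (D n t).
    rewrite (limit_tail_neg (arg n x t)); last first.
      by rewrite /arg pmulr_llt0 ?expR_gt0// subr_lt0.
    rewrite lerD2l ler_wpM2l// ler_wpM2l// ler_nat.
    have [wx|//] := leP (expR (w + S n t)) x.
    by have -> : expR (w + S n t) < D n t by exact: le_lt_trans wx xD.
  rewrite add0r.
  have [wx|_] := leP (expR (w + S n t)) x; last first.
    rewrite !mulr0; apply: addr_ge0 => //; apply: mulr_ge0 => //.
  have [_|Dw] := ltP (expR (w + S n t)) (D n t); first by rewrite lerDr.
  rewrite !mulr0 addr0 mulr1.
  apply: (@le_trans _ _ (Fbar (x * expR (- S n t)))); last first.
    apply: limit_tail_nonincreasing; rewrite /arg ler_wpM2r ?expR_ge0//.
    by rewrite lerBlDr lerDl.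
  have zw : expR w <= x * expR (- S n t).
    by rewrite expRN ler_pdivlMr ?expR_gt0// -expRD.
  rewrite mulrAC ler_pdivrMr// -(powR_arg x (S n t) x0) mulrA.
  by rewrite ler_wpM2r ?expR_ge0// [leRHS]mulrC aF.
- exact: measurable_funM.
- exact: measurable_funM.
Qed.

(* With [y = (1 - dl) x]: if [D_n <= y] then [F ((x - D_n) e^{-S_n})] is at most
   [A / (dl x)^beta e^{beta S_n}]; the sharper constant [a] needs also
   [S_n <= ln x - w] and [D_n <= dl e^{w + S_n}], which gives [D_n <= dl x]. *)
Lemma lower_inequality n x w dl a A0 u k : 0 < x -> 0 <= w -> 0 < dl < 1 -> 0 <= a ->
  (forall z, (1 - dl) * expR w <= z -> z `^ beta * Fbar z <= a) ->
  (forall z, 0 < z -> z `^ beta * Fbar z <= A0) ->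
  (\int[P]_t ((expR (beta * S n t))%:E *
     ((expR (w + ln dl + S n t) < D n t)%R%:R)%:E) <= u%:E)%E ->
  (\int[P]_t ((expR (beta * S n t))%:E * ((D n t < expR (S n t - w))%R%:R)%:E)
   <= k%:E)%E ->
  Fbar x + A0 / (dl * x) `^ beta * tilted_cdf n (ln x - w) <=
  tail P (D n) ((1 - dl) * x) +
  a / ((1 - dl) * x) `^ beta * tilted_cdf n (ln x - w) +
  A0 / (dl * x) `^ beta * u + A0 / (dl * x) `^ beta * tilted_cdf n (ln x + w) +
  A0 / (dl * x) `^ beta * k.
Proof.
move=> x0 w0 /andP[dl0 dl1] a0 aF AF upb lowb.
set y := (1 - dl) * x.
have [K KE] : exists K, K = a / y `^ beta by exists (a / y `^ beta).
have [A AE] : exists A, A = A0 / (dl * x) `^ beta by exists (A0 / (dl * x) `^ beta).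
rewrite -KE -AE.
have y0 : 0 < y by rewrite mulr_gt0// subr_gt0.
have dx0 : 0 < dl * x by rewrite mulr_gt0.
have K0 : 0 <= K by rewrite KE divr_ge0 ?powR_ge0.
have A00 : 0 <= A0.
  by apply: le_trans (AF 1 ltr01); rewrite mulr_ge0 ?powR_ge0 ?limit_tail_ge0.
have A_ge0 : 0 <= A by rewrite AE divr_ge0 ?powR_ge0.
have m1 : measurable_fun setT (fun t => (y < D n t)%R%:R : R).
  by apply: (measurable_natr_lt (cst y) (D n)).
have m2 := mind n (ln x - w).
have m3 := mind n (ln x + w).
have m4 := mup n (w + ln dl).
have m5 := mlow n w.
have me := me_ n.
have eI t (b : bool) : 0 <= e_ n t * b%:R by rewrite mulr_ge0.
have iI b t : 0 <= e_ n t * ind_ n b t by exact: eI.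
have mcM (c : R) (h : T -> R) : measurable_fun setT h -> measurable_fun setT (fun t => c * h t).
  by move=> mh; exact: (measurable_funM (measurable_cst c) mh).
have F0 t := limit_tail_ge0 (arg n x t).
have mF : measurable_fun setT (fun t => Fbar (arg n x t)) by exact: mFarg.
have meM h : measurable_fun setT h -> measurable_fun setT (fun t => e_ n t * h t).
  by move=> mh; exact: measurable_funM.
rewrite -lee_fin !EFinD !EFinM tail_integral// !tilted_cdf_fin (limit_tail_renewal n x).
have le_u := lee_wpmul2l (x := A%:E) A_ge0 upb.
have le_k := lee_wpmul2l (x := A%:E) A_ge0 lowb.
apply: (@le_trans _ _ (\int[P]_t (Fbar (arg n x t) +
  A * (e_ n t * ind_ n (ln x - w) t))%:E)%E).
  by rewrite ge0_integral_lin//; exact: meM.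
apply: (@le_trans _ _ (\int[P]_t ((((y < D n t)%R%:R +
   K * (e_ n t * ind_ n (ln x - w) t)) +
   A * (e_ n t * (expR (w + ln dl + S n t) < D n t)%R%:R)) +
   A * (e_ n t * ind_ n (ln x + w) t) +
   A * (e_ n t * (D n t < expR (S n t - w))%R%:R))%:E)%E); last first.
  have m12 := measurable_funD m1 (mcM K _ (meM _ m2)).
  have m124 := measurable_funD m12 (mcM A _ (meM _ m4)).
  have m1243 := measurable_funD m124 (mcM A _ (meM _ m3)).
  have p1 t : 0 <= (y < D n t)%R%:R + K * (e_ n t * ind_ n (ln x - w) t).
    by rewrite addr_ge0// mulr_ge0.
  have p2 t : 0 <= (y < D n t)%R%:R + K * (e_ n t * ind_ n (ln x - w) t) +
      A * (e_ n t * (expR (w + ln dl + S n t) < D n t)%R%:R).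
    by rewrite addr_ge0// mulr_ge0.
  have p3 t : 0 <= (y < D n t)%R%:R + K * (e_ n t * ind_ n (ln x - w) t) +
      A * (e_ n t * (expR (w + ln dl + S n t) < D n t)%R%:R) +
      A * (e_ n t * ind_ n (ln x + w) t).
    by rewrite addr_ge0// mulr_ge0.
  rewrite ge0_integral_lin//; last exact: meM.
  rewrite ge0_integral_lin//; last exact: meM.
  rewrite ge0_integral_lin//; last exact: meM.
  rewrite ge0_integral_lin//; last exact: meM.
  by rewrite leeD// leeD// leeD.
apply: ge0_le_integral; [exact: measurableT| | | |].
- by move=> t _; rewrite lee_fin addr_ge0// mulr_ge0.
- apply/measurable_EFinP; apply: measurable_funD => //; apply: measurable_funM => //.
  exact: meM.
- apply/measurable_EFinP.
  by do 4 (apply: measurable_funD; last (apply: measurable_funM => //; exact: meM)).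
move=> t _; rewrite lee_fin /ind_ walk_level//.
have -> : (S n t <= ln x + w) = (expR (S n t - w) <= x).
  by rewrite -[in RHS](lnK x0) ler_expR lerBlDr.
have -> : expR (w + ln dl + S n t) = dl * expR (w + S n t).
  by rewrite addrAC expRD lnK// mulrC.
set e := e_ n t; have e0 : 0 <= e by exact: e_ge0.
have powA z : 0 < z -> (z * expR (- S n t)) `^ beta * e = z `^ beta by exact: powR_arg.
have leFA B z : 0 < z -> (z * expR (- S n t)) `^ beta * Fbar (z * expR (- S n t)) <= B ->
    Fbar (z * expR (- S n t)) <= B / z `^ beta * e.
  move=> z0 zB; rewrite mulrAC ler_pdivlMr ?powR_gt0// -(powA z z0).
  by rewrite mulrA ler_wpM2r// mulrC.
have eA0 : 0 <= A * e by rewrite mulr_ge0.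
have eK0 : 0 <= K * e by rewrite mulr_ge0.
have Ab (b : bool) : 0 <= A * (e * b%:R) by exact: mulr_ge0 A_ge0 (eI t b).
have Kb (b : bool) : 0 <= K * (e * b%:R) by exact: mulr_ge0 K0 (eI t b).
have wS : expR (S n t - w) <= expR (w + S n t).
  by rewrite ler_expR addrC lerD2r; lra.
(* The cdf at [ln x - w] stands on the left so that the mass of the window appears without a
   subtraction. Since w >= 0 it is dominated by the cdf at [ln x + w], which settles the case D_n >
   y, where F <= 1. *)
have Amono : A * (e * (expR (w + S n t) <= x)%R%:R) <= A * (e * (expR (S n t - w) <= x)%R%:R).
  by rewrite ler_wpM2l// ler_wpM2l// ler_nat; case: leP => // /(le_trans wS)->.
have T1 : true%:R = 1 :> R by [].
have F1 : false%:R = 0 :> R by [].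
have [yD|Dy] := ltP y (D n t).
  rewrite T1.
  have := limit_tail_le1 (arg n x t); move: Amono.
  move: (Ab (dl * expR (w + S n t) < D n t)) (Ab (D n t < expR (S n t - w))).
  move: (Kb (expR (w + S n t) <= x)). lra.
have xD : dl * x <= x - D n t by move: Dy; rewrite /y; lra.
have FA : Fbar (arg n x t) <= A * e.
  apply: (@le_trans _ _ (Fbar (dl * x * expR (- S n t)))).
    by apply: limit_tail_nonincreasing; rewrite ler_wpM2r ?expR_ge0.
  by rewrite AE; apply: leFA => //; apply: AF; rewrite mulr_gt0 ?expR_gt0.
rewrite F1 add0r; have [wx|xw] := leP (expR (w + S n t)) x.
  rewrite (le_trans wS wx) !T1 !mulr1.
  have [_|Dw] := ltP (dl * expR (w + S n t)) (D n t).
    by rewrite T1 mulr1; move: (Ab (D n t < expR (S n t - w))); lra.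
  rewrite F1 !mulr0.
  suff : Fbar (arg n x t) <= K * e by move: (Ab (D n t < expR (S n t - w))); lra.
  apply: (@le_trans _ _ (Fbar (y * expR (- S n t)))).
    apply: limit_tail_nonincreasing; rewrite ler_wpM2r ?expR_ge0// lerBrDr.
    by rewrite /y -lerBrDl (le_trans Dw)// (_ : _ - _ = dl * x) ?ler_wpM2l ?(ltW dl0)//; ring.
  rewrite KE; apply: leFA => //; apply: aF; rewrite /y -mulrA ler_wpM2l ?subr_ge0 ?(ltW dl1)//.
  by rewrite expRN ler_pdivlMr ?expR_gt0// -expRD.
rewrite F1 !mulr0 ?add0r ?addr0.
(* In the window ln x - w < S_n <= ln x + w the crude bound [FA] is paid by the cdf at
   [ln x + w]. *)
have [_|xSw] := leP (expR (S n t - w)) x.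
  rewrite T1 mulr1; move: (Ab (dl * expR (w + S n t) < D n t)) (Ab (D n t < expR (S n t - w))).
  lra.
(* Above the window D_n <= y <= x < e^{S_n - w}: the ratio D_n e^{-S_n} is small, an event of the
   error term. *)
have -> : (D n t < expR (S n t - w)) = true.
  rewrite (le_lt_trans Dy)// (le_lt_trans _ xSw)// /y.
  by rewrite ler_piMl ?(ltW x0)//; lra.
rewrite T1 ?F1 ?mulr0 ?mulr1 ?addr0 ?add0r; move: (Ab (dl * expR (w + S n t) < D n t)); lra.
Qed.

End perpetuity_tail.

(** * From the central limit theorem to the tail profile *)

Section tilted_transfer.
Context {R : realType} (Phi : R -> R) (K alpha beta c : R).
Hypotheses (Phi_ge0 : forall z, 0 <= Phi z) (Phi_le1 : forall z, Phi z <= 1).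
Hypothesis Phi_lip : forall z h, 0 <= h -> Phi (z + h) <= Phi z + h * K.
Hypothesis PhiN : forall z, Phi (- z) = 1 - Phi z.
Hypotheses (K0 : 0 <= K) (alpha0 : 0 < alpha) (beta0 : 0 < beta) (c0 : 0 < c).
Variables (F : R -> R) (p q : nat -> R -> R).
Hypotheses (F_ge0 : forall x, 0 <= F x) (F_le1 : forall x, F x <= 1).
Hypothesis F_lim : forall e, 0 < e -> exists x0, forall x, x0 <= x ->
  `|x `^ beta * F x - c| <= e.
Hypothesis p_nd : forall m n x, (m <= n)%N -> p m x <= p n x.
Hypothesis q_nd : forall n a b, a <= b -> q n a <= q n b.
Hypothesis upper : forall e, 0 < e -> exists w0, forall w, w0 <= w ->
  forall n x a, 0 < x -> 0 <= a -> (forall z, expR w <= z -> a <= z `^ beta * F z) ->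
  p n x + a / x `^ beta * q n (ln x - w) <= F x + a / x `^ beta * e.
Hypothesis lower : forall e dl, 0 < e -> 0 < dl < 1 -> exists w0, forall w, w0 <= w ->
  forall n x a A, (0 < n)%N -> 0 < x -> 0 <= a ->
  (forall z, (1 - dl) * expR w <= z -> z `^ beta * F z <= a) ->
  (forall z, 0 < z -> z `^ beta * F z <= A) ->
  F x + A / (dl * x) `^ beta * q n (ln x - w) <=
  p n ((1 - dl) * x) + a / ((1 - dl) * x) `^ beta * q n (ln x - w) +
  A / (dl * x) `^ beta * e + A / (dl * x) `^ beta * q n (ln x + w) +
  A / (dl * x) `^ beta * e.
Hypothesis q_clt : forall z e, 0 < e -> exists M, forall n, (M <= n)%N ->
  q n (n%:R * alpha + z * Num.sqrt n%:R) <= Phi z + e /\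
  Phi z <= q n (n%:R * alpha + z * Num.sqrt n%:R) + e.

(** Here alpha r^2 stands for ln x. If N alpha is within alpha of ln x + u r, then ln x + w equals N
    alpha - u sqrt N up to o(sqrt N), because sqrt N - r stays bounded; the bounded shift w
    disappears at this scale. *)
Lemma level_window (u w e : R) (M : nat) : 0 < e -> exists r0, forall r, r0 <= r ->
  forall N : nat, `|N%:R * alpha - (alpha * r ^+ 2 + u * r)| <= alpha ->
  (M <= N)%N /\
  `|alpha * r ^+ 2 + w - N%:R * alpha + u * Num.sqrt N%:R| <= e * Num.sqrt N%:R.
Proof.
(* C' bounds |sqrt N - r|, since |N - r^2| <= C' r for r >= 1. C bounds the whole deviation, which
   is at most e sqrt N once sqrt N >= C / e. *)
move=> e0; pose C' := 1 + `|u| / alpha.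
have C'1 : 1 <= C' by rewrite lerDl divr_ge0 ?(ltW alpha0).
pose C := `|w| + alpha + `|u| * C'.
have C0 : 0 <= C by rewrite !addr_ge0 ?mulr_ge0 ?(ltW alpha0)//; lra.
exists (C' + C / e + M%:R + 1) => r r0 N NH.
have Ce0 : 0 <= C / e by rewrite divr_ge0 ?(ltW e0).
have M0 : 0 <= M%:R :> R by [].
have r1 : 1 <= r by lra.
have rgt0 : 0 < r by lra.
set y := Num.sqrt N%:R; have y0 : 0 <= y by exact: sqrtr_ge0.
have yN : N%:R = y ^+ 2 by rewrite sqr_sqrtr.
have yr : `|y - r| <= C'.
  have : `|y ^+ 2 - r ^+ 2| <= C' * r.
    have -> : y ^+ 2 - r ^+ 2 =
        alpha^-1 * ((N%:R * alpha - (alpha * r ^+ 2 + u * r)) + u * r).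
      by rewrite -yN; field; rewrite gt_eqF.
    rewrite normrM gtr0_norm ?invr_gt0// mulrC ler_pdivrMr// (le_trans (ler_normD _ _))//.
    rewrite (le_trans (lerD NH (lexx _)))// normrM (gtr0_norm rgt0) /C'.
    rewrite (_ : _ * r * alpha = alpha * r + `|u| * r); last by field; rewrite gt_eqF.
    by rewrite lerD2r ler_peMr// ltW.
  rewrite subr_sqr normrM (@ger0_norm _ (y + r)) ?addr_ge0 ?(ltW rgt0)// => H.
  rewrite -(ler_pM2r rgt0) (le_trans _ H)// ler_wpM2l//; lra.
have yM : C / e + M%:R + 1 <= y by move: yr; rewrite ler_norml => /andP[]; lra.
split.
  rewrite -(ler_nat R) yN expr2 (@le_trans _ _ y)//; first by lra.
  by rewrite ler_peMr//; lra.
have -> : alpha * r ^+ 2 + w - N%:R * alpha + u * y =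
    w - (N%:R * alpha - (alpha * r ^+ 2 + u * r)) + u * (y - r) by ring.
apply: (@le_trans _ _ C).
  rewrite (le_trans (ler_normD _ _))// lerD//.
    by rewrite (le_trans (ler_normB _ _))// lerD2l.
  by rewrite normrM ler_wpM2l.
rewrite mulrC -ler_pdivrMr//; lra.
Qed.

(** By [level_window] the level lies between N alpha + (- u - h) sqrt N and N alpha + (- u + h) sqrt
    N. The central limit theorem at these two points and the Lipschitz bound on Phi enclose the
    cdf. *)
Lemma tilted_cdf_level (u w e : R) : 0 < e -> exists r0, forall r, r0 <= r ->
  forall N : nat, `|N%:R * alpha - (alpha * r ^+ 2 + u * r)| <= alpha ->
  (0 < N)%N /\ `|q N (alpha * r ^+ 2 + w) - Phi (- u)| <= e.
Proof.
move=> e0; pose h := e / 2 / (K + 1).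
have K1 : 0 < K + 1 by rewrite ltr_wpDl.
have h0 : 0 < h by rewrite !divr_gt0.
have hK : h * K <= e / 2.
  rewrite /h -mulrA ler_piMr ?divr_ge0 ?(ltW e0)//.
  by rewrite mulrC ler_pdivrMr// mul1r lerDl.
have e20 : 0 < e / 2 by rewrite divr_gt0.
have [M1 HM1] := q_clt (- u + h) _ e20.
have [M2 HM2] := q_clt (- u - h) _ e20.
have [r0 Hr] := level_window u w h (maxn 1 (maxn M1 M2)) h0.
exists r0 => r rr N NH; have [] := Hr r rr N NH.
rewrite !geq_max => /and3P[N1 NM1 NM2] HN; split => //.
have [HM1' _] := HM1 _ NM1; have [_ HM2'] := HM2 _ NM2.
have := Phi_lip (- u) h (ltW h0); have := Phi_lip (- u - h) h (ltW h0).
rewrite subrK => L1 L2; move: HN; rewrite !ler_norml => /andP[Ha Hb].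
have q1 : q N (alpha * r ^+ 2 + w) <= q N (N%:R * alpha + (- u + h) * Num.sqrt N%:R).
  by apply: q_nd; rewrite mulrDl; lra.
have q2 : q N (N%:R * alpha + (- u - h) * Num.sqrt N%:R) <= q N (alpha * r ^+ 2 + w).
  by apply: q_nd; rewrite mulrBl; lra.
apply/andP; split; lra.
Qed.

Let rt x := Num.sqrt (ln x / alpha).

Lemma sqrt_ln_large r0 : exists x0, forall x, x0 <= x ->
  [/\ 0 < x, r0 <= rt x, 0 < rt x & ln x = alpha * rt x ^+ 2].
Proof.
pose b := `|r0| + 1; have b0 : 0 < b by rewrite ltr_wpDl.
exists (expR (alpha * b ^+ 2)) => x x0.
have xgt0 : 0 < x by exact: lt_le_trans (expR_gt0 _) x0.
have lnx : b ^+ 2 <= ln x / alpha.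
  by rewrite ler_pdivlMr// mulrC -ler_expR lnK.
have br : b <= rt x.
  by rewrite -[leLHS](gtr0_norm b0) -sqrtr_sqr ler_wsqrtr.
split => //; last first.
- by rewrite sqr_sqrtr ?(le_trans _ lnx) ?sqr_ge0//; field; rewrite gt_eqF.
- exact: lt_le_trans br.
- by rewrite (le_trans _ br)// (le_trans (ler_norm _))// lerDl.
Qed.

(** The truncation of a real number lies within 1 below it only if that number is nonnegative. *)
Lemma level_ge0 u r : 0 < r -> `|u| / alpha <= r -> 0 <= r ^+ 2 + u * r / alpha.
Proof.
move=> r0 ur; rewrite (_ : _ + _ = r * (r + u / alpha)); last by ring.
rewrite mulr_ge0 ?(ltW r0)// -lerBlDr sub0r -mulNr (le_trans _ ur)//.
by rewrite ler_wpM2r ?invr_ge0 ?(ltW alpha0)// -normrN ler_norm.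
Qed.

(** Time is rounded up: all admissible n are at most a single N, so p_n <= p_N by monotonicity. At N
    the tilted cdf is close to Phi (- u) = 1 - Phi u, and [upper] leaves c - c (1 - Phi u) = c Phi
    u. *)
Lemma tail_below_level u e : 0 < e -> exists x0, forall x, x0 <= x -> forall n : nat,
  n%:R * alpha <= alpha * rt x ^+ 2 + u * rt x -> x `^ beta * p n x <= c * Phi u + e.
Proof.
(* z^beta F is replaced by c twice, at a cost of 2 e1; the cdf and the error term of [upper] each
   cost e1 times a factor [a <= c]. *)
move=> e0; pose e1 := e / (2 + 2 * c).
have c2 : 0 < 2 + 2 * c by rewrite addr_gt0// mulr_gt0.
have e10 : 0 < e1 by rewrite divr_gt0.
have e1E : e1 * (2 + 2 * c) = e by rewrite divfK// gt_eqF.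
have [x1 Hx1] := F_lim _ e10; have [w0 Hw] := upper _ e10.
pose w := Num.max w0 (Num.max 0 x1).
have ww : w0 <= w by rewrite le_max lexx.
have wx : x1 <= expR w.
  by rewrite (le_trans _ (expR_ge1Dx _))// (@le_trans _ _ w) ?lerDr// !le_max lexx !orbT.
have [r0 Hr] := tilted_cdf_level u (- w) _ e10.
have [x2 Hx2] := sqrt_ln_large (Num.max r0 (`|u| / alpha)).
exists (Num.max x1 x2) => x; rewrite ge_max => /andP[/Hx1 xF /Hx2[x0]].
rewrite ge_max => /andP[/Hr{}Hr ur] rx0 lnx n nu.
have r'0 := level_ge0 _ _ rx0 ur; have := truncn_itv r'0.
set N0 := Num.trunc _ => /andP[N1 N2]; pose N := N0.+1.
have aN0 : alpha * (rt x ^+ 2 + u * rt x / alpha) = alpha * rt x ^+ 2 + u * rt x.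
  by field; rewrite gt_eqF.
have nN : (n <= N)%N.
  rewrite leqW// -ltnS -(ltr_nat R) (le_lt_trans _ N2)//.
  by rewrite -(ler_pM2r alpha0) (le_trans nu)// -aN0 mulrC.
have [|_] := Hr N.
  rewrite -aN0 mulrC -mulrBr normrM gtr0_norm// ler_piMr ?(ltW alpha0)//.
  by rewrite ler_norml /N -natr1; move: N2; rewrite -natr1; lra.
rewrite -lnx PhiN => Hq.
pose a := Num.max 0 (c - e1).
have a0 : 0 <= a by rewrite le_max lexx.
have ac : a <= c by rewrite ge_max (ltW c0)/= gerBl ltW.
have ca : c - e1 <= a by rewrite le_max lexx orbT.
have aF z : expR w <= z -> a <= z `^ beta * F z.
  move=> /(le_trans wx)/Hx1; rewrite ler_norml => /andP[Fz _].
  rewrite ge_max mulr_ge0 ?powR_ge0//=; lra.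
have := Hw w ww N x a x0 a0 aF.
have xb0 : 0 < x `^ beta by exact: powR_gt0.
rewrite -(ler_pM2l xb0) !mulrDr.
rewrite (_ : x `^ beta * (a / x `^ beta * q N (ln x - w)) = a * q N (ln x - w)); last first.
  by field; rewrite gt_eqF.
rewrite (_ : x `^ beta * (a / x `^ beta * e1) = a * e1); last by field; rewrite gt_eqF.
have pnN : x `^ beta * p n x <= x `^ beta * p N x by rewrite ler_wpM2l ?powR_ge0// p_nd.
move: Hq xF; rewrite !ler_norml => /andP[q1 _] /andP[_ xF].
have aq : a * (1 - Phi u - e1) <= a * q N (ln x - w) by rewrite ler_wpM2l//; lra.
have ae : a * e1 <= c * e1 by rewrite ler_wpM2r// ltW.
have aP : (c - e1) * (1 - Phi u) <= a * (1 - Phi u) by rewrite ler_wpM2r// subr_ge0.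
have eP : e1 * Phi u >= 0 by rewrite mulr_ge0// ltW.
move: aq aP; rewrite !mulrBr !mulrBl !mulr1; rewrite -e1E mulrDr (mulrCA e1 2 c); lra.
Qed.

(** F <= 1 handles bounded z, the limit handles large z. *)
Lemma scaled_limit_bounded : exists2 A, 0 <= A & forall z, 0 < z -> z `^ beta * F z <= A.
Proof.
have [x1 Hx1] := F_lim _ ltr01; exists (c + 1 + (Num.max x1 0) `^ beta).
  by rewrite !addr_ge0 ?powR_ge0 ?(ltW c0).
move=> z z0; have [/Hx1|zx1] := leP x1 z.
  by rewrite ler_norml => /andP[_]; have := powR_ge0 (Num.max x1 0) beta; lra.
rewrite (@le_trans _ _ (z `^ beta))//; first by rewrite ler_piMr ?powR_ge0.
rewrite (@le_trans _ _ ((Num.max x1 0) `^ beta))//; last by rewrite lerDr addr_ge0// ltW.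
by rewrite ge0_ler_powR ?nnegrE ?(ltW beta0) ?(ltW z0) ?le_max ?lexx ?orbT// (ltW zx1).
Qed.

(** Time is rounded down, so that p_N <= p_n. Since [lower] bounds the tail at (1 - dl) x', it is
    used at x' = x e^tau with 1 - dl = e^{-tau}: the tail is then the one at x, and the logarithmic
    level moves only by tau. [dl], hence [B], is fixed before [e1], because the error terms carry
    the factor [B]. *)
Lemma tail_above_level u e : 0 < e -> exists x0, forall x, x0 <= x -> forall n : nat,
  alpha * rt x ^+ 2 + u * rt x <= n%:R * alpha -> c * Phi u - e <= x `^ beta * p n x.
Proof.
move=> e0; have [A A0 HA] := scaled_limit_bounded.
(* In passing from x'^beta to x^beta one loses c (1 - e^{- tau beta}) <= c tau beta = e / 2. *)
pose tau := e / 2 / (c * beta).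
have cb0 : 0 < c * beta by rewrite mulr_gt0.
have tau0 : 0 < tau by rewrite !divr_gt0.
pose dl := 1 - expR (- tau).
have dl1 : 1 - dl = expR (- tau) by rewrite /dl; ring.
have dl01 : 0 < dl < 1.
  by rewrite subr_gt0 expR_lt1 oppr_lt0 tau0/= ltrBlDr ltrDl expR_gt0.
have [dl0 _] := andP dl01.
have [B BE] : exists B, B = A / (dl * expR tau) `^ beta by eexists.
have B0 : 0 <= B by rewrite BE divr_ge0// powR_ge0.
pose kappa := expR (- tau * beta).
have kappa_ge : c * (1 - kappa) <= e / 2.
  have := expR_ge1Dx (- tau * beta); rewrite -/kappa => H.
  rewrite (@le_trans _ _ (c * (tau * beta)))//.
    by rewrite ler_wpM2l ?(ltW c0)//; lra.
  rewrite (_ : c * (tau * beta) = e / 2)//; rewrite /tau; field.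
  by rewrite !gt_eqF.
have kappa1 : kappa <= 1.
  by rewrite -[leRHS]expR0 ler_expR mulNr oppr_le0 mulr_ge0 ?ltW.
have kappa0 : 0 <= kappa by exact: expR_ge0.
(* (3 + c) e1 covers the limit of z^beta F and the cdf, with e1 <= 1 absorbing a square. 4 B e1
   covers the two error terms of [lower] and a window of mass at most 2 e1. *)
pose G := 3 + c + 4 * B; have G0 : 0 < G by rewrite ltr_wpDr ?mulr_ge0// addr_gt0.
pose e1 := Num.min 1 (e / 2 / G).
have e10 : 0 < e1 by rewrite lt_min ltr01 !divr_gt0.
have e11 : e1 <= 1 by rewrite ge_min lexx.
have e1G : e1 * G <= e / 2 by rewrite -ler_pdivlMr// ge_min lexx orbT.
have [x1 Hx1] := F_lim _ e10; have [w0 Hw] := lower _ _ e10 dl01.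
pose w := Num.max w0 (tau + Num.max 0 x1).
have ww : w0 <= w by rewrite le_max lexx.
have wx : x1 <= (1 - dl) * expR w.
  rewrite dl1 -expRD (le_trans _ (expR_ge1Dx _))// (@le_trans _ _ (- tau + w)) ?lerDr//.
  have : tau + Num.max 0 x1 <= w by rewrite le_max lexx orbT.
  have : x1 <= Num.max 0 x1 by rewrite le_max lexx orbT.
  lra.
have [r0 Hr] := tilted_cdf_level u (tau - w) _ e10.
have [r0' Hr'] := tilted_cdf_level u (tau + w) _ e10.
have [x2 Hx2] := sqrt_ln_large (Num.max (Num.max r0 r0') (`|u| / alpha)).
exists (Num.max x1 x2) => x; rewrite ge_max => /andP[xx1 /Hx2[x0]].
rewrite !ge_max => /andP[/andP[/Hr{}Hr /Hr'{}Hr'] ur] rx0 lnx n nu.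
have r'0 := level_ge0 _ _ rx0 ur; have := truncn_itv r'0.
set N := Num.trunc _ => /andP[N1 N2].
have aN0 : alpha * (rt x ^+ 2 + u * rt x / alpha) = alpha * rt x ^+ 2 + u * rt x.
  by field; rewrite gt_eqF.
have nN : (N <= n)%N.
  rewrite -(ler_nat R) (le_trans N1)//.
  by rewrite -(ler_pM2l alpha0) aN0 (le_trans nu)// mulrC.
have NH : `|N%:R * alpha - (alpha * rt x ^+ 2 + u * rt x)| <= alpha.
  rewrite -aN0 mulrC -mulrBr normrM gtr0_norm// ler_piMr ?(ltW alpha0)//.
  by rewrite ler_norml; move: N2; rewrite -natr1; lra.
have [N0 Hq] := Hr _ NH; have [_ Hq'] := Hr' _ NH.
move: Hq Hq'; rewrite !PhiN addrA -addrA -lnx => Hq Hq'.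
pose x' := x * expR tau; have x'0 : 0 < x' by rewrite mulr_gt0 ?expR_gt0.
have lnx' : ln x' = ln x + tau by rewrite lnM ?posrE ?expR_gt0// expRK.
have x'E : (1 - dl) * x' = x.
  by rewrite dl1 mulrCA -expRD addNr expR0 mulr1.
have ce0 : 0 <= c + e1 by rewrite addr_ge0 ?ltW.
have aF z : (1 - dl) * expR w <= z -> z `^ beta * F z <= c + e1.
  by move=> /(le_trans wx)/Hx1; rewrite ler_norml => /andP[_]; lra.
have := Hw w ww N x' _ A N0 x'0 ce0 aF HA.
have xb0 : 0 < x `^ beta by exact: powR_gt0.
have dlx' : A / (dl * x') `^ beta = B / x `^ beta.
  rewrite BE /x' mulrCA [x * _]mulrC powRM ?(ltW x0) ?mulr_ge0 ?expR_ge0 ?(ltW dl0)//.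
  by rewrite invfM mulrA.
rewrite x'E dlx' lnx' -(ler_pM2l xb0) !mulrDr.
have xM h : x `^ beta * (B / x `^ beta * h) = B * h by field; rewrite gt_eqF.
rewrite !xM (_ : x `^ beta * ((c + e1) / x `^ beta * q N (ln x + tau - w)) =
  (c + e1) * q N (ln x + tau - w)); last by field; rewrite gt_eqF.
have -> : x `^ beta * F x' = kappa * (x' `^ beta * F x').
  by rewrite mulrA -[in LHS]x'E dl1 powRM ?expR_ge0 ?(ltW x'0)// powR_expR /kappa [beta * _]mulrC.
have pnN : x `^ beta * p N x <= x `^ beta * p n x by rewrite ler_wpM2l ?powR_ge0// p_nd.
have /Hx1 : x1 <= x'.
  by rewrite (le_trans xx1)// ler_peMr ?(ltW x0)// -[leLHS]expR0 ler_expR ltW.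
rewrite ler_norml => /andP[xF _].
have kF : kappa * (c - e1) <= kappa * (x' `^ beta * F x').
  by rewrite ler_wpM2l//; lra.
move: Hq Hq'; rewrite !ler_norml !addrA => /andP[qa qb] /andP[qc qd].
have Bq : B * q N (ln x + tau + w) <= B * q N (ln x + tau - w) + B * (2 * e1).
  by rewrite -mulrDr ler_wpM2l//; lra.
have cq : (c + e1) * q N (ln x + tau - w) <= (c + e1) * (1 - Phi u + e1).
  by rewrite ler_wpM2l//; lra.
have k1 : kappa * e1 <= 1 * e1 by rewrite ler_wpM2r// ltW.
have e1P : e1 * (1 - Phi u + e1) <= e1 * 2.
  by rewrite ler_wpM2l ?(ltW e10)//; have := Phi_ge0 u; lra.
have kF' : c - e / 2 - e1 <= kappa * (c - e1) by lra.
have cq' : (c + e1) * (1 - Phi u + e1) <= c - c * Phi u + c * e1 + 2 * e1 by lra.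
have e1G' : 3 * e1 + c * e1 + 4 * (B * e1) <= e / 2 by move: e1G; rewrite /G; lra.
move: Bq; rewrite (_ : B * (2 * e1) = 2 * (B * e1)); last by ring.
lra.
Qed.

End tilted_transfer.

(** * Elementary properties of the normal distribution function *)

Section normal_cdf_facts.
Context {R : realType} (s : R) (s0 : 0 < s).
Let Phi z := fine (normal_prob 0 s `]-oo, z]).

Let PhiE z : (Phi z)%:E = normal_prob 0 s `]-oo, z].
Proof. by rewrite fineK// fin_num_measure. Qed.

Lemma normal_cdf_ge0 z : 0 <= Phi z.
Proof. exact: fine_ge0. Qed.

Lemma normal_cdf_le1 z : Phi z <= 1.
Proof. by rewrite -lee_fin PhiE; exact: probability_le1. Qed.

Lemma normal_cdf_nd a b : a <= b -> Phi a <= Phi b.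
Proof.
move=> ab; rewrite -lee_fin !PhiE; apply: le_measure; rewrite ?inE//.
by move=> x /=; rewrite !in_itv/= => /le_trans; apply.
Qed.

Lemma normal_cdf_lipschitz z dl : 0 <= dl -> Phi (z + dl) <= Phi z + dl * normal_peak s.
Proof. by move=> dl0; rewrite -lee_fin EFinD !PhiE; exact: normal_prob_lipschitz. Qed.

(** Reflection gives the mass of [z, +oo[; the endpoint may be moved across because the law has no
    atoms. *)
Lemma normal_cdfN z : Phi (- z) = 1 - Phi z.
Proof.
have s0' : s != 0 by rewrite gt_eqF.
have eN : normal_prob 0 s `]-oo, - z] = normal_prob 0 s `[z, +oo[.
  rewrite normal_probE /normal_prob -ge0_integral_oppr.
  - rewrite [RHS]integral_mkcond; apply: eq_integral => x _.
    rewrite normal_pdf_oppr// lerN2 patchE.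
    rewrite (_ : (x \in `[z, +oo[%classic) = (z <= x)).
      by case: (z <= x); rewrite ?mule1 ?mule0.
    by apply/idP/idP; rewrite inE/= in_itv/= andbT.
  - apply: emeasurable_funM; first by apply/measurable_EFinP; exact: measurable_normal_pdf.
    by apply/measurable_EFinP; exact: (measurable_le_natr id).
  - by move=> x; rewrite mule_ge0// lee_fin normal_pdf_ge0.
have e1 : normal_prob 0 s `]-oo, z] = normal_prob 0 s `]-oo, z[.
  rewrite /normal_prob integral_itv_bndo_bndc//.
  by apply/measurable_EFinP; apply: measurable_funTS; exact: measurable_normal_pdf.
have : normal_prob 0 s (~` `]-oo, z[) = (1 - normal_prob 0 s `]-oo, z[)%E.
  exact: probability_setC.
rewrite setCitvl -eN -e1 -!PhiE.
by rewrite -EFinB => -[].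
Qed.

Lemma normal_cdf_small e : 0 < e -> exists2 Z, 0 < Z & Phi (- Z) <= e.
Proof.
move=> e0.
pose F (n : nat) : set R := `]-oo, - (n%:R : R)]%classic.
have mF n : measurable (F n : set (measurableTypeR R)) by exact: measurable_itv.
have capF : \bigcap_n F n = set0.
  apply/seteqP; split => // x Fx; have := archi_boundP (normr_ge0 x).
  have := Fx (Num.bound `|x|) I; rewrite /F/= in_itv/= => xb.
  move: (ler_norm (- x)); rewrite normrN => x1 x2; suff : false by [].
  lra.
have cvF : normal_prob 0 s (F n) @[n --> \oo] --> (0 : \bar R).
  rewrite -(measure0 (normal_prob 0 s)) -capF; apply: nonincreasing_cvg_mu => //.
  - by rewrite (le_lt_trans (probability_le1 _ _))// ltry.
  - by rewrite capF.
  - move=> n m nm; apply/subsetPset => x; rewrite /F/= !in_itv/= => /le_trans; apply.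
    by rewrite lerN2 ler_nat.
have cvPhi : Phi (- n%:R) @[n --> \oo] --> (0 : R) by exact: (fine_cvg cvF).
have [N _ /(_ N.+1 (leqnSn _)) PhiN] : \forall n \near \oo, Phi (- n%:R) < e.
  exact: (cvgr_lt 0 cvPhi).
by exists N.+1%:R => //; exact: ltW.
Qed.

End normal_cdf_facts.

(** * Uniformity over all times *)

Section uniform_profile.
Context {R : realType} (Phi : R -> R) (K c : R).
Hypotheses (Phi_ge0 : forall z, 0 <= Phi z) (Phi_le1 : forall z, Phi z <= 1).
Hypothesis Phi_nd : forall a b, a <= b -> Phi a <= Phi b.
Hypothesis Phi_lip : forall z h, 0 <= h -> Phi (z + h) <= Phi z + h * K.
Hypothesis PhiN : forall z, Phi (- z) = 1 - Phi z.
Hypothesis Phi_small : forall e, 0 < e -> exists2 Z, 0 < Z & Phi (- Z) <= e.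
Hypotheses (K0 : 0 <= K) (c0 : 0 < c).
Variables (X V : nat -> R -> R) (G : R -> R).
Hypotheses (X_ge0 : forall n x, 0 <= X n x) (X_le : forall n x, X n x <= G x).
Hypothesis G_lim : forall e, 0 < e -> exists x0, forall x, x0 <= x -> `|G x - c| <= e.
Hypothesis below : forall u e, 0 < e -> exists x0, forall x, x0 <= x -> forall n,
  V n x <= u -> X n x <= c * Phi u + e.
Hypothesis above : forall u e, 0 < e -> exists x0, forall x, x0 <= x -> forall n,
  u <= V n x -> c * Phi u - e <= X n x.

Lemma eventually_all_levels (e : R) (g : nat -> R) (m : nat) : 0 < e ->
  exists x0, forall x, x0 <= x -> forall i, (i <= m)%N -> forall n,
  (V n x <= g i -> X n x <= c * Phi (g i) + e) /\
  (g i <= V n x -> c * Phi (g i) - e <= X n x).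
Proof.
move=> e0; elim: m => [|m [x0 ih]].
  have [x1 H1] := below (g 0) _ e0; have [x2 H2] := above (g 0) _ e0.
  exists (Num.max x1 x2) => x; rewrite ge_max => /andP[/H1{}H1 /H2{}H2] i.
  by rewrite leqn0 => /eqP-> n; split => [/H1|/H2].
have [x1 H1] := below (g m.+1) _ e0; have [x2 H2] := above (g m.+1) _ e0.
exists (Num.max x0 (Num.max x1 x2)) => x; rewrite !ge_max => /and3P[/ih{}ih /H1{}H1 /H2{}H2] i.
by rewrite leq_eqVlt => /predU1P[-> n|/ih//]; split => [/H1|/H2].
Qed.

Lemma late_profile e : 0 < e -> exists Z x0, forall x, x0 <= x -> forall n,
  Z <= V n x -> G x - X n x <= e.
Proof.
move=> e0; have e40 : 0 < e / 4 by rewrite divr_gt0.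
have [Z Z0 HZ] := Phi_small (e / 4 / c) (divr_gt0 e40 c0).
have [x1 H1] := above Z _ e40; have [x2 H2] := G_lim _ e40.
exists Z, (Num.max x1 x2) => x; rewrite ge_max => /andP[/H1{}H1 /H2{}H2] n /H1.
move: HZ; rewrite PhiN ler_pdivlMr// mulrC mulrBr; move: H2.
rewrite ler_norml => /andP[]; lra.
Qed.

(** Polya's argument: [below] and [above] already hold for all n on one side of a level, so two
    neighbouring points of a finite grid on [- Z, Z] trap [X n x], and Phi varies by at most h K
    between them. Left of - Z both quantities are small; right of Z both are close to c, the bound
    [X n x <= G x] serving from above. *)
Lemma uniform_profile e : 0 < e -> exists x0, forall x, x0 <= x -> forall n,
  `|X n x - c * Phi (V n x)| <= e.
Proof.
move=> e0; have e20 : 0 < e / 2 by rewrite divr_gt0.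
have [Z Z0] := Phi_small (e / 2 / c) (divr_gt0 e20 c0).
rewrite ler_pdivlMr// mulrC => HZ.
have K1 : 0 < K + 1 by rewrite ltr_wpDl.
have cK : 0 < c * (K + 1) by rewrite mulr_gt0.
have [h hE] : exists h, h = e / 2 / (c * (K + 1)) by eexists.
have h0 : 0 < h by rewrite hE divr_gt0.
have chK : c * (h * K) <= e / 2.
  rewrite (_ : e / 2 = c * (h * (K + 1))); last by rewrite hE; field; rewrite !gt_eqF.
  by rewrite ler_wpM2l ?(ltW c0)// ler_wpM2l ?(ltW h0)// lerDl.
pose m := (Num.trunc (2 * Z / h)).+1.
have mh : 2 * Z < m%:R * h.
  rewrite -ltr_pdivrMr//.
  by have /andP[] := truncn_itv (divr_ge0 (ltW (mulr_gt0 (ltr0n _ 2) Z0)) (ltW h0)).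
have [x1 H1] := eventually_all_levels _ (fun i => i%:R * h - Z) m e20.
have [x2 H2] := below (- Z) _ e20.
have [x3 H3] := above Z _ e20; have [x4 H4] := G_lim _ e20.
exists (Num.max (Num.max x1 x2) (Num.max x3 x4)) => x; rewrite !ge_max.
move=> /andP[/andP[/H1{}H1 /H2{}H2] /andP[/H3{}H3 /H4{}H4]] n.
have [v1|v1] := leP (V n x) (- Z).
  have := H2 n v1; have := Phi_nd _ _ v1; have := Phi_ge0 (V n x) => P0 P1.
  have := X_ge0 n x.
  have : c * Phi (V n x) <= c * Phi (- Z) by rewrite ler_wpM2l// ltW.
  have : 0 <= c * Phi (V n x) by rewrite mulr_ge0// ltW.
  rewrite ler_norml => *; apply/andP; split; lra.
have [v2|v2] := leP Z (V n x).
  have := H3 n v2; have := Phi_nd _ _ v2 => P1; have := X_le n x.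
  have : c * Phi Z <= c * Phi (V n x) by rewrite ler_wpM2l// ltW.
  have : c * Phi (V n x) <= c * 1 by rewrite ler_wpM2l// ltW.
  move: H4 HZ; rewrite PhiN mulrBr mulr1 !ler_norml => /andP[? ?] *.
  apply/andP; split; lra.
have vZ0 : 0 <= V n x + Z by lra.
have := truncn_itv (divr_ge0 vZ0 (ltW h0)); set k := Num.trunc _.
rewrite ler_pdivlMr// ltr_pdivrMr// => /andP[k1 k2].
have km : (k.+1 <= m)%N.
  by rewrite -(ltr_nat R) -(ltr_pM2r h0); lra.
have [_ /(_ _)Hk] := H1 k (ltnW km) n; have [/(_ _)Hk' _] := H1 k.+1 km n.
have /Hk{}Hk : k%:R * h - Z <= V n x by lra.
have /Hk'{}Hk' : V n x <= k.+1%:R * h - Z by lra.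
have L : Phi (k.+1%:R * h - Z) <= Phi (k%:R * h - Z) + h * K.
  rewrite (_ : k.+1%:R * h - Z = k%:R * h - Z + h); last by rewrite -natr1; ring.
  exact: Phi_lip (ltW h0).
have P1 : Phi (k%:R * h - Z) <= Phi (V n x) by apply: Phi_nd; lra.
have P2 : Phi (V n x) <= Phi (k.+1%:R * h - Z) by apply: Phi_nd; lra.
have cL : c * Phi (k.+1%:R * h - Z) <= c * (Phi (k%:R * h - Z) + h * K).
  by rewrite ler_wpM2l// ltW.
have cP1 : c * Phi (k%:R * h - Z) <= c * Phi (V n x) by rewrite ler_wpM2l// ltW.
have cP2 : c * Phi (V n x) <= c * Phi (k.+1%:R * h - Z) by rewrite ler_wpM2l// ltW.
move: cL; rewrite mulrDr => cL; rewrite ler_norml; apply/andP; split; lra.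
Qed.

End uniform_profile.

Lemma sim_powR_lim {R : realType} (F : R -> R) (beta c e : R) : 0 < c ->
  sim F (fun x => c / x `^ beta) -> 0 < e ->
  exists x0, forall x, x0 <= x -> `|x `^ beta * F x - c| <= e.
Proof.
move=> c0 /cvgrPdist_le Fc e0.
have [M [_ HM]] := Fc (e / c) (divr_gt0 e0 c0).
exists (Num.max (M + 1) 1) => x; rewrite ge_max => /andP[xM x1].
have x0 : 0 < x by rewrite (lt_le_trans ltr01).
have xb0 : 0 < x `^ beta by exact: powR_gt0.
have /HM : M < x by rewrite (lt_le_trans _ xM)// ltrDl.
rewrite /= ler_pdivlMr// -[X in _ * X](gtr0_norm c0) -normrM.
rewrite (_ : (_ - _) * c = c - x `^ beta * F x) 1?distrC//.
by field; rewrite !gt_eqF.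
Qed.

(** * The tail profile from the one-step law *)

Section perpetuity_profile.
Context {d} {T : measurableType d} {R : realType} (P : probability T R).
Variables (xi zeta : T -> R) (S D : nat -> T -> R) (beta alpha s : R).
Hypotheses (mxi : measurable_fun setT xi) (mzeta : measurable_fun setT zeta).
Hypotheses (mS : forall n, measurable_fun setT (S n))
  (mD : forall n, measurable_fun setT (D n)).
Hypotheses (zeta_ge0 : forall t, 0 <= zeta t)
  (zeta_gt0 : {ae P, forall t, 0 < zeta t}).
Hypotheses (S0 : forall t, S 0 t = 0) (D0 : forall t, D 0 t = 0)
  (D_ge0 : forall n t, 0 <= D n t) (D_nd : forall n t, D n t <= D n.+1 t).
Hypothesis lawM : forall n (g : R * R -> \bar R), measurable_fun setT g ->
  (forall p, 0 <= g p)%E ->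
  (\int[P]_t g (S n.+1 t, D n.+1 t) =
   \int[P]_t \int[P]_t' g (S n t + xi t', D n t + zeta t' * expR (S n t))%R)%E.
Hypotheses (beta0 : 0 < beta) (alpha0 : 0 < alpha) (s0 : 0 < s).
Hypothesis w_total : (\int[P]_t (expR (beta * xi t))%:E = 1)%E.
Hypothesis w_mean : (\int[P]_t (expR (beta * xi t) * (xi t - alpha))%:E = 0)%E.
Hypothesis w_var :
  (\int[P]_t (expR (beta * xi t) * (xi t - alpha) ^+ 2)%:E = (s ^+ 2)%:E)%E.
Hypothesis zeta_beta : (\int[P]_t (zeta t `^ beta)%:E < +oo)%E.
Hypothesis xi_pos : (0 < P [set t | (0 < xi t)%R])%E.
Variables (Fbar : R -> R) (c : R).
Hypothesis cvF : forall y, tail P (D m) y @[m --> \oo] --> Fbar y.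
Hypothesis c0 : 0 < c.
Hypothesis F_sim : sim Fbar (fun x => c / x `^ beta).

Let Phi z := fine (normal_prob 0 s `]-oo, z]).
Let p n x := tail P (D n) x.
Let q n b := tilted_cdf P S beta n b.
Let V n x := (n%:R * alpha - ln x) / Num.sqrt (alpha^-1 * ln x).
Let K0 : 0 <= normal_peak s. Proof. exact: normal_peak_ge0. Qed.
Let F_ge0 x := limit_tail_ge0 P D mD D_nd Fbar cvF x.
Let F_le1 x := limit_tail_le1 P D mD Fbar cvF x.
Let F_lim e := sim_powR_lim Fbar beta c e c0 F_sim.

Let p_nd m n x : (m <= n)%N -> p m x <= p n x.
Proof. exact: tail_nd. Qed.

Let q_nd n a b : a <= b -> q n a <= q n b.
Proof. exact: (tilted_cdf_nd P xi zeta S D beta mxi mS S0 lawM w_total). Qed.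

Let tail_threshold e : 0 < e -> exists w0, forall w, w0 <= w -> forall n,
  (\int[P]_t ((expR (beta * S n t))%:E * ((expR (w + S n t) < D n t)%R%:R)%:E)
   <= e%:E)%E.
Proof.
(* At most 1 for subadditivity of the power, strictly between 0 and beta for the recursion to
   contract. *)
move=> e0; pose th := Num.min 1 beta / 2.
have m0 : 0 < Num.min 1 beta by rewrite lt_min ltr01.
have th0 : 0 < th by rewrite divr_gt0.
have thm : th < Num.min 1 beta by rewrite ltr_pdivrMr// ltr_pMr// ltr1n.
have th1 : th <= 1 by rewrite (le_trans (ltW thm))// ge_min lexx.
have thb : th < beta by rewrite (lt_le_trans thm)// ge_min lexx orbT.
have [C C0 HC] := tilted_upper_tail P xi zeta S D beta mxi mzeta mS mD zeta_ge0
  S0 D0 D_ge0 lawM beta0 w_total th th0 th1 thb zeta_beta xi_pos.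
exists (C / (e * th)) => w wC n; rewrite (le_trans (HC n w))// lee_fin.
have : C <= e * (th * w) by rewrite mulrA mulrC -ler_pdivrMr// mulr_gt0.
move/le_trans => HCe; rewrite expRN ler_pdivrMr ?expR_gt0// HCe//.
by rewrite ler_wpM2l ?(ltW e0)// (le_trans _ (expR_ge1Dx _))// lerDr.
Qed.

Let upper e : 0 < e -> exists w0, forall w, w0 <= w ->
  forall n x a, 0 < x -> 0 <= a -> (forall z, expR w <= z -> a <= z `^ beta * Fbar z) ->
  p n x + a / x `^ beta * q n (ln x - w) <= Fbar x + a / x `^ beta * e.
Proof.
move=> /tail_threshold[w0 Hw]; exists w0 => w ww n x a x0 a0 aF.
exact: (upper_inequality P xi zeta S D beta mxi mzeta mS mD S0 D0 D_ge0 D_nd lawM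
  w_total Fbar cvF n x w a e x0 a0 aF (Hw w ww n)).
Qed.

Let lower e dl : 0 < e -> 0 < dl < 1 -> exists w0, forall w, w0 <= w ->
  forall n x a A, (0 < n)%N -> 0 < x -> 0 <= a ->
  (forall z, (1 - dl) * expR w <= z -> z `^ beta * Fbar z <= a) ->
  (forall z, 0 < z -> z `^ beta * Fbar z <= A) ->
  Fbar x + A / (dl * x) `^ beta * q n (ln x - w) <=
  p n ((1 - dl) * x) + a / ((1 - dl) * x) `^ beta * q n (ln x - w) +
  A / (dl * x) `^ beta * e + A / (dl * x) `^ beta * q n (ln x + w) +
  A / (dl * x) `^ beta * e.
Proof.
move=> e0 dl01; have [w1 Hw1] := tail_threshold e e0.
have [w2 Hw2] := tilted_small_cvg P xi zeta beta mxi mzeta zeta_gt0 w_total e e0.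
(* The upper tail event of [lower_inequality] is taken at [w + ln dl], hence the shift of [w1]. *)
exists (Num.max 0 (Num.max (w1 - ln dl) w2)) => w; rewrite !ge_max.
move=> /and3P[w0 ww1 ww2] n x a A n0 x0 a0 aF AF; rewrite lerBlDr in ww1.
apply: (lower_inequality P xi zeta S D beta mxi mzeta mS mD S0 D0 D_nd lawM
  w_total Fbar cvF n x w dl a A e e x0 w0 dl01 a0 aF AF (Hw1 _ ww1 n)).
case: n n0 => // n _.
exact: le_trans (tilted_lower_tail P xi zeta S D beta mxi mzeta mS mD S0 D_ge0 lawM
  w_total n w) (Hw2 w ww2).
Qed.

Let q_clt z e : 0 < e -> exists M, forall n, (M <= n)%N ->
  q n (n%:R * alpha + z * Num.sqrt n%:R) <= Phi z + e /\
  Phi z <= q n (n%:R * alpha + z * Num.sqrt n%:R) + e.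
Proof.
move=> e0; have [M HM] := tilted_clt P xi S beta alpha s mxi mS S0
  (walk_law P xi zeta S D lawM) s0 w_total w_mean w_var z e e0.
exists M => n /HM.
rewrite -(tilted_cdf_fin P xi zeta S D beta mxi mS S0 lawM w_total).
have -> : normal_prob 0 s `]-oo, z] = (Phi z)%:E by rewrite fineK// fin_num_measure.
by rewrite -!EFinD !lee_fin.
Qed.

Let levelE u x n : 0 < ln x -> (V n x <= u) =
    (n%:R * alpha <= alpha * Num.sqrt (ln x / alpha) ^+ 2 + u * Num.sqrt (ln x / alpha)) /\
  (u <= V n x) =
    (alpha * Num.sqrt (ln x / alpha) ^+ 2 + u * Num.sqrt (ln x / alpha) <= n%:R * alpha).
Proof.
move=> lnx; have la : 0 < ln x / alpha by rewrite divr_gt0.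
rewrite /V [alpha^-1 * _]mulrC sqr_sqrtr ?(ltW la)//.
rewrite (_ : alpha * (ln x / alpha) = ln x); last by field; rewrite gt_eqF.
by rewrite ler_pdivrMr ?sqrtr_gt0// ler_pdivlMr ?sqrtr_gt0// lerBlDl lerBrDl.
Qed.

Let ln_gt0_from : forall x : R, 2 <= x -> 0 < ln x.
Proof. by move=> x x2; rewrite ln_gt0// (lt_le_trans _ x2)// ltr1n. Qed.

Let below u e : 0 < e -> exists x0, forall x, x0 <= x -> forall n,
  V n x <= u -> x `^ beta * p n x <= c * Phi u + e.
Proof.
move=> e0; have [x0 Hx0] := tail_below_level Phi (normal_peak s) alpha beta c
  (normal_cdf_ge0 s) (normal_cdf_le1 s) (normal_cdf_lipschitz s s0) (normal_cdfN s s0)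
  K0 alpha0 c0 Fbar p q F_ge0 F_lim p_nd q_nd upper q_clt u e e0.
exists (Num.max x0 2) => x; rewrite ge_max => /andP[/Hx0{}Hx0 /ln_gt0_from x2] n.
by have [-> _] := levelE u x n x2; exact: Hx0.
Qed.

Let above u e : 0 < e -> exists x0, forall x, x0 <= x -> forall n,
  u <= V n x -> c * Phi u - e <= x `^ beta * p n x.
Proof.
move=> e0; have [x0 Hx0] := tail_above_level Phi (normal_peak s) alpha beta c
  (normal_cdf_ge0 s) (normal_cdf_lipschitz s s0) (normal_cdfN s s0)
  K0 alpha0 beta0 c0 Fbar p q F_le1 F_lim p_nd q_nd lower q_clt u e e0.
exists (Num.max x0 2) => x; rewrite ge_max => /andP[/Hx0{}Hx0 /ln_gt0_from x2] n.
by have [_ ->] := levelE u x n x2; exact: Hx0.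
Qed.

Let X_le n x : x `^ beta * p n x <= x `^ beta * Fbar x.
Proof. by rewrite ler_wpM2l ?powR_ge0//; exact: tail_le_limit. Qed.

Lemma perpetuity_uniform_tail e : 0 < e -> \forall x \near +oo%R, forall n : nat,
  `|p n x - c / x `^ beta * Phi (V n x)| <= e / x `^ beta.
Proof.
move=> e0; have [x0 Hx0] := uniform_profile Phi (normal_peak s) c
  (normal_cdf_ge0 s) (normal_cdf_le1 s) (normal_cdf_nd s) (normal_cdf_lipschitz s s0)
  (normal_cdfN s s0) (normal_cdf_small s) K0 c0 (fun n x => x `^ beta * p n x) V
  (fun x => x `^ beta * Fbar x) (fun n x => mulr_ge0 (powR_ge0 _ _) (tail_ge0 P _ _))
  X_le F_lim below above e e0.
near=> x => n; have xx0 : x0 <= x by near: x; apply: nbhs_pinfty_ge; exact: num_real.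
have xgt0 : 0 < x by near: x; apply: nbhs_pinfty_gt; exact: num_real.
have xb0 : 0 < x `^ beta by exact: powR_gt0.
rewrite ler_pdivlMr// -[X in _ * X](gtr0_norm xb0) -normrM.
rewrite (_ : (_ - _) * _ = x `^ beta * p n x - c * Phi (V n x)) ?Hx0//.
by field; rewrite gt_eqF.
Unshelve. all: by end_near. Qed.

Lemma perpetuity_late_tail (U : R -> R) (n : R -> nat) : U x @[x --> +oo%R] --> +oo%R ->
  (\forall x \near +oo%R, alpha^-1 * ln x + U x * Num.sqrt (ln x) < (n x)%:R) ->
  sim (fun x => tail P (D (n x)) x) Fbar.
Proof.
move=> Uoo nU; apply/cvgrPdist_le => e e0.
(* x^beta F is eventually at least c / 2, so an absolute error e c / 2 gives a relative error e. *)
have ec0 : 0 < e * (c / 2) by rewrite mulr_gt0// divr_gt0.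
have [Z [x1 H1]] := late_profile Phi c (normal_cdfN s s0) (normal_cdf_small s) c0
  (fun n x => x `^ beta * p n x) V (fun x => x `^ beta * Fbar x) F_lim above _ ec0.
have [x2 H2] := F_lim _ (divr_gt0 c0 (ltr0n _ 2)).
near=> x.
have xx1 : x1 <= x by near: x; apply: nbhs_pinfty_ge; exact: num_real.
have xx2 : x2 <= x by near: x; apply: nbhs_pinfty_ge; exact: num_real.
have xge2 : 2 <= x by near: x; apply: nbhs_pinfty_ge; exact: num_real.
have x0 : 0 < x by rewrite (lt_le_trans _ xge2).
have lnx := ln_gt0_from x xge2.
have xb0 : 0 < x `^ beta by exact: powR_gt0.
(* n alpha - ln x exceeds alpha U sqrt (ln x), while the denominator of [V] is sqrt (ln x / alpha):
   this bound on U gives V >= |Z|. *)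
have Ux : `|Z| * Num.sqrt alpha^-1 / alpha <= U x.
  by near: x; exact: (proj1 (cvgryPge _) Uoo).
have nx : alpha^-1 * ln x + U x * Num.sqrt (ln x) < (n x)%:R by near: x.
have ZV : Z <= V (n x) x.
  rewrite (le_trans (ler_norm _))// /V ler_pdivlMr ?sqrtr_gt0 ?mulr_gt0 ?invr_gt0//.
  rewrite sqrtrM ?invr_ge0 ?(ltW alpha0)// mulrA.
  have UL : `|Z| * Num.sqrt alpha^-1 * Num.sqrt (ln x) <= alpha * (U x * Num.sqrt (ln x)).
    by rewrite [leRHS]mulrA ler_wpM2r ?sqrtr_ge0// [alpha * _]mulrC -ler_pdivrMr.
  rewrite (le_trans UL)// lerBrDr -[X in _ + X](mulVKf (lt0r_neq0 alpha0)) -mulrDr.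
  by rewrite addrC mulrC ler_wpM2r ?(ltW alpha0)// ltW.
have FF : c / 2 <= x `^ beta * Fbar x.
  by have := H2 x xx2; rewrite ler_norml => /andP[]; lra.
have F0 : 0 < Fbar x.
  by rewrite -(pmulr_rgt0 _ xb0) (lt_le_trans _ FF)// divr_gt0.
have := H1 x xx1 (n x) ZV; rewrite -mulrBr => HF.
have -> : 1 - tail P (D (n x)) x / Fbar x = (Fbar x - p (n x) x) / Fbar x.
  by rewrite /p; field; rewrite gt_eqF.
have pF : 0 <= Fbar x - p (n x) x.
  by rewrite subr_ge0; exact: tail_le_limit.
rewrite ger0_norm ?divr_ge0 ?(ltW F0)// ler_pdivrMr// -(ler_pM2l xb0) (le_trans HF)//.
by rewrite [leRHS]mulrCA ler_wpM2l// ltW.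
Unshelve. all: by end_near. Qed.

End perpetuity_profile.

(** * Consequences of the moment assumptions *)

Section cramer_moments.
Context {d} {T : measurableType d} {R : realType} (P : probability T R).
Variables (xi : T -> R) (beta alpha sigma2 : R).
Hypotheses (mxi : measurable_fun setT xi) (beta0 : 0 < beta).
Hypothesis w_total : (\int[P]_t (expR (beta * xi t))%:E = 1)%E.
Hypothesis w_first : (\int[P]_t (xi t * expR (beta * xi t))%:E = alpha%:E)%E.
Hypothesis w_second : (\int[P]_t (xi t ^+ 2 * expR (beta * xi t))%:E - (alpha ^+ 2)%:E
  = sigma2%:E)%E.
Hypothesis xi_pos : (0 < P [set t | (0 < xi t)%R])%E.

Let w t := expR (beta * xi t).
Let w0 t : 0 <= w t. Proof. exact: expR_ge0. Qed.
Let mw : measurable_fun setT w. Proof. by rewrite /w; solve_measurable. Qed.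

Let second : (\int[P]_t (w t * xi t ^+ 2)%:E = (sigma2 + alpha ^+ 2)%:E)%E.
Proof.
under eq_integral do rewrite mulrC.
by rewrite EFinD -w_second subeK.
Qed.

Let iw : P.-integrable setT (fun t => (w t)%:E).
Proof. by apply: ge0_integrable_EFin => //; rewrite w_total ltry. Qed.

Let iw2 : P.-integrable setT (fun t => (w t * xi t ^+ 2)%:E).
Proof.
apply: ge0_integrable_EFin; [| |by rewrite second ltry].
- by apply: measurable_funM => //; exact: measurable_funX.
- by move=> t; rewrite mulr_ge0// sqr_ge0.
Qed.

Let iw1 : P.-integrable setT (fun t => (w t * xi t)%:E).
Proof. exact: integrable_weighted_first_moment. Qed.

Let first : (\int[P]_t (w t * xi t)%:E = alpha%:E)%E.
Proof. by under eq_integral do rewrite mulrC. Qed.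

Lemma tilted_centered_mean : (\int[P]_t (expR (beta * xi t) * (xi t - alpha))%:E = 0)%E.
Proof.
have E t : (expR (beta * xi t) * (xi t - alpha))%:E =
    ((w t * xi t)%:E + (- alpha)%:E * (w t)%:E)%E.
  by rewrite -!EFinM -!EFinD /w; congr (_%:E); ring.
under eq_integral do rewrite E.
have i1 : P.-integrable setT (fun t => ((- alpha)%:E * (w t)%:E)%E).
  exact: integrableZl.
rewrite integralD// integralZl// first w_total mule1 -EFinD.
by rewrite subrr.
Qed.

Lemma tilted_variance :
  (\int[P]_t (expR (beta * xi t) * (xi t - alpha) ^+ 2)%:E = sigma2%:E)%E.
Proof.
have E t : (expR (beta * xi t) * (xi t - alpha) ^+ 2)%:E = ((w t * xi t ^+ 2)%:E +
    ((- (2 * alpha))%:E * (w t * xi t)%:E + (alpha ^+ 2)%:E * (w t)%:E))%E.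
  by rewrite -!EFinM -!EFinD /w; congr (_%:E); ring.
under eq_integral do rewrite E.
have i1 : P.-integrable setT (fun t => ((- (2 * alpha))%:E * (w t * xi t)%:E)%E).
  exact: integrableZl.
have i2 : P.-integrable setT (fun t => ((alpha ^+ 2)%:E * (w t)%:E)%E).
  exact: integrableZl.
rewrite integralD//; last exact: integrableD.
rewrite integralD// !integralZl// second first w_total mule1 -EFinM -!EFinD.
by congr (_%:E); ring.
Qed.

(** With w = e^{beta xi}, the function w ln w - w + 1 is nonnegative and vanishes only where xi = 0.
    Its expectation, the relative entropy of the tilted law, is beta alpha. *)
Lemma tilted_mean_gt0 : 0 < alpha.
Proof.
pose f t := w t * (beta * xi t) - w t + 1.
have f_ge t : beta * xi t != 0 -> 0 < f t.
  move=> x0; have := expR_gt1Dx _ (x := - (beta * xi t)).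
  rewrite oppr_eq0 => /(_ x0); rewrite expRN -(ltr_pM2l (expR_gt0 (beta * xi t))).
  by rewrite divff ?gt_eqF ?expR_gt0// /f /w; lra.
have f0 t : 0 <= f t.
  have [/eqP xi0|/f_ge/ltW//] := boolP (beta * xi t == 0).
  by rewrite /f /w xi0 expR0; lra.
have mf : measurable_fun setT f.
  by apply: measurable_funD => //; apply: measurable_funB => //; apply: measurable_funM => //;
    exact: measurable_funM.
have := expectation_gt0 P xi mxi xi_pos f mf f0.
have -> : (\int[P]_t (f t)%:E = (beta * alpha)%:E)%E.
  have E t : (f t)%:E = (beta%:E * (w t * xi t)%:E + ((- 1)%:E * (w t)%:E + 1%:E))%E.
    by rewrite -!EFinM -!EFinD /f; congr (_%:E); ring.
  under eq_integral do rewrite E.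
  have i1 : P.-integrable setT (fun t => (beta%:E * (w t * xi t)%:E)%E).
    exact: integrableZl.
  have i2 : P.-integrable setT (fun t => ((- 1)%:E * (w t)%:E)%E).
    exact: integrableZl.
  have i3 : P.-integrable setT (fun t : T => 1%:E).
    exact: finite_measure_integrable_cst.
  rewrite integralD//; last exact: integrableD.
  have e3 : (\int[P]_t 1%:E = 1)%E.
    by rewrite integral_cst// mul1e; exact: probability_setT.
  rewrite integralD// !integralZl// first w_total e3 !mule1 -EFinM -!EFinD.
  by congr (_%:E); ring.
rewrite lte_fin pmulr_rgt0//; apply => t xt0.
by apply: f_ge; rewrite mulf_neq0 ?gt_eqF.
Qed.

Lemma tilted_variance_ge0 : 0 <= sigma2.
Proof.
rewrite -lee_fin -tilted_variance; apply: integral_ge0 => t _.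
by rewrite lee_fin mulr_ge0 ?expR_ge0 ?sqr_ge0.
Qed.

(** The weight is positive, so zero tilted variance forces xi = alpha almost surely; as alpha > 0,
    xi would then be lattice with span alpha. *)
Lemma tilted_variance_gt0 : ~ lattice P xi -> 0 < sigma2.
Proof.
move=> nlat; rewrite lt_neqAle tilted_variance_ge0 andbT; apply/eqP => s0.
apply: nlat; exists alpha; first exact: tilted_mean_gt0.
have mf : measurable_fun setT (fun t => (w t * (xi t - alpha) ^+ 2)%:E).
  apply/measurable_EFinP; apply: measurable_funM => //; apply: measurable_funX.
  exact: measurable_funB.
have : (\int[P]_t `|(w t * (xi t - alpha) ^+ 2)%:E| = 0)%E.
  have E t : `|(w t * (xi t - alpha) ^+ 2)%:E|%E = (w t * (xi t - alpha) ^+ 2)%:E.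
    by rewrite gee0_abs// lee_fin mulr_ge0// sqr_ge0.
  under eq_integral do rewrite E.
  by rewrite tilted_variance -s0.
move=> /(ae_eq_integral_abs P measurableT mf).
apply: filterS => t /(_ I) [/eqP].
rewrite mulf_eq0 gt_eqF ?expR_gt0//= sqrf_eq0 subr_eq0 => /eqP ->.
by exists 1%Z; rewrite mulr1.
Qed.

End cramer_moments.

(** * Measurability and tails of random series *)

Section limits_of_measurable.
Context {d} {T : measurableType d} {R : realType}.

Lemma cvg_einf_esup (u : (\bar R)^nat) : limn_einf u = limn_esup u -> cvgn u.
Proof.
move=> ulu; apply/cvg_ex; exists (limn_esup u).
apply: (@squeeze_cvge _ _ _ _ (einfs u) _ (esups u)).
- near=> n; apply/andP; split.
  + by apply: ereal_inf_lbound; exists n => //=.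
  + by apply: ereal_sup_ubound; exists n => //=.
- by rewrite -ulu limn_einf_lim; exact: is_cvg_einfs.
- by rewrite limn_esup_lim; exact: is_cvg_esups.
Unshelve. all: by end_near. Qed.

(* [limn] is [point] where the sequence diverges.  Measurability matters because a
   measure takes arbitrary values on nonmeasurable sets, so [etail] need not
   respect almost sure equality there. *)
Lemma measurable_limn (f : nat -> T -> \bar R) : (forall n, measurable_fun setT (f n)) ->
  measurable_fun setT (fun t => limn (f ^~ t)).
Proof.
move=> mf; rewrite (_ : (fun t => _) = fun t =>
    if limn_einf (f ^~ t) == limn_esup (f ^~ t) then limn_esup (f ^~ t) else point); last first.
  apply/funext => t; case: eqP => [/cvg_einf_esup/is_cvg_limn_esupE->//|ne].
  apply: xgetPN => l fl; apply: ne.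
  by have [-> ->] := cvg_limn_einf_sup fl.
have msup := measurable_fun_limn_esup mf.
apply: measurable_fun_ifT => //; apply: measurable_fun_eqe => //.
rewrite /limn_einf; apply: measurableT_comp; first exact: oppe_measurable.
by apply: measurable_fun_limn_esup => n; apply: measurableT_comp.
Qed.

End limits_of_measurable.

Section random_series.
Context {d} {T : measurableType d} {R : realType} (P : probability T R).
Implicit Types a b : nat -> T -> R.

Let measurable_series_gt a (x : R) : (forall k, measurable_fun setT (a k)) ->
  measurable [set t | (x%:E < \sum_(0 <= k <oo) (a k t)%:E)%E].
Proof.
move=> ma; rewrite -[X in measurable X]setTI.
apply: measurable_lte => //.
apply: measurable_limn => n.
by apply: emeasurable_sum => k; apply/measurable_EFinP.
Qed.

Lemma ae_eq_measure (A B : set T) : measurable A -> measurable B ->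
  {ae P, forall t, A t <-> B t} -> P A = P B.
Proof.
move=> mA mB [N [mN PN0 sub]].
have H (X Y : set T) : measurable X -> measurable Y -> (X `<=` Y `|` N) -> (P X <= P Y)%E.
  move=> mX mY XY; rewrite -[leRHS]adde0 -PN0 (le_trans _ (measureU2 _ _ _))//.
  by apply: le_measure; rewrite ?inE//; exact: measurableU.
apply/eqP; rewrite eq_le; apply/andP; split; apply: H => // t Xt.
  have [Nt|Nt] := pselect (N t); [by right|left].
  by have /(_ Xt) : A t -> B t by apply: contra_notP Nt => nAB; apply: sub => /= -[].
have [Nt|Nt] := pselect (N t); [by right|left].
by have /(_ Xt) : B t -> A t by apply: contra_notP Nt => nAB; apply: sub => /= -[].
Qed.

Lemma ae_eq_etail_series a b x : (forall k, measurable_fun setT (a k)) ->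
  (forall k, measurable_fun setT (b k)) -> {ae P, forall t, forall k, a k t = b k t} ->
  etail P (fun t => \sum_(0 <= k <oo) (a k t)%:E)%E x =
  etail P (fun t => \sum_(0 <= k <oo) (b k t)%:E)%E x.
Proof.
move=> ma mb ab; congr fine; apply: ae_eq_measure; [exact: measurable_series_gt..|].
apply: filterS ab => t ab /=.
by under eq_eseriesr do rewrite ab.
Qed.

Lemma ae_eq_tail_sum a b n x : (forall k, measurable_fun setT (a k)) ->
  (forall k, measurable_fun setT (b k)) -> {ae P, forall t, forall k, a k t = b k t} ->
  tail P (fun t => \sum_(k < n) a k t) x = tail P (fun t => \sum_(k < n) b k t) x.
Proof.
move=> ma mb ab; congr fine; apply: ae_eq_measure.
- by apply: (measurable_set_lt (cst x) (fun t => \sum_(k < n) a k t)) => //; exact: measurable_sum.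
- by apply: (measurable_set_lt (cst x) (fun t => \sum_(k < n) b k t)) => //; exact: measurable_sum.
apply: filterS ab => t ab /=.
by under eq_bigr do rewrite ab.
Qed.

(** The strict inequality matters: a nonnegative series exceeds x exactly when some partial sum
    does, so the events increase to the limit event and continuity from below applies. *)
Lemma cvg_tail_series a x : (forall k, measurable_fun setT (a k)) ->
  (forall k t, 0 <= a k t) ->
  tail P (fun t => \sum_(k < m) a k t) x @[m --> \oo] -->
  etail P (fun t => \sum_(0 <= k <oo) (a k t)%:E)%E x.
Proof.
move=> ma a0; pose F m := [set t | x < \sum_(k < m) a k t].
have mF m : measurable (F m).
  by apply: (measurable_set_lt (cst x) (fun t => \sum_(k < m) a k t)) => //; exact: measurable_sum.
have cupF : \bigcup_m F m = [set t | (x%:E < \sum_(0 <= k <oo) (a k t)%:E)%E].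
  apply/seteqP; split => [t [m _ xm]|t /=].
    rewrite /= (@lt_le_trans _ _ (\sum_(0 <= k < m) (a k t)%:E)%E)//.
      by rewrite sumEFin lte_fin big_mkord.
    by apply: nneseries_lim_ge => k _ _; rewrite lee_fin.
  apply: contraPP => nF; apply/negP; rewrite -leNgt.
  apply: lime_le; first by apply: is_cvg_nneseries => k _ _; rewrite lee_fin.
  apply: nearW => m; rewrite sumEFin lee_fin big_mkord leNgt; apply/negP => xm.
  by apply: nF; exists m.
have mcup := measurable_series_gt a x ma.
apply: fine_cvg; rewrite fineK ?fin_num_measure//.
rewrite -cupF in mcup *; apply: nondecreasing_cvg_mu => // m k mk.
apply/subsetPset => t /= /lt_le_trans; apply.
rewrite -!(big_mkord xpredT (fun k => a k t)) (@big_cat_nat _ _ _ m 0 k)//= lerDl.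
by apply: sumr_ge0 => i _.
Qed.

End random_series.

(** * The perpetuity of an i.i.d. sequence *)

Section iid_perpetuity.
Context {d} {T : measurableType d} {R : realType} (P : probability T R).
Variables (xi zeta : T -> R) (xis zetas : nat -> T -> R) (beta alpha sigma2 : R).
Hypotheses (mxi : measurable_fun setT xi) (mzeta : measurable_fun setT zeta).
Hypotheses (mxis : forall k, measurable_fun setT (xis k))
  (mzetas : forall k, measurable_fun setT (zetas k)).
Hypothesis copies : forall k,
  same_law P (fun t => (xis k t, zetas k t)) (fun t => (xi t, zeta t)).
Hypothesis indep : independent_seq P (fun k t => (xis k t, zetas k t)).
Hypotheses (zeta_ge0 : forall t, 0 <= zeta t) (zetas_ge0 : forall k t, 0 <= zetas k t)
  (zeta_gt0 : {ae P, forall t, 0 < zeta t}).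
Hypotheses (beta0 : 0 < beta) (nonlattice : ~ lattice P xi)
  (xi_pos : (0 < P [set t | (0 < xi t)%R])%E).
Hypothesis w_total : (\int[P]_t (expR (beta * xi t))%:E = 1)%E.
Hypothesis w_first : (\int[P]_t (xi t * expR (beta * xi t))%:E = alpha%:E)%E.
Hypothesis w_second : (\int[P]_t (xi t ^+ 2 * expR (beta * xi t))%:E - (alpha ^+ 2)%:E
  = sigma2%:E)%E.
Hypothesis zeta_beta : (\int[P]_t (zeta t `^ beta)%:E < +oo)%E.

Let S := walk xis.
Let D := perp_tilde xis zetas.

Lemma walk0 t : walk xis 0 t = 0.
Proof. by rewrite /walk big_ord0. Qed.

Lemma walkS n t : walk xis n.+1 t = walk xis n t + xis n t.
Proof. by rewrite /walk big_ord_recr. Qed.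

Lemma measurable_walk n : measurable_fun setT (walk xis n).
Proof. exact: measurable_sum. Qed.

Let mterm k : measurable_fun setT (fun t => zetas k t * expR (walk xis k t)).
Proof. by have mS := measurable_walk; solve_measurable. Qed.

Let term_ge0 k t : 0 <= zetas k t * expR (walk xis k t).
Proof. by rewrite mulr_ge0 ?expR_ge0. Qed.

Let D0 t : D 0 t = 0.
Proof. by rewrite /D /perp_tilde big_ord0. Qed.

Let DS n t : D n.+1 t = D n t + zetas n t * expR (S n t).
Proof. by rewrite /D /perp_tilde big_ord_recr. Qed.

Let mD n : measurable_fun setT (D n).
Proof. exact: measurable_sum. Qed.

Let D_ge0 n t : 0 <= D n t.
Proof. by apply: sumr_ge0. Qed.

Let D_nd n t : D n t <= D n.+1 t.
Proof. by rewrite DS lerDl. Qed.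

Let lawM n (g : R * R -> \bar R) : measurable_fun setT g ->
  (forall p, 0 <= g p)%E ->
  (\int[P]_t g (S n.+1 t, D n.+1 t) =
   \int[P]_t \int[P]_t' g (S n t + xi t', D n t + zeta t' * expR (S n t))%R)%E.
Proof.
move=> mg g0.
pose phi (q : (R * R) * (R * R)) : R * R :=
  (q.1.1 + q.2.1, q.1.2 + q.2.2 * expR q.1.1).
have mZ k : measurable_fun setT (fun t => (xis k t, zetas k t)).
  exact: measurable_fun_pair.
have mZ0 : measurable_fun setT (fun t => (xi t, zeta t)) by exact: measurable_fun_pair.
have mphi : measurable_fun setT phi by rewrite /phi; solve_measurable.
apply: (recursion_law P (fun k t => (xis k t, zetas k t)) (fun t => (xi t, zeta t)) phi
  (fun n t => (S n t, D n t)) (0, 0) mZ mZ0 mphi indep copies _ _ n g mg g0).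
- by move=> t; rewrite /S walk0 D0.
- by move=> k t; rewrite /phi /= DS /S walkS.
Qed.

Let sigma2_gt0 : 0 < sigma2.
Proof. exact: (tilted_variance_gt0 P xi beta alpha sigma2). Qed.

Let sqrt_sigma2 : Num.sqrt sigma2 ^+ 2 = sigma2.
Proof. by rewrite sqr_sqrtr// ltW. Qed.

Let alpha_gt0 : 0 < alpha.
Proof. exact: (tilted_mean_gt0 P xi beta alpha sigma2). Qed.

Let w_var :
  (\int[P]_t (expR (beta * xi t) * (xi t - alpha) ^+ 2)%:E = (Num.sqrt sigma2 ^+ 2)%:E)%E.
Proof. by rewrite sqrt_sigma2; exact: tilted_variance. Qed.

Let w_mean : (\int[P]_t (expR (beta * xi t) * (xi t - alpha))%:E = 0)%E.
Proof. exact: (tilted_centered_mean P xi beta alpha sigma2). Qed.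

Let cvF y : tail P (D m) y @[m --> \oo] --> etail P (perp_tilde_oo xis zetas) y.
Proof. exact: (cvg_tail_series P _ y mterm term_ge0). Qed.

Theorem iid_perpetuity_tail c : 0 < c ->
  sim (etail P (perp_tilde_oo xis zetas)) (fun x => c / x `^ beta) ->
  uniform_normal_tail P (perp_tilde xis zetas) alpha sigma2 beta c /\
  late_tail_equivalence P (perp_tilde xis zetas) (perp_tilde_oo xis zetas) alpha.
Proof.
move=> c0 Fsim; have s0 : 0 < Num.sqrt sigma2 by rewrite sqrtr_gt0.
have S0 : forall t, S 0 t = 0 by exact: walk0.
split.
  move=> e e0.
  exact: (perpetuity_uniform_tail P xi zeta S D beta alpha (Num.sqrt sigma2) mxi mzeta
    measurable_walk mD zeta_ge0 zeta_gt0 S0 D0 D_ge0 D_nd lawM beta0 alpha_gt0 s0 w_total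
    w_mean w_var zeta_beta xi_pos _ c cvF c0 Fsim e e0).
move=> U Uoo n nU.
exact: (perpetuity_late_tail P xi zeta S D beta alpha (Num.sqrt sigma2) mxi mzeta
  measurable_walk mD zeta_ge0 zeta_gt0 S0 D0 D_ge0 D_nd lawM beta0 alpha_gt0 s0 w_total
  w_mean w_var zeta_beta xi_pos _ c cvF c0 Fsim U n Uoo nU).
Qed.

End iid_perpetuity.

(** * Transfer to the given sequence *)

Section measurable_image.
Context {d d' d''} {T : measurableType d} {T' : measurableType d'} {T'' : measurableType d''}.
Context {R : realType} (P : probability T R) (psi : T' -> T'') (mpsi : measurable_fun setT psi).

Let mpreim (A : set T'') : measurable A -> measurable (psi @^-1` A).
Proof. by move=> mA; rewrite -[X in measurable X]setTI; exact: mpsi. Qed.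

Lemma same_law_comp (X Y : T -> T') : same_law P X Y -> same_law P (psi \o X) (psi \o Y).
Proof. by move=> XY A mA; exact: (XY _ (mpreim A mA)). Qed.

Lemma independent_seq_comp (X : nat -> T -> T') : independent_seq P X ->
  independent_seq P (fun k => psi \o X k).
Proof.
move=> iX J A uJ mA.
exact: (iX J (fun k => psi @^-1` A k) uJ (fun k => mpreim _ (mA k))).
Qed.

End measurable_image.

Section copies.
Context {d} {T : measurableType d} {R : realType} (P : probability T R).
Variables (xi eta : T -> R) (xis etas : nat -> T -> R).
Hypotheses (mxi : measurable_fun setT xi) (meta : measurable_fun setT eta).
Hypotheses (mxis : forall k, measurable_fun setT (xis k))
  (metas : forall k, measurable_fun setT (etas k)).
Hypothesis copies : forall k,
  same_law P (fun t => (xis k t, etas k t)) (fun t => (xi t, eta t)).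
Hypothesis indep : independent_seq P (fun k t => (xis k t, etas k t)).
Hypothesis eta_pos : {ae P, forall t, 0 < eta t}.

(** Almost sure positivity is a property of the law, and countably many null sets have a null
    union. *)
Lemma ae_copies_gt0 : {ae P, forall t, forall k, 0 < etas k t}.
Proof.
apply: ae_foralln => k.
have mA (f : T -> R) : measurable_fun setT f -> measurable [set t | f t <= 0].
  by move=> mf; apply: (measurable_set_le f (cst 0)).
have nonpos (f : T -> R) : ~` [set t | 0 < f t] = [set t | f t <= 0].
  by apply/seteqP; split => t /=; rewrite leNgt => /negP.
rewrite /prop_near1 /nbhs/= /almost_everywhere/= nonpos; apply/negligibleP; first exact: mA.
have mB : measurable [set p : R * R | p.2 <= 0].
  exact: (measurable_set_le (fun p : R * R => p.2) (cst 0) measurable_snd (measurable_cst _)).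
apply: etrans (copies k _ mB) _; apply/negligibleP; first exact: mA.
by have := eta_pos; rewrite /prop_near1 /nbhs/= /almost_everywhere/= nonpos.
Qed.

Variables (beta alpha sigma2 : R).
Hypotheses (beta0 : 0 < beta) (nonlattice : ~ lattice P xi)
  (xi_pos : (0 < P [set t | (0 < xi t)%R])%E).
Hypothesis w_total : (\int[P]_t (expR (beta * xi t))%:E = 1)%E.
Hypothesis w_first : (\int[P]_t (xi t * expR (beta * xi t))%:E = alpha%:E)%E.
Hypothesis w_second : (\int[P]_t (xi t ^+ 2 * expR (beta * xi t))%:E - (alpha ^+ 2)%:E
  = sigma2%:E)%E.

(* [psi] maps [(xi, eta)] to the coefficient of [e^{S_{k-1}}]; it is nonnegative
   everywhere, whereas [eta] is only almost surely positive. *)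
Lemma perpetuity_tail_of_copies (psi : R * R -> R) (f : T -> R) (a : nat -> T -> R) :
  measurable_fun setT psi -> (forall p, 0 <= psi p) ->
  {ae P, forall t, 0 < psi (xi t, eta t)} ->
  measurable_fun setT f -> (forall t, 0 <= f t) ->
  {ae P, forall t, f t = psi (xi t, eta t) `^ beta} ->
  (\int[P]_t (f t)%:E < +oo)%E ->
  (forall k, measurable_fun setT (a k)) ->
  {ae P, forall t, forall k, a k t = psi (xis k t, etas k t) * expR (walk xis k t)} ->
  forall c, 0 < c ->
  sim (etail P (fun t => \sum_(0 <= k <oo) (a k t)%:E)%E) (fun x => c / x `^ beta) ->
  uniform_normal_tail P (fun n t => \sum_(k < n) a k t) alpha sigma2 beta c /\
  late_tail_equivalence P (fun n t => \sum_(k < n) a k t)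
    (fun t => \sum_(0 <= k <oo) (a k t)%:E)%E alpha.
Proof.
move=> mpsi psi0 psi_pos mf f0 fpsi f_lty ma aE c c0.
pose zetas k t := psi (xis k t, etas k t); pose zeta t := psi (xi t, eta t).
have mzetas k : measurable_fun setT (zetas k).
  exact: (measurableT_comp mpsi (measurable_fun_pair (mxis k) (metas k))).
have mzeta : measurable_fun setT zeta.
  exact: (measurableT_comp mpsi (measurable_fun_pair mxi meta)).
pose b k t := zetas k t * expR (walk xis k t).
have mb k : measurable_fun setT (b k).
  have mS := measurable_walk _ mxis; have mz := mzetas; rewrite /b; clearbody zetas.
  by solve_measurable.
have tailE n x : tail P (fun t => \sum_(k < n) a k t) x = tail P (perp_tilde xis zetas n) x.
  exact: (ae_eq_tail_sum P a b).
have etailE : etail P (fun t => \sum_(0 <= k <oo) (a k t)%:E)%E =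
    etail P (perp_tilde_oo xis zetas).
  by apply/funext => x; exact: (ae_eq_etail_series P a b).
have mpsi2 : measurable_fun setT (fun p : R * R => (p.1, psi p)).
  by apply: measurable_fun_pair.
(* The moment bound is given for [f], which is known to agree with the power of [zeta] only almost
   everywhere. *)
have zeta_beta : (\int[P]_t (zeta t `^ beta)%:E < +oo)%E.
  rewrite (_ : (\int[P]_t _)%E = (\int[P]_t (f t)%:E)%E)//.
  apply: ge0_ae_eq_integral => //.
  - by solve_measurable.
  - exact/measurable_EFinP.
  - by move=> t _; rewrite lee_fin powR_ge0.
  - by move=> t _; rewrite lee_fin.
  - by apply: filterS fpsi => t -> _.
rewrite etailE => Fsim.
have [unif late] := iid_perpetuity_tail P xi zeta xis zetas beta alpha sigma2 mxi mzeta mxis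
  mzetas (fun k => same_law_comp P _ mpsi2 _ _ (copies k))
  (independent_seq_comp P _ mpsi2 _ indep) (fun=> psi0 _) (fun _ _ => psi0 _) psi_pos
  beta0 nonlattice xi_pos w_total w_first w_second zeta_beta c c0 Fsim.
split=> [e /unif|U Uoo n /(late U Uoo n)].
  by apply: filterS => x H n; rewrite tailE.
by rewrite etailE; under [X in _ -> sim X _]eq_fun do rewrite tailE.
Qed.

End copies.

Theorem theorem6 (R : realType) (d : measure_display) (T : measurableType d)
  (P : probability T R)
  (xi eta : {RV P >-> R}) (xis etas : nat -> {RV P >-> R})
  (hcopies : forall k : nat,
    same_law P (fun t => (xis k t, etas k t)) (fun t => (xi t, eta t)))
  (hindep : independent_seq P (fun k t => (xis k t, etas k t)))
  (hxi_pos : (0 < P [set t | (0 < xi t)%R])%E)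
  (heta_pos : {ae P, forall t, 0 < eta t})
  (hnonlattice : ~ lattice P xi)
  (beta : R) (hbeta : 0 < beta)
  (hcramer : ('E_P[fun t => expR (beta * xi t)%R] = 1)%E)
  (alpha : R)
  (halpha : ('E_P[fun t => (xi t * expR (beta * xi t))%R] = alpha%:E)%E)
  (sigma2 : R)
  (hsigma2 : ('E_P[fun t => (xi t ^+ 2 * expR (beta * xi t))%R]
              - (alpha ^+ 2)%:E = sigma2%:E)%E) :
  (('E_P[fun t => (expR (beta * xi t) * eta t `^ beta)%R] < +oo)%E ->
   ('E_P[fun t => (`|xi t| * expR (beta * xi t) * eta t `^ beta)%R] < +oo)%E ->
   ('E_P[fun t => ((Num.max (xi t) 0 + ln (1 + eta t)) ^+ 2
                   * expR (beta * Num.max (xi t) 0)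
                   * (1 + eta t) `^ beta)%R] < +oo)%E ->
   forall c : R, 0 < c ->
   sim (etail P (perp_oo xis etas)) (fun x => c / x `^ beta) ->
   uniform_normal_tail P (perp xis etas) alpha sigma2 beta c /\
   late_tail_equivalence P (perp xis etas) (perp_oo xis etas) alpha)
  /\
  (('E_P[fun t => (eta t `^ beta)%R] < +oo)%E ->
   ('E_P[fun t => (`|xi t| * eta t `^ beta)%R] < +oo)%E ->
   ('E_P[fun t => (eta t `^ beta * ln (1 + eta t) ^+ 2)%R] < +oo)%E ->
   forall c : R, 0 < c ->
   sim (etail P (perp_tilde_oo xis etas)) (fun x => c / x `^ beta) ->
   uniform_normal_tail P (perp_tilde xis etas) alpha sigma2 beta c /\
   late_tail_equivalence P (perp_tilde xis etas) (perp_tilde_oo xis etas) alpha).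
Proof.
rewrite unlock in hcramer halpha hsigma2; rewrite unlock.
have mxi : measurable_fun setT xi by exact: measurable_funPT.
have meta : measurable_fun setT eta by exact: measurable_funPT.
have mxis k : measurable_fun setT (xis k) by exact: measurable_funPT.
have metas k : measurable_fun setT (etas k) by exact: measurable_funPT.
have mS := measurable_walk (fun k => xis k : T -> R) mxis.
have etas_pos := ae_copies_gt0 P xi eta (fun k => xis k) (fun k => etas k) meta metas
  hcopies heta_pos.
have mnorm : measurable_fun setT (fun p : R * R => `|p.2|).
  by apply: measurableT_comp; [exact: normr_measurable|exact: measurable_snd].
have core := perpetuity_tail_of_copies P xi eta (fun k => xis k) (fun k => etas k)
  mxi meta mxis metas hcopies hindep beta alpha sigma2 hbeta hnonlattice hxi_pos hcramer
  halpha hsigma2.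
pose S := walk (fun k => xis k : T -> R).
split=> [hf _ _ c c0|hf _ _ c c0].
(* Since S_{k+1} = S_k + [xis k], the coefficient of e^{S_k} is eta e^{xi}, and its power beta is
   the integrand e^{beta xi} eta^beta of the moment condition. The absolute value makes it
   nonnegative everywhere. *)
- have psi_pos : {ae P, forall t, 0 < `|eta t| * expR (xi t)}.
    by apply: filterS heta_pos => t eta0; rewrite mulr_gt0 ?expR_gt0// normr_gt0 gt_eqF.
  have powE : {ae P, forall t, expR (beta * xi t) * eta t `^ beta =
      (`|eta t| * expR (xi t)) `^ beta}.
    apply: filterS heta_pos => t eta0.
    by rewrite powRM ?expR_ge0// powR_expR gtr0_norm// mulrC.
  have termE : {ae P, forall t, forall k, etas k t * expR (S k.+1 t) =
      `|etas k t| * expR (xis k t) * expR (S k t)}.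
    apply: filterS etas_pos => t etas0 k.
    by rewrite gtr0_norm// /S walkS addrC expRD mulrA.
  apply: (core (fun p => `|p.2| * expR p.1) (fun t => expR (beta * xi t) * eta t `^ beta)
    (fun k t => etas k t * expR (S k.+1 t)) _ _ psi_pos _ _ powE hf _ termE c c0).
  + by solve_measurable.
  + by move=> p; rewrite mulr_ge0 ?expR_ge0.
  + by solve_measurable.
  + by move=> t; rewrite mulr_ge0 ?expR_ge0 ?powR_ge0.
  + move=> k; have mSk := mS k.+1; have mek := metas k; rewrite /S; solve_measurable.
- have psi_pos : {ae P, forall t, 0 < `|eta t|}.
    by apply: filterS heta_pos => t eta0; rewrite normr_gt0 gt_eqF.
  have powE : {ae P, forall t, eta t `^ beta = `|eta t| `^ beta}.
    by apply: filterS heta_pos => t eta0; rewrite gtr0_norm.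
  have termE : {ae P, forall t, forall k, etas k t * expR (S k t) =
      `|etas k t| * expR (S k t)}.
    by apply: filterS etas_pos => t etas0 k; rewrite gtr0_norm.
  apply: (core (fun p => `|p.2|) (fun t => eta t `^ beta)
    (fun k t => etas k t * expR (S k t)) mnorm _ psi_pos _ _ powE hf _ termE c c0).
  + by move=> p.
  + by solve_measurable.
  + by move=> t; rewrite powR_ge0.
  + by move=> k; have mSk := mS k; have mek := metas k; rewrite /S; solve_measurable.
Qed.
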